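(* Let $k\ge1$ and $\zeta\ge0$ be integers. There exists a $k$-$\gamma_c$-critical graph with exactly $\zeta$ cut-vertices that is not traceable if and only if $k\ge4$ and $0\le\zeta\le k-4$.
   Context: Graphs are finite and simple. For a connected graph $G$, a connected dominating set is a set $S\subseteq V(G)$ such that every vertex outside $S$ has a neighbor in $S$ and $G[S]$ is connected; $\gamma_c(G)$ is the minimum size of such a set. A connected graph $G$ is $k$-$\gamma_c$-critical if $\gamma_c(G)=k$ and $\gamma_c(G+uv)<k$ for every pair of non-adjacent vertices $u,v$. A graph is traceable if it has a hamiltonian path (a path through all vertices). *)

(* Defs.v *)
From mathcomp Require Import all_boot.

Set Implicit Arguments.
Unset Strict Implicit.
Unset Printing Implicit Defensive.

(* A graph is given by its adjacency relation on a finite vertex type. *)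
Definition simple_graph (T : finType) (e : rel T) : Prop :=
  symmetric e /\ irreflexive e.

Definition induced (T : finType) (e : rel T) (S : {set T}) : rel T :=
  [rel x y | [&& x \in S, y \in S & e x y]].

(* Any two vertices of S are joined by a walk inside S. The empty set passes;
   nonemptiness is required separately in [connected_graph]. *)
Definition connected_on (T : finType) (e : rel T) (S : {set T}) : bool :=
  [forall x in S, forall y in S, connect (induced e S) x y].

Definition connected_graph (T : finType) (e : rel T) : bool :=
  (0 < #|T|) && connected_on e setT.

Definition dominating (T : finType) (e : rel T) (S : {set T}) : bool :=
  [forall x, (x \notin S) ==> [exists y in S, e x y]].

Definition conn_dominating (T : finType) (e : rel T) (S : {set T}) : bool :=
  dominating e S && connected_on e S.

(* The starting point [setT] is itself a connected dominating set as soon as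
   the graph is connected; on disconnected graphs the value is irrelevant. *)
Definition gamma_c (T : finType) (e : rel T) : nat :=
  #|[arg min_(S < [set: T] | conn_dominating e S) #|S|]|.

Definition add_edge (T : finType) (e : rel T) (u v : T) : rel T :=
  [rel x y | [|| e x y, (x == u) && (y == v) | (x == v) && (y == u)]].

Definition gamma_c_critical (k : nat) (T : finType) (e : rel T) : Prop :=
  [/\ connected_graph e,
      gamma_c e = k
    & forall u v : T, u != v -> ~~ e u v -> gamma_c (add_edge e u v) < k].

(* Vertices v such that G - v is disconnected. Since the empty set satisfies
   [connected_on], the vertex of a one-vertex graph is not a cut-vertex. *)
Definition cut_vertices (T : finType) (e : rel T) : {set T} :=
  [set v | ~~ connected_on e [set~ v]].

Definition traceable (T : finType) (e : rel T) : Prop :=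
  exists s : seq T, [/\ sorted e s, uniq s & forall x : T, x \in s].

(* Main.v *)
Require Import Defs.
From mathcomp Require Import all_boot.
From mathcomp Require Import zify.

(** The bound three enters by counting. After an edge is added, the new set keeps at most two
    vertices where it may change; if these face an independent set of at least three vertices, they
    are one end of the edge and a vertex adjacent to the whole independent set except the other end.
    Distinct missed members have distinct such vertices, and these are attachments of the component
    that the path misses. So an independent set without neighbours in that component exceeds the
    attachments by at most one, and the predecessors come close to this bound.

    The obstacle is that in an end piece the path must start at a neighbour of the cut-vertex. If
    its first vertex is attached, that vertex has no predecessor and the count loses its tightness;
    the neighbours of the cut-vertex form a clique and offer other starts, which makes up for the
    loss.

    Three pairwise remote sides that share three vertices include two with at most one each, so
    cut-vertices cannot branch.

    In the construction the core costs four only when a gate vertex is required; cheaper sets exist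
    away from the gate, so an edge from the top of the chain to another core vertex lowers the
    total. *)

(* A minimum connected dominating set contains every cut-vertex.  In a critical
   graph two simplicial vertices are adjacent (compare the graph with the edge
   joining them), so two non-adjacent sides of cut-vertices cannot both contain
   at most one vertex of the dominating set that is not a cut-vertex.  If at
   most three vertices of the set are not cut-vertices, this forces the graph to
   decompose at its cut-vertices into cliques and end pieces; in an end piece, or
   in the whole graph if there is no cut-vertex, the predecessors on a longest
   path of the neighbours of a component it misses form an independent set, and
   criticality applied to pairs of that set yields a longer path.  Hence a
   non-traceable critical graph has k >= zeta + 4.

   Conversely, a chain of cliques of size one or two, consecutive cliques being
   completely joined, is attached to a fixed core on 15 vertices that contributes
   4 to the connected domination number; each one-vertex clique but the first is
   a cut-vertex.  Removing 7 core vertices leaves 9 components, which rules out a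
   hamiltonian path. *)

Set Implicit Arguments.
Unset Strict Implicit.
Unset Printing Implicit Defensive.

(** * Connectivity *)

(* [lia] is slow in the large contexts below. *)
Ltac keepnat :=
  repeat match goal with H : ?P |- _ =>
    lazymatch P with is_true (leq _ _) => fail | @eq nat _ _ => fail | _ => clear H end end.
Ltac nlia := keepnat; lia.

Section Connectivity.
Variables (T : finType) (e : rel T).
Hypothesis symE : symmetric e.
Implicit Types S X Y : {set T}.

Lemma induced_sym S : symmetric (induced e S).
Proof. by move=> x y; rewrite /induced /= symE andbCA. Qed.

(** Trading walks for cuts lets later proofs about modified graphs follow a single edge instead of
    transforming a walk. A walk out of [X] has a first edge leaving [X]; conversely the part of [S]
    reachable from [x] is a cut that no edge leaves. *)
Lemma connected_onP S :
  reflect (forall X, X \subset S -> X != set0 -> X != S ->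
             exists x y, [/\ x \in X, y \in S :\: X & e x y])
          (connected_on e S).
Proof.
apply: (iffP idP) => [cS X sXS /set0Pn[x xX] nXS | cut].
  have /set0Pn[y yD] : S :\: X != set0.
    by apply: contraNneq nXS => /eqP; rewrite setD_eq0 => sSX; rewrite eqEsubset sXS.
  have [yS yX] : y \in S /\ y \notin X by move: yD; rewrite inE => /andP[].
  have /connectP[p pp py] : connect (induced e S) x y.
    by move/forall_inP: cS => /(_ _ (subsetP sXS _ xX))/forall_inP; exact.
  elim: p x xX pp py => [|z p IH] x xX /=.
    by move=> _ yx; rewrite yx xX in yX.
  case/andP=> /and3P[xS zS xz] pz py.
  have [zX|zX] := boolP (z \in X); first exact: IH pz py.
  by exists x, z; rewrite inE zX zS.
apply/forall_inP => x xS; apply/forall_inP => y yS.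
pose X := [set z in S | connect (induced e S) x z].
have [yX|yX] := boolP (y \in X); first by move: yX; rewrite inE => /andP[].
have [||| u [v [uX]]] := cut X.
- by apply/subsetP => z; rewrite inE => /andP[].
- by apply/set0Pn; exists x; rewrite inE xS connect0.
- by apply: contraNneq yX => ->.
rewrite !inE negb_and => /andP[/orP[/negP vS vS'|nc vS] uv]; first by case: vS.
case/negP: nc; move: uX; rewrite inE => /andP[uS xu].
by apply: connect_trans xu (connect1 _); rewrite /induced /= uS vS.
Qed.

(** By symmetry an edge across the complement of [X] is an edge across [X], so only the cuts
    avoiding one chosen vertex need testing. *)
Lemma connected_onP1 S c : c \in S ->
  (forall X, X \subset S -> X != set0 -> c \notin X ->
     exists x y, [/\ x \in X, y \in S :\: X & e x y]) ->
  connected_on e S.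
Proof.
move=> cS cut; apply/connected_onP => X sXS nX0 nXS.
have [cX|cX] := boolP (c \in X); last exact: cut.
have nSX : S :\: X != set0.
  by apply: contraNneq nXS => /eqP; rewrite setD_eq0 => sSX; rewrite eqEsubset sXS.
have [||x [y [xX yD xy]]] := cut (S :\: X) _ nSX; rewrite ?subsetDl ?inE ?cX //.
move: xX yD; rewrite !inE negb_and negbK => /andP[xX xS] /andP[yXS yS].
by rewrite yS orbF in yXS; exists y, x; rewrite symE !inE xX.
Qed.

Lemma connected_on1 x : connected_on e [set x].
Proof.
apply: (@connected_onP1 _ x) => [|X]; first exact: set11.
by rewrite subset1 => /orP[/eqP->|/eqP->]; rewrite ?set11 ?eqxx.
Qed.

Lemma connected_onU S1 S2 x y :
  connected_on e S1 -> connected_on e S2 -> x \in S1 -> y \in S2 ->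
  (x == y) || e x y -> connected_on e (S1 :|: S2).
Proof.
move=> /connected_onP c1 /connected_onP c2 x1 y2 xy.
apply: (@connected_onP1 _ x) => [|X sX nX xX]; first by rewrite inE x1.
have [y'X|y'X] := boolP (y \in X).
  case/orP: xy => [/eqP xy|xy]; first by rewrite xy y'X in xX.
  by exists y, x; rewrite symE !inE xX x1.
have find S' z : S' \subset S1 :|: S2 -> z \in S' -> z \notin X -> X :&: S' != set0 ->
    (forall Y, Y \subset S' -> Y != set0 -> Y != S' ->
      exists x y, [/\ x \in Y, y \in S' :\: Y & e x y]) ->
    exists x y, [/\ x \in X, y \in (S1 :|: S2) :\: X & e x y].
  move=> sS' zS' zX n0 c.
  have [||| u [v [uX vD uv]]] := c (X :&: S'); rewrite ?subsetIr //.
    by apply: contraNneq zX => eq; move: zS'; rewrite -{1}eq inE => /andP[].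
  move: uX vD; rewrite !inE => /andP[uX uS']; rewrite negb_and.
  case/andP=> /orP[vX vS'|/negP nv vS']; last by case: nv.
  by exists u, v; rewrite inE vX (subsetP sS').
have [n1|/negPn/eqP n1] := boolP (X :&: S1 != set0).
  by apply: (find S1 x) => //; exact: subsetUl.
apply: (find S2 y) => //; first exact: subsetUr.
have/set0Pn[z zX] := nX; apply/set0Pn; exists z; rewrite inE zX /=.
move/subsetP: sX => /(_ z zX); rewrite inE => /orP[z1|//].
have : z \in X :&: S1 by rewrite inE zX z1.
by rewrite n1 inE.
Qed.

Lemma connected_onU1 S x y :
  connected_on e S -> x \in S -> e x y -> connected_on e (y |: S).
Proof.
move=> cS xS xy; apply: (@connected_onU _ _ y x) => //; last by rewrite symE xy orbT.
  exact: connected_on1.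
exact: set11.
Qed.

(** Only [c] may have neighbours in [D] outside [S]. A cut of [S] that avoids [c] is also a cut of
    [D], and the edge leaving it stays in [S]. *)
Lemma connected_on_sub D S c : connected_on e D -> S \subset D -> c \in S ->
  (forall y z, y \in S -> y != c -> z \in D -> e y z -> z \in S) ->
  connected_on e S.
Proof.
move=> /connected_onP cD sSD cS clo; apply: (@connected_onP1 _ c) => // X sX nX cX.
have [||| u [v [uX vD uv]]] := cD X => //; first exact: subset_trans sX sSD.
  by apply: contraNneq cX => ->; exact: subsetP sSD _ cS.
exists u, v; split=> //; move: vD; rewrite !inE => /andP[-> vD].
apply: clo (subsetP sX _ uX) _ vD uv.
by apply: contraNneq cX => <-.
Qed.

(** A walk through [x] can be shortcut, because the two neighbours of [x] that it uses are equal or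
    adjacent. *)
Lemma connected_onD1 D x : connected_on e D ->
  (forall u v, e x u -> e x v -> u != v -> e u v) -> connected_on e (D :\ x).
Proof.
move=> /connected_onP cD simp; apply/connected_onP => X sX nX nXD.
have xX : x \notin X by apply: contraTN (sX) => xX; apply/subsetPn; exists x => //; rewrite !inE eqxx.
have sXD : X \subset D by apply: subset_trans sX (subsetDl _ _).
have [xD|xD] := boolP (x \in D); last first.
  have [||| u [v [uX vD uv]]] := cD X => //.
    by apply: contraNneq nXD => ->; rewrite eqEsubset subsetDl andbT; apply/subsetP=> z zD; rewrite !inE zD andbT; apply: contraNneq xD => <-.
  exists u, v; split=> //; move: vD; rewrite !inE => /andP[-> vD]; rewrite vD andbT /=.
  by apply: contraNneq xD => <-.
have [||| u [v [uX vD uv]]] := cD X => //; first by apply: contraNneq xX => ->.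
have [vx|vx] := eqVneq v x; last first.
  by exists u, v; split=> //; move: vD; rewrite !inE vx.
(* The edge found leads from [u] into [x]. An edge leaving [x |: X] either starts in [X], or starts
   at [x], and then its end and [u] are both neighbours of [x]. *)
have [||| u' [v' [uX' vD' uv']]] := cD (x |: X); rewrite ?subUset ?sub1set ?xD //.
- by apply/set0Pn; exists x; rewrite setU11.
- by apply: contraNneq nXD => <-; rewrite setU1K.
case/setU1P: uX' => [eu'|uX']; last first.
  by exists u', v'; split=> //; move: vD'; rewrite !inE negb_or => /andP[/andP[-> ->] ->].
move: vD'; rewrite !inE negb_or => /andP[/andP[v'x v'X] v'D].
exists u, v'; split; rewrite ?inE ?v'x ?v'X //.
apply: simp; rewrite -?eu' //; first by rewrite eu' -vx symE.
by apply: contraNneq v'X => <-.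
Qed.

End Connectivity.

Section Transfer.
Variables (T : finType) (e e' : rel T).
Implicit Types S : {set T}.

Lemma connected_on_mono S : {in S &, forall x y, e x y -> e' x y} ->
  connected_on e S -> connected_on e' S.
Proof.
move=> sub /forall_inP cS; apply/forall_inP => x xS; apply/forall_inP => y yS.
have := forall_inP (cS x xS) y yS; apply: connect_sub => u v /and3P[uS vS uv].
by apply: connect1; rewrite /induced /= uS vS sub.
Qed.

End Transfer.

(** * Adding one edge *)

Section AddEdge.
Variables (T : finType) (e : rel T).
Hypothesis symE : symmetric e.
Implicit Types S D : {set T}.
Variables u v : T.

Lemma add_edge_sym : symmetric (add_edge e u v).
Proof.
move=> x y; rewrite /add_edge /= symE; congr (_ || _).
by rewrite orbC andbC [X in X || _]andbC; congr (_ || _); rewrite andbC.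
Qed.

Lemma add_edgeC : add_edge e u v =2 add_edge e v u.
Proof. by move=> x y; rewrite /add_edge /= [X in _ || X]orbC. Qed.

Lemma add_edgeW x y : e x y -> add_edge e u v x y.
Proof. by rewrite /add_edge /= => ->. Qed.

Lemma add_edge_neq x y : add_edge e u v x y ->
  ~~ e x y -> (x = u /\ y = v) \/ (x = v /\ y = u).
Proof.
by rewrite /add_edge /= => /orP[->//|/orP[]/andP[/eqP-> /eqP->] _]; [left|right].
Qed.

Lemma add_edge_off x y : x != u -> x != v -> add_edge e u v x y = e x y.
Proof. by rewrite /add_edge /= => /negPf-> /negPf->; rewrite orbF. Qed.

Lemma connected_on_add S : connected_on e S -> connected_on (add_edge e u v) S.
Proof. by apply: connected_on_mono => x y _ _; apply: add_edgeW. Qed.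

Lemma connected_on_addN S : (u \notin S) || (v \notin S) ->
  connected_on (add_edge e u v) S -> connected_on e S.
Proof.
move=> nS; apply: connected_on_mono => x y xS yS /orP[//|].
by case/orP: nS => nS /orP[]/andP[/eqP xe /eqP ye]; rewrite ?xe ?ye in xS yS;
  rewrite ?xS ?yS in nS.
Qed.

(* A common neighbour inside the set makes the new edge superfluous. *)
Lemma connected_on_add_bridge S c : c \in S -> e c u -> e c v ->
  connected_on (add_edge e u v) S -> connected_on e S.
Proof.
move=> cS cu cv /connected_onP cut; apply: (@connected_onP1 _ _ symE _ c) => // X sX nX cX.
have [||| x [y [xX yD xy]]] := cut X => //; first by apply: contraNneq cX => ->.
have [exy|nxy] := boolP (e x y); first by exists x, y.
exists x, c; rewrite !inE cX cS xX; split=> //.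
by case: (add_edge_neq xy nxy) => [[-> _]|[-> _]]; rewrite symE.
Qed.

End AddEdge.

(** * Cut-vertices and simplicial vertices of a critical graph *)

Lemma dominatingP (T : finType) (e : rel T) (D : {set T}) :
  reflect (forall x, x \notin D -> exists2 y, y \in D & e x y) (dominating e D).
Proof.
apply: (iffP forallP) => [dD x xD | dD x].
  by have /exists_inP := implyP (dD x) xD.
by apply/implyP => /dD ?; apply/exists_inP.
Qed.

(* [A] is a union of components of [G - c], and not all of [G - c]. *)
Definition side (T : finType) (e : rel T) (c : T) (A : {set T}) : Prop :=
  [/\ A != set0, c \notin A, ~: (c |: A) != set0
    & forall a b, a \in A -> b \notin A -> e a b -> b = c].

Definition simplicial (T : finType) (e : rel T) (x : T) : Prop :=
  forall u v, e x u -> e x v -> u != v -> e u v.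

(** * Sides of a cut-vertex *)

Section Sides.
Variables (T : finType) (e : rel T).
Hypothesis symE : symmetric e.
Implicit Types A B D X : {set T}.

Lemma side_compl c A : side e c A -> side e c (~: (c |: A)).
Proof.
move=> [nA cA nB clA]; split=> //; first by rewrite !inE eqxx.
  have -> : ~: (c |: ~: (c |: A)) = A; last by [].
  by apply/setP => x; rewrite !inE; case: eqVneq => [->|_] /=; rewrite ?negbK // (negPf cA).
move=> a b; rewrite in_setC in_setU1 negb_or => /andP[ac aA].
rewrite in_setC negbK in_setU1 => /orP[/eqP//|bA] ab.
by rewrite symE in ab; rewrite (clA b a bA aA ab) eqxx in ac.
Qed.

(** If [D] avoided [c], domination would make it meet both sides, and connectedness would give an
    edge of [D] leaving [A], whose far end is [c]. *)
Lemma side_mem c A D : side e c A -> conn_dominating e D -> c \in D.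
Proof.
move=> sA /andP[/dominatingP dD cD]; apply/negPn/negP => ncD.
have out A' : side e c A' -> D :&: A' != set0.
  move=> [/set0Pn[a aA] _ _ clA]; have [aD|/dD[y yD ay]] := boolP (a \in D).
    by apply/set0Pn; exists a; rewrite inE aD.
  apply/set0Pn; exists y; rewrite inE yD; apply: contraNT ncD => yA.
  by rewrite -(clA a y).
have /set0Pn[x] := out _ sA; rewrite inE => /andP[xD xA].
have /set0Pn[y] := out _ (side_compl sA); rewrite !inE negb_or => /and3P[yD yc yA].
have [||| u [v []]] := connected_onP _ _ cD (D :&: A); rewrite ?subsetIl ?out //.
  by apply: contraNneq yA => /setP/(_ y); rewrite inE yD.
rewrite !inE => /andP[_ uA]; rewrite negb_and => /andP[/orP[/negP//|vA] vD] uv.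
by case: sA => _ _ _ clA; rewrite -(clA u v) ?vD in ncD.
Qed.

Lemma side_add c A x y : side e c A ->
  x \in c |: A -> y \in c |: A -> side (add_edge e x y) c A.
Proof.
move=> [nA cA nB clA]; rewrite !in_setU1 => xA yA; split=> // a b aA bA /orP[/clA->//|].
by case/orP=> /andP[/eqP ea /eqP eb]; subst; rewrite (negPf bA) orbF in xA yA; apply/eqP.
Qed.

Lemma side_add_out c A x y : side e c A ->
  x \notin A -> y \notin A -> side (add_edge e x y) c A.
Proof.
move=> [nA cA nB clA] xA yA; split=> // a b aA bA /orP[/clA->//|].
by case/orP=> /andP[/eqP ea /eqP eb]; subst; rewrite aA in xA yA.
Qed.

Lemma side_conn c A D : side e c A -> c \in D -> connected_on e D ->
  connected_on e (c |: (D :&: A)).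
Proof.
move=> [_ _ _ clA] cD cnD; apply: (connected_on_sub symE (c := c) cnD).
- by rewrite subUset sub1set cD subsetIl.
- exact: setU11.
move=> y z; rewrite !inE => /orP[/eqP->|/andP[_ yA] _ zD yz]; first by rewrite eqxx.
by rewrite zD /=; case: (boolP (z \in A)) => [|zA]; rewrite ?orbT // (clA y z) ?eqxx.
Qed.

Lemma side_card c A D : c \notin A -> c \in D ->
  #|D| = (#|D :&: A| + #|D :&: ~: (c |: A)|).+1.
Proof.
move=> cA cD; rewrite (cardsD1 c) cD -(cardsID A (D :\ c)) add1n; congr (_ + _).+1.
  by apply: eq_card => x; rewrite !inE; case: eqVneq => //= ->; rewrite (negPf cA) andbF.
by apply: eq_card => x; rewrite !inE; case: (x == c); case: (x \in A); case: (x \in D).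
Qed.

Lemma cut_verticesP c :
  reflect (exists A, side e c A) (c \in cut_vertices e).
Proof.
rewrite inE; apply: (iffP idP) => [|[A [/set0Pn[a aA] cA /set0Pn[b bA] clA]]].
  case/forall_inPn => x xc /forall_inPn[y yc nxy].
  pose A := [set z in [set~ c] | connect (induced e [set~ c]) x z].
  exists A; split.
  - by apply/set0Pn; exists x; rewrite inE xc connect0.
  - by rewrite !inE eqxx.
  - by apply/set0Pn; exists y; rewrite !inE in yc *; rewrite yc (negPf nxy) orbF.
  move=> a b; rewrite inE => /andP[ac xa] nb ab; apply/eqP/negPn/negP => nbc.
  case/negP: nb; rewrite !inE nbc; apply: connect_trans xa (connect1 _).
  by rewrite /induced /= !inE nbc ab; rewrite !inE in ac; rewrite ac.
apply/negP => /connected_onP cut.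
have ac : a != c by apply: contraNneq cA => <-.
move: bA; rewrite !inE negb_or => /andP[bc bA].
have [||| u [v [uA]]] := cut A.
- by apply/subsetP => z zA; rewrite !inE; apply: contraNneq cA => <-.
- by apply/set0Pn; exists a.
- by apply: contraNneq bA => ->; rewrite !inE.
by rewrite !inE => /andP[vA vc] /(clA _ _ uA vA) vc'; rewrite vc' eqxx in vc.
Qed.

End Sides.

(** Criticality with a fixed minimum set [D0] in place of the number [gamma_c]: the arguments below
    exchange parts of [D0] and compare sizes, so the set itself must be at hand. *)
Definition crit (T : finType) (e : rel T) (D0 : {set T}) : Prop :=
  [/\ simple_graph e, connected_on e setT, conn_dominating e D0,
      forall D, conn_dominating e D -> #|D0| <= #|D|
    & forall u v, u != v -> ~~ e u v ->
        exists2 D, conn_dominating (add_edge e u v) D & #|D| < #|D0|].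

(** * Criticality within a side, and simplicial vertices *)

Section Critical.
Variables (T : finType) (e : rel T) (D0 : {set T}).
Hypothesis critE : crit e D0.
Implicit Types A B D X : {set T}.

Let symE : symmetric e. Proof. by case: critE => -[]. Qed.
Let minD D : conn_dominating e D -> #|D0| <= #|D|.
Proof. by case: critE => _ _ _ H _; exact: H. Qed.

Lemma crit_edge_out X x y : x \in X -> y \notin X ->
  exists u v, [/\ u \in X, v \notin X & e u v].
Proof.
case: critE => _ /connected_onP cut _ _ _ xX yX.
have [||| u [v [uX]]] := cut X; rewrite ?subsetT //.
- by apply/set0Pn; exists x.
- by apply: contraNneq yX => ->; rewrite inE.
by rewrite !inE andbT => vX uv; exists u, v.
Qed.

Lemma side_nbr c A : side e c A -> exists2 a, a \in A & e c a.
Proof.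
move=> [/set0Pn[a aA] cA _ clA].
have [u [v [uA vA uv]]] := crit_edge_out aA cA.
by exists u => //; rewrite symE -(clA u v).
Qed.

(** With the edge [a a'] added, [c] is still a cut-vertex and so lies in every connected dominating
    set. There it dominates both ends and joins them, so the new edge saves nothing. *)
Lemma side_clique c A a a' : side e c A -> a \in A -> a' \in A ->
  e c a -> e c a' -> a != a' -> e a a'.
Proof.
move=> sA aA aA' ca ca' naa'; apply/negPn/negP => nE.
case: (critE) => _ _ _ _ /(_ a a' naa' nE)[D cD ltD].
have cinD : c \in D.
  apply: (side_mem (e := add_edge e a a') (add_edge_sym symE a a') _ cD).
  by apply: (side_add sA); rewrite in_setU1 ?aA ?aA' orbT.
suff /minD : conn_dominating e D by rewrite leqNgt ltD.
case/andP: cD => /dominatingP dD cnD; apply/andP; split; last first.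
  exact: connected_on_add_bridge cinD ca ca' cnD.
apply/dominatingP => x /dD[y yD]; case: (boolP (e x y)) => [xy _|nxy xy]; first by exists y.
by exists c => //; rewrite symE; case: (add_edge_neq xy nxy) => [][-> _].
Qed.

(** Exchanging [D0 :&: A] for [X] gives another connected dominating set, as both parts are glued at
    [c]. *)
Lemma side_replace c A X : side e c A -> X \subset A -> connected_on e (c |: X) ->
  (forall a, a \in A -> a \notin X -> exists2 y, y \in c |: X & e a y) ->
  #|D0 :&: A| <= #|X|.
Proof.
move=> sA sX cX dX; have [_ cA _ clA] := sA.
case: (critE) => _ _ cD0 _ _; have c0 := side_mem symE sA cD0.
case/andP: (cD0) => /dominatingP d0 cn0.
have /minD : conn_dominating e ((D0 :\: A) :|: (c |: X)).
  apply/andP; split; last first.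
    apply: (connected_onU symE (x := c) (y := c)); rewrite ?eqxx ?setU11 ?inE ?cA //.
    have := side_conn symE (side_compl symE sA) c0 cn0; congr (connected_on _ _).
    apply/setP => x; rewrite !inE negb_or; case: eqVneq => //= [->|]; rewrite ?c0 ?cA //.
    by rewrite andbC.
  apply/dominatingP => x; rewrite !inE !negb_or negb_and negbK => /and3P[xA' xc xX].
  have [xA|xA] := boolP (x \in A).
    by have [y yX xy] := dX x xA xX; exists y => //; rewrite inE yX orbT.
  rewrite (negPf xA) in xA'; have [y y0 xy] := d0 x xA'; exists y => //.
  rewrite !inE y0 andbT; case: (boolP (y \in A)) => //= yA.
  by rewrite symE in xy; rewrite (clA y x yA xA xy) eqxx in xc.
have -> : (D0 :\: A) :|: (c |: X) = (D0 :\: A) :|: X.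
  by apply/setP => x; rewrite !inE; case: eqVneq => //= ->; rewrite c0 cA.
rewrite cardsU => le; have := cardsID A D0; nlia.
Qed.

(** An edge with no end in [A] cannot lower the cost inside [A]: what [D] has there already does the
    work of [D0 :&: A] in the old graph. *)
Lemma side_keep c A x y D : side e c A -> x \notin A -> y \notin A -> x != y ->
  conn_dominating (add_edge e x y) D -> #|D0 :&: A| <= #|D :&: A|.
Proof.
move=> sA xA yA nxy cD; have [_ cA _ clA] := sA.
have sA' := side_add_out sA xA yA.
have symE' := add_edge_sym symE x y.
have cinD := side_mem symE' sA' cD.
case/andP: cD => /dominatingP dD cnD.
have offA z : z \in A -> z != x /\ z != y.
  by move=> zA; split; apply: contraTneq zA => ->.
apply: (side_replace sA); rewrite ?subsetIr //.
  have := side_conn symE' sA' cinD cnD.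
  apply: connected_on_mono => u v; rewrite !in_setU1 !in_setI.
  case/predU1P=> [->|/andP[_ uA]].
    case/predU1P=> [->|/andP[_ vA]]; last by rewrite symE' add_edge_off ?(offA v vA).1 ?(offA v vA).2 // symE.
    rewrite /add_edge /= => /orP[//|/orP[]/andP[/eqP cx /eqP cy]]; by rewrite -cx -cy eqxx in nxy.
  by rewrite add_edge_off ?(offA u uA).1 ?(offA u uA).2.
move=> b bA; rewrite inE bA andbT => /dD[z zD].
rewrite add_edge_off ?(offA b bA).1 ?(offA b bA).2 // => bz; exists z => //.
rewrite !inE zD /=; case: eqVneq => //= zc; apply: contraNT (zc) => zA.
by apply/eqP/(clA b z).
Qed.

(** The complementary side costs no less than before by [side_keep], so the whole saving falls in
    [A]: the side is itself critical. *)
Lemma side_local c A x y : side e c A -> x \in c |: A -> y \in c |: A ->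
  x != y -> ~~ e x y ->
  exists X, [/\ X \subset A, #|X| < #|D0 :&: A|,
    connected_on (add_edge e x y) (c |: X)
    & forall a, a \in A -> a \notin X -> exists2 z, z \in c |: X & add_edge e x y a z].
Proof.
move=> sA xA yA nxy nE; have [_ cA _ clA] := sA.
case: (critE) => _ _ cD0 _ /(_ x y nxy nE)[D cD ltD].
have sA' := side_add sA xA yA.
have symE' := add_edge_sym symE x y.
have cinD := side_mem symE' sA' cD.
have c0 := side_mem symE sA cD0.
case/andP: (cD) => /dominatingP dD cnD.
set B := ~: (c |: A); have sB : side e c B := side_compl symE sA.
have leB : #|D0 :&: B| <= #|D :&: B|.
  by apply: (side_keep sB _ _ nxy cD); rewrite /B in_setC negbK.
exists (D :&: A); split; first exact: subsetIr.
- move: ltD; rewrite (side_card cA cinD) (side_card cA c0) -/B ltnS => ltD.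
  by rewrite -(ltn_add2r #|D0 :&: B|); apply: leq_ltn_trans ltD; rewrite leq_add2l.
- exact (side_conn symE' sA' cinD cnD).
move=> a aA; rewrite inE aA andbT => /dD[z zD az]; exists z => //.
rewrite !inE zD /=; case: eqVneq => //= zc; apply/negPn/negP => zA.
by case: sA' => _ _ _ /(_ a z aA zA az) zc'; rewrite zc' eqxx in zc.
Qed.

(** If [c] sees all of [A], any vertex of [A] is simplicial by [side_clique]. Otherwise join [c] to
    a non-neighbour [r]: the saving leaves no vertex in [A], so [c] alone dominates [A] and sees all
    of it but [r]; hence the neighbours of [r] lie in a clique. *)
Lemma light_side_simplicial c A : side e c A -> #|D0 :&: A| <= 1 ->
  exists2 x, x \in A & simplicial e x.
Proof.
move=> sA le1; have [/set0Pn[a0 a0A] cA _ clA] := sA.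
have sim r : r \in A -> (forall a, a \in A -> a != r -> e c a) -> simplicial e r.
  move=> rA all u v ru rv uv.
  have nc w : w != r -> w \notin A -> e r w -> w = c by move=> _ wA rw; apply: clA rw.
  have [uA|uA] := boolP (u \in A); have [vA|vA] := boolP (v \in A).
  - have [ur|ur] := eqVneq u r; first by rewrite ur.
    have [vr|vr] := eqVneq v r; first by rewrite vr symE.
    by apply: (side_clique sA); rewrite // all.
  - rewrite (clA r v rA vA rv) symE; have [ur|ur] := eqVneq u r; last exact: all.
    by rewrite ur symE -(clA r v).
  - rewrite (clA r u rA uA ru); have [vr|vr] := eqVneq v r; last exact: all.
    by rewrite vr symE -(clA r u).
  - by rewrite (clA r v) // (clA r u) // eqxx in uv *.
have [/forall_inP all|] := boolP [forall a in A, e c a].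
  by exists a0 => //; apply: sim => // a aA _; exact: all.
case/forall_inPn => r rA ncr; exists r => //; apply: sim => // a aA ar.
have nrc : c != r by apply: contraNneq cA => ->.
have rcA : r \in c |: A by rewrite !inE rA orbT.
have [X [_ X0 _ dX]] := side_local sA (setU11 c A) rcA nrc ncr.
have {X0} X0 : X = set0 by apply/eqP; rewrite -cards_eq0; nlia.
have [|z] := dX a aA; first by rewrite X0 inE.
have ac : a != c by apply: contraNneq cA => <-.
by rewrite X0 setU0 inE => /eqP->; rewrite /add_edge /= (negPf ac) (negPf ar) /= orbF symE.
Qed.

Let irrE : irreflexive e. Proof. by case: critE => -[]. Qed.

(** In the old graph [D] fails only at [x2]. Exchange [x1] for a neighbour [u] of [x2]: deleting the
    simplicial [x1] keeps [D] connected, and all it dominated is dominated by a neighbour of [x1] in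
    the new set, which is no larger. *)
Lemma simplicial_one_end x1 x2 D : ~~ e x1 x2 -> simplicial e x1 ->
  conn_dominating (add_edge e x1 x2) D -> #|D| < #|D0| ->
  x1 \in D -> x2 \notin D -> False.
Proof.
move=> nE s1 /andP[/dominatingP dD cD] ltD x1D x2D.
have cnD : connected_on e D by apply: connected_on_addN cD; rewrite x2D orbT.
have nx : x1 != x2 by apply: contraNneq x2D => <-.
have nb2 u : u \in D -> ~~ e x2 u.
  move=> uD; apply/negP => x2u; suff /minD : conn_dominating e D by rewrite leqNgt ltD.
  rewrite /conn_dominating cnD andbT; apply/dominatingP => x xD.
  have [y yD xy] := dD x xD; have [exy|nxy] := boolP (e x y); first by exists y.
  case: (add_edge_neq xy nxy) => [][ex _]; first by rewrite ex x1D in xD.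
  by exists u => //; rewrite ex.
have [y [u [/set1P-> _ x2u]]] : exists y u, [/\ y \in [set x2], u \notin [set x2] & e y u].
  by apply: (crit_edge_out (x := x2) (y := x1)); rewrite inE ?eqxx.
have uD : u \notin D by apply/negP => /nb2; rewrite x2u.
have [z zD uz] : exists2 z, z \in D & e u z.
  have [z zD uz] := dD u uD; exists z => //; apply/negPn/negP => nuz.
  case: (add_edge_neq uz nuz) => [][eu _]; last by rewrite eu irrE in x2u.
  by rewrite eu x1D in uD.
have cnD1 := connected_onD1 symE cnD s1.
pose D' := u |: (D :\ x1).
have uD1 w : w \in D -> w != u by move=> wD; apply: contraNneq uD => <-.
have [cnD' [w wD' x1w]] : connected_on e D' /\ exists2 w, w \in D' & e x1 w.
  have [D10|nD1] := eqVneq (D :\ x1) set0.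
    rewrite /D' D10 setU0; split; first exact: connected_on1.
    exists u; rewrite ?set11 //; rewrite symE; case: (eqVneq z x1) => [<- //|zx].
    have : z \in D :\ x1 by rewrite !inE zx.
    by rewrite D10 inE.
  have [||| x [w [/set1P->]]] := connected_onP _ _ cnD [set x1].
  - by rewrite sub1set.
  - by apply/set0Pn; exists x1; rewrite set11.
  - by apply: contraNneq nD1 => <-; rewrite setDv.
  rewrite inE inE => /andP[wx wD] x1w; have wD1 : w \in D :\ x1 by rewrite !inE wx.
  split; last by exists w; rewrite // inE wD1 orbT.
  have [zx|zx] := eqVneq z x1; last by apply: (connected_onU1 symE (x := z)); rewrite ?inE ?zx // symE.
  (* Here the vertex dominating [u] is the deleted [x1]; then [u] and [w] are both neighbours of
     [x1], hence adjacent. *)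
  apply: (connected_onU1 symE (x := w)) => //; apply: s1; rewrite ?uD1 //.
  by rewrite symE -zx.
have /minD : conn_dominating e D'.
  rewrite /conn_dominating cnD' andbT; apply/dominatingP => v vD'.
  have [->|vx] := eqVneq v x1; first by exists w.
  have vD : v \notin D by apply: contra vD' => vD; rewrite !inE vx vD orbT.
  have [z' zD' vz] := dD v vD; have [evz|nvz] := boolP (e v z').
    have [zx|zx] := eqVneq z' x1; last by exists z'; rewrite // !inE zx zD' orbT.
    exists w => //; apply: s1 => //; first by rewrite symE -zx.
    by apply: contraNneq vD' => ->.
  case: (add_edge_neq vz nvz) => [][ev _]; first by rewrite ev eqxx in vx.
  by exists u; rewrite ?setU11 // ev.
rewrite /D' cardsU1; move: ltD; rewrite (cardsD1 x1 D) x1D.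
by case: (u \notin _) => /=; nlia.
Qed.

(** Without the new edge [D] falls into two parts. Deleting [x1] and [x2] keeps each part connected
    and, if neither becomes empty, keeps domination. The two vertices saved then suffice to rejoin
    the parts, since two sets that together dominate a connected graph are at distance at most
    three. An empty part is treated apart. *)
Lemma simplicial_two_ends x1 x2 X D : ~~ e x1 x2 -> simplicial e x1 -> simplicial e x2 ->
  conn_dominating (add_edge e x1 x2) D -> #|D| < #|D0| ->
  X \subset D -> x1 \in X -> x2 \in D :\: X ->
  (forall x y, x \in X -> y \in D :\: X -> ~~ e x y) -> False.
Proof.
move=> nE s1 s2 /andP[/dominatingP dD cD] ltD sX x1X x2Y noXY.
have symE' := add_edge_sym symE x1 x2.
pose Y := D :\: X; rewrite -/Y in x2Y noXY.
have x2X : x2 \notin X by move: x2Y; rewrite inE => /andP[].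
have x1Y : x1 \notin Y by rewrite inE x1X.
have x2D : x2 \in D by move: x2Y; rewrite inE => /andP[].
have x1D := subsetP sX _ x1X.
have cX : connected_on e X.
  apply: (connected_on_addN (u := x1) (v := x2)); first by rewrite x2X orbT.
  apply: (connected_on_sub symE' (c := x1) cD) => // y z yX yx zD yz.
  apply/negPn/negP => zX; case: (boolP (e y z)) => [eyz|nyz].
    by have := noXY y z yX; rewrite eyz inE zX zD => /(_ isT).
  by case: (add_edge_neq yz nyz) => [][ey _]; rewrite ey ?eqxx // in yx yX; rewrite yX in x2X.
have cY : connected_on e Y.
  apply: (connected_on_addN (u := x1) (v := x2)); first by rewrite x1Y.
  apply: (connected_on_sub symE' (c := x2) cD); rewrite ?subsetDl // => y z yY yx zD yz.
  apply/negPn/negP => zY; have zX : z \in X by move: zY; rewrite inE zD andbT negbK.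
  case: (boolP (e y z)) => [eyz|nyz].
    by have := noXY z y zX yY; rewrite symE eyz.
  by case: (add_edge_neq yz nyz) => [][ey _]; rewrite ey ?eqxx // in yx yY; rewrite yY in x1Y.
pose Q1 := X :\ x1; pose Q2 := Y :\ x2.
have cQ1 : connected_on e Q1 := connected_onD1 symE cX s1.
have cQ2 : connected_on e Q2 := connected_onD1 symE cY s2.
have cardD : #|D| = (#|Q1| + #|Q2|).+2.
  rewrite -(cardsID X D) (setIidPr sX) -/Y (cardsD1 x1 X) (cardsD1 x2 Y) x1X x2Y -/Q1 -/Q2; nlia.
have near x (Z : {set T}) : x \in Z -> connected_on e Z -> simplicial e x -> Z :\ x != set0 ->
    forall v, v \notin Z :\ x -> (v == x) || e v x -> exists2 y, y \in Z :\ x & e v y.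
  move=> xZ cZ sx nZ v vZ vx; have [||| y [w [/set1P->]]] := connected_onP _ _ cZ [set x].
  - by rewrite sub1set.
  - by apply/set0Pn; exists x; rewrite set11.
  - by apply: contraNneq nZ => <-; rewrite setDv.
  move=> wZ xw; exists w => //; case/orP: vx => [/eqP->//|vx].
  by apply: sx => //; [rewrite symE | apply: contraNneq vZ => ->].
have dom v : v \notin D -> exists2 z, z \in D & e v z.
  move=> vD; have [z zD vz] := dD v vD; exists z => //; apply/negPn/negP => nvz.
  by case: (add_edge_neq vz nvz) => [][ev _]; rewrite ev ?x1D ?x2D in vD.
have splitD z : z \in D -> [\/ z \in Q1, z \in Q2, z = x1 | z = x2].
  move=> zD; rewrite !inE zD andbT; case: (eqVneq z x1) => [->|_]; first by constructor 3.
  by case: (eqVneq z x2) => [->|_]; [constructor 4 | case: (z \in X); [constructor 1|constructor 2]].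
(* One part was the single vertex [x']. It is enough to reach a neighbour of [x'] from [Q] with at
   most two new vertices: that neighbour dominates all the others, as they form a clique. *)
have pend x x' (Z Q : {set T}) : Q = Z :\ x -> x \in Z -> connected_on e Z -> simplicial e x ->
    connected_on e Q -> Q != set0 -> simplicial e x' -> x' \notin Q -> x' != x ->
    (forall y, y \in Q -> ~~ e x' y) -> #|Q| + 2 < #|D0| ->
    (forall v, v \notin Q -> v != x' -> ~~ e v x' -> exists2 y, y \in Q & e v y) -> False.
  move=> eQ xZ cZ sx cQ nQ sx' x'Q nx nx'Q ltQ domQ.
  pose W := [set v | (v \in Q) || [exists y in Q, e v y]].
  have cW z : z \in W -> connected_on e (z |: Q).
    rewrite inE; have [zQ _|_ /exists_inP[y yQ zy]] := boolP (z \in Q).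
      by rewrite (setUidPr _) // sub1set.
    by apply: (connected_onU1 symE (x := y)); rewrite // symE.
  have fin (Q' : {set T}) u : Q \subset Q' -> connected_on e Q' -> u \in Q' -> e x' u -> #|Q'| <= #|Q| + 2 -> False.
    move=> sQ cQ' uQ' x'u le; suff /minD : conn_dominating e Q' by nlia.
    rewrite /conn_dominating cQ' andbT; apply/dominatingP => v vQ'.
    have [->|vx] := eqVneq v x'; first by exists u.
    have [vx'|nvx'] := boolP (e v x').
      exists u => //; apply: sx'; rewrite // 1?symE //.
      by apply: contraNneq vQ' => ->.
    have vQ : v \notin Q by apply: contra vQ'; exact: subsetP.
    by have [y yQ vy] := domQ v vQ vx nvx'; exists y => //; exact: subsetP sQ _ yQ.
  have [/existsP[u /andP[uW x'u]]|/existsPn none] := boolP [exists u, (u \in W) && e x' u].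
    by apply: (fin (u |: Q) u); rewrite ?subsetUr ?setU11 ?cW // cardsU1; nlia.
  have sQW : Q \subset W by apply/subsetP => y yQ; rewrite inE yQ.
  have x'W : x' \notin W.
    by rewrite inE negb_or x'Q; apply/exists_inPn => y /nx'Q.
  have /set0Pn[q qQ] := nQ.
  have [z [v [zW vW zv]]] := crit_edge_out (subsetP sQW _ qQ) x'W.
  have vx' : v != x' by apply: contraTneq zW => ev; move: (none z); rewrite -ev symE zv andbT.
  have vQ : v \notin Q by apply: contra vW; exact: subsetP.
  have x'v : e x' v.
    rewrite symE; apply: contraNT vW => nvx'; have [y yQ vy] := domQ v vQ vx' nvx'.
    by rewrite inE (negPf vQ); apply/exists_inP; exists y.
  apply: (fin (v |: (z |: Q)) v); rewrite ?setU11 //.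
  - by apply: subset_trans (subsetUr _ _); rewrite subsetUr.
  - by apply: (connected_onU1 symE (x := z)); rewrite ?cW ?setU11.
  - by rewrite !cardsU1; nlia.
have x1Q1 : x1 \notin Q1 by rewrite !inE eqxx.
have x2Q2 : x2 \notin Q2 by rewrite !inE eqxx.
have ltQ1 : #|Q1| + 2 < #|D0| by nlia.
have ltQ2 : #|Q2| + 2 < #|D0| by nlia.
have nx21 : x2 != x1 by apply: contraNneq x2X => ->.
have Q1X y : y \in Q1 -> y \in X by rewrite inE => /andP[].
have Q2Y y : y \in Q2 -> y \in Y by rewrite inE => /andP[].
have [Q10|nQ1] := eqVneq Q1 set0; have [Q20|nQ2] := eqVneq Q2 set0.
(* Both parts are single vertices, so [D0] has at least three. An edge [z v] leaving the closed
   neighbourhood of [x1] dominates everything. *)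
- have k3 : 2 < #|D0| by rewrite cardD Q10 Q20 cards0 in ltD.
  have domx v : v != x1 -> v != x2 -> ~~ e v x1 -> e v x2.
    move=> v1 v2 nv1; have vD : v \notin D.
      by apply/negP => /splitD[]; rewrite ?Q10 ?Q20 ?inE // => ev; rewrite ev eqxx in v1 v2.
    have [z zD vz] := dom v vD; case: (splitD z zD) vz; rewrite ?Q10 ?Q20 ?inE // => -> //.
    by rewrite (negPf nv1).
  pose W := x1 |: [set v | e x1 v].
  have x2W : x2 \notin W by rewrite !inE negb_or nx21.
  have [z [v [zW vW zv]]] := crit_edge_out (setU11 _ _) x2W.
  have [vx1 nx1v] : v != x1 /\ ~~ e x1 v by apply/andP; rewrite -negb_or; move: vW; rewrite !inE.
  have x1z : e x1 z by move: zW; rewrite !inE => /orP[/eqP ez|//]; rewrite ez (negPf nx1v) in zv.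
  have vx2 : (v == x2) || e v x2.
    by case: eqVneq => //= nv; apply: domx; rewrite // symE.
  suff /minD : conn_dominating e [set z; v] by have := cards2 z v; nlia.
  apply/andP; split; last first.
    by apply: (connected_onU symE (x := z) (y := v)); rewrite ?connected_on1 ?set11 ?zv ?orbT.
  apply/dominatingP => u; rewrite !inE negb_or => /andP[uz uv].
  have [->|u1] := eqVneq u x1; first by exists z; rewrite // !inE eqxx.
  have [eu1|nu1] := boolP (e u x1).
    by exists z; rewrite ?inE ?eqxx //; apply: s1; rewrite // symE.
  exists v; first by rewrite !inE eqxx orbT.
  have [eu|u2] := eqVneq u x2.
    by case/orP: vx2 => [/eqP ev|]; [rewrite eu ev eqxx in uv | rewrite eu symE].
  have eu2 := domx u u1 u2 nu1.
  by case/orP: vx2 => [/eqP->//|ev2]; apply: s2; rewrite // symE.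
- apply: (pend x2 x1 Y Q2) => //; first by apply: contra x1Y; exact: Q2Y.
  + by rewrite eq_sym.
  + by move=> y /Q2Y; exact: noXY.
  move=> v vQ2 vx1 nvx1; have [vx|nvx] := boolP ((v == x2) || e v x2).
    exact: near vx.
  have vD : v \notin D.
    apply/negP => /splitD[vQ|vQ|ev|ev].
    - by rewrite Q10 inE in vQ.
    - by rewrite vQ in vQ2.
    - by rewrite ev eqxx in vx1.
    - by rewrite ev eqxx in nvx.
  have [z zD vz] := dom v vD; case: (splitD z zD) => [zQ|zQ|ez|ez].
  + by rewrite Q10 inE in zQ.
  + by exists z.
  + by rewrite -ez vz in nvx1.
  + by rewrite -ez vz orbT in nvx.
- apply: (pend x1 x2 X Q1) => //; first by apply: contra x2X; exact: Q1X.
  + by move=> y /Q1X yX; rewrite symE; exact: noXY.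
  move=> v vQ1 vx2 nvx2; have [vx|nvx] := boolP ((v == x1) || e v x1).
    exact: near vx.
  have vD : v \notin D.
    apply/negP => /splitD[vQ|vQ|ev|ev].
    - by rewrite vQ in vQ1.
    - by rewrite Q20 inE in vQ.
    - by rewrite ev eqxx in nvx.
    - by rewrite ev eqxx in vx2.
  have [z zD vz] := dom v vD; case: (splitD z zD) => [zQ|zQ|ez|ez].
  + by exists z.
  + by rewrite Q20 inE in zQ.
  + by rewrite -ez vz orbT in nvx.
  + by rewrite -ez vz in nvx2.
have domQ v : v \notin Q1 :|: Q2 -> exists2 y, y \in Q1 :|: Q2 & e v y.
  rewrite inE negb_or => /andP[v1 v2].
  have [vx|nvx1] := boolP ((v == x1) || e v x1).
    by have [y yQ vy] := near x1 X x1X cX s1 nQ1 v v1 vx; exists y; rewrite // inE yQ.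
  have [vx|nvx2] := boolP ((v == x2) || e v x2).
    by have [y yQ vy] := near x2 Y x2Y cY s2 nQ2 v v2 vx; exists y; rewrite // inE yQ orbT.
  have vD : v \notin D.
    apply/negP => /splitD[]; rewrite ?(negPf v1) ?(negPf v2) // => ev.
    - by rewrite ev eqxx in nvx1.
    - by rewrite ev eqxx in nvx2.
  have [z zD vz] := dom v vD; case: (splitD z zD) vz => [zQ|zQ|->|->] vz.
  - by exists z; rewrite // inE zQ.
  - by exists z; rewrite // inE zQ orbT.
  - by rewrite vz orbT in nvx1.
  - by rewrite vz orbT in nvx2.
have fin u v : connected_on e (u |: Q1) -> connected_on e (v |: Q2) -> (u == v) || e u v -> False.
  move=> cu cv uv; suff /minD : conn_dominating e ((u |: Q1) :|: (v |: Q2)).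
    have := cardsU (u |: Q1) (v |: Q2); rewrite !cardsU1; nlia.
  apply/andP; split; last by apply: (connected_onU symE (x := u) (y := v)); rewrite ?setU11.
  apply/dominatingP => w; rewrite !inE !negb_or => /andP[/andP[_ w1] /andP[_ w2]].
  have [|y yQ wy] := domQ w; first by rewrite !inE !negb_or w1.
  by exists y => //; move: yQ; rewrite !inE => /orP[] ->; rewrite !orbT.
(* Either [q2] lies in the closed neighbourhood [W] of [Q1], or an edge leaves [W], and its far end
   can only be dominated by [Q2]. *)
pose W := [set v | (v \in Q1) || [exists y in Q1, e v y]].
have cW u : u \in W -> connected_on e (u |: Q1).
  rewrite inE; have [uQ _|_ /exists_inP[y yQ uy]] := boolP (u \in Q1).
    by rewrite (setUidPr _) // sub1set.
  by apply: (connected_onU1 symE (x := y)); rewrite // symE.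
have /set0Pn[q1 q1Q] := nQ1; have /set0Pn[q2 q2Q] := nQ2.
have q1W : q1 \in W by rewrite inE q1Q.
have [q2W|q2W] := boolP (q2 \in W).
  by apply: (fin q2 q2); rewrite ?eqxx ?cW // (setUidPr _) // sub1set.
have [u [v [uW vW uv]]] := crit_edge_out q1W q2W.
apply: (fin u v); rewrite ?cW ?uv ?orbT //.
have [vQ2|vQ2] := boolP (v \in Q2); first by rewrite (setUidPr _) // sub1set.
have vQ1 : v \notin Q1 by apply: contra vW => vQ1; rewrite inE vQ1.
have [|y] := domQ v; first by rewrite inE negb_or vQ1.
rewrite in_setU => /orP[yQ1|yQ2] vy.
  by case/negP: vW; rewrite inE; apply/orP; right; apply/exists_inP; exists y.
by apply: (connected_onU1 symE (x := y)); rewrite // symE.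
Qed.

(** Join the two and take a smaller set [D]. With neither end in [D], or with both and [D] connected
    without the new edge, that edge is idle; the remaining cases are the two preceding lemmas. *)
Lemma simplicial_adjacent x1 x2 :
  simplicial e x1 -> simplicial e x2 -> x1 != x2 -> e x1 x2.
Proof.
move=> s1 s2 nx; apply/negPn/negP => nE.
case: (critE) => _ _ _ _ /(_ x1 x2 nx nE)[D cD ltD].
have nE' : ~~ e x2 x1 by rewrite symE.
have cD' : conn_dominating (add_edge e x2 x1) D.
  move: cD; rewrite /conn_dominating => /andP[/dominatingP dD cD]; apply/andP; split.
    by apply/dominatingP => x /dD[y yD xy]; exists y; rewrite // add_edgeC.
  by apply: connected_on_mono cD => x y _ _; rewrite add_edgeC.
have [x1D|x1D] := boolP (x1 \in D); have [x2D|x2D] := boolP (x2 \in D).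
- have [cnD|ncD] := boolP (connected_on e D).
    suff /minD : conn_dominating e D by rewrite leqNgt ltD.
    rewrite /conn_dominating cnD andbT; case/andP: cD => /dominatingP dD _.
    apply/dominatingP => v vD; have [z zD vz] := dD v vD; exists z => //.
    apply/negPn/negP => nvz.
    by case: (add_edge_neq vz nvz) => [][ev _]; rewrite ev ?x1D ?x2D in vD.
  have /existsP[X /and4P[sX nX nXD /forall_inP noX]] : [exists X : {set T},
      [&& X \subset D, X != set0, X != D & [forall x in X, [forall y in D :\: X, ~~ e x y]]]].
    apply: contraNT ncD => /existsPn none; apply/connected_onP => X sX nX nXD.
    move: (none X); rewrite sX nX nXD /= => /forall_inPn[x xX /forall_inPn[y yX]].
    by rewrite negbK => xy; exists x, y.
  have {}noX x y : x \in X -> y \in D :\: X -> ~~ e x y by move=> /noX/forall_inP; exact.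
  have [||| x [y [xX yX xy]]] := connected_onP _ _ (andP cD).2 X => //.
  have nxy := noX x y xX yX.
  case: (add_edge_neq xy nxy) => [][ex ey]; rewrite ex ey in xX yX.
    exact: (simplicial_two_ends nE s1 s2 cD ltD sX xX yX noX).
  exact: (simplicial_two_ends nE' s2 s1 cD' ltD sX xX yX noX).
- by case: (simplicial_one_end nE s1 cD ltD x1D x2D).
- by case: (simplicial_one_end nE' s2 cD' ltD x2D x1D).
suff /minD : conn_dominating e D by rewrite leqNgt ltD.
case/andP: cD => /dominatingP dD cD; apply/andP; split.
  apply/dominatingP => v vD; have [z zD vz] := dD v vD; exists z => //.
  apply/negPn/negP => nvz.
  by case: (add_edge_neq vz nvz) => [][_ ez]; rewrite -ez zD in x1D x2D.
by apply: connected_on_addN cD; rewrite x1D.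
Qed.

End Critical.

(** * Paths spanning a set *)

Definition ham_path (T : finType) (e : rel T) (S : {set T}) (x y : T) : Prop :=
  exists s, [/\ path e x s, last x s = y, uniq (x :: s) & x :: s =i S].

Section HamPath.
Variables (T : finType) (e : rel T).
Implicit Types S A B : {set T}.

Lemma ham_path1 x : ham_path e [set x] x x.
Proof. by exists [::]; split=> // z; rewrite !inE. Qed.

Lemma ham_path_cat A B x y z w : ham_path e A x y -> ham_path e B z w -> e y z ->
  (forall v, v \in A -> v \in B -> False) -> ham_path e (A :|: B) x w.
Proof.
move=> [s [ps ls us eA]] [t [pt lt ut eB]] yz dis; exists (s ++ z :: t); split.
- by rewrite cat_path ps /= ls yz.
- by rewrite last_cat.
- rewrite -cat_cons cat_uniq us ut andbT; apply/hasPn => v; rewrite eB => vB.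
  by apply/negP => /=; rewrite eA => vA; exact: dis vB.
by move=> v; rewrite -cat_cons mem_cat eA eB inE.
Qed.

Lemma ham_path_rev A x y : symmetric e -> ham_path e A x y -> ham_path e A y x.
Proof.
move=> symE [s [ps ls us eA]]; exists (rev (belast x s)).
have eq : y :: rev (belast x s) = rev (x :: s) by rewrite (lastI x s) ls rev_rcons.
split.
- by rewrite -ls rev_path; apply: sub_path ps => u v; rewrite symE.
- by rewrite -[LHS](last_cons y) eq rev_cons last_rcons.
- by rewrite eq rev_uniq.
by move=> v; rewrite eq mem_rev.
Qed.

Lemma ham_path_traceable x y : ham_path e setT x y -> traceable e.
Proof.
move=> [s [ps _ us es]]; exists (x :: s); split=> //.
by move=> v; rewrite es inE.
Qed.

Lemma ham_path_card A x y : ham_path e A x y ->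
  exists s, [/\ sorted e (x :: s), uniq (x :: s), (size s).+1 = #|A| & x :: s =i A].
Proof.
move=> [s [ps _ us es]]; exists s; split=> //.
by rewrite -(eq_card es); apply/esym/card_uniqP.
Qed.

Lemma ham_path_inl A x y : ham_path e A x y -> x \in A.
Proof. by move=> [s [_ _ _ <-]]; rewrite mem_head. Qed.

Lemma ham_path_connect A x y : x \in A -> connect (induced e A) x y ->
  exists2 B : {set T}, B \subset A & ham_path e B x y.
Proof.
move=> xA /connectP[p pp ->]; case/shortenP: pp => q pq uq _.
exists [set z in x :: q]; last first.
  exists q; split=> //; last by move=> z; rewrite in_set.
  by apply: sub_path pq => u v /and3P[].
apply/subsetP => z; rewrite in_set in_cons => /predU1P[->//|zq].
elim: q x xA pq zq {uq p} => //= w q IH x xA /andP[/and3P[_ wA _] pq].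
by case/predU1P=> [->//|zq]; exact: IH pq zq.
Qed.

End HamPath.

Section Segments.
Variables (T : finType) (e : rel T) (x0 : T) (s : seq T).
Hypotheses (ss : sorted e s) (us : uniq s).

(** Segments are cut out by position, so that disjointness and covering of the pieces of a rerouted
    path become linear arithmetic on indices. *)
Definition seg i j := [set x in s | i <= index x s <= j].

Lemma seg1 i : i < size s -> seg i i = [set nth x0 s i].
Proof.
move=> im; apply/setP => x; rewrite !inE; apply/andP/eqP => [[xs ix]|->].
  by rewrite -[x](nth_index x0 xs); congr nth; lia.
by rewrite mem_nth // index_uniq //; split=> //; lia.
Qed.

Lemma ham_path_seg i j : i <= j < size s -> ham_path e (seg i j) (nth x0 s i) (nth x0 s j).
Proof.
case/andP=> ij; rewrite -(subnKC ij); elim: (j - i) => [|d IH] dm.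
  by rewrite addn0 in dm *; rewrite seg1 //; exact: ham_path1.
have -> : seg i (i + d.+1) = seg i (i + d) :|: seg (i + d.+1) (i + d.+1).
  apply/setP => x; rewrite !inE; lia.
apply: ham_path_cat (IH _) _ _ _; first by lia.
- rewrite seg1 //; exact: ham_path1.
- by rewrite addnS; apply: (sortedP x0 ss); lia.
by move=> v; rewrite !inE; lia.
Qed.

End Segments.

(** * Longest paths *)

Definition indep (T : finType) (e : rel T) (I : {set T}) : Prop :=
  {in I &, forall x y, ~~ e x y}.

(** Such an [x] comes from criticality: if [u] and [x] dominate the graph with the edge [uv], and
    [u], [v] belong to an independent [I], then the other members of [I] do not see [u] and must see
    [x]. *)
Definition misses (T : finType) (e : rel T) (I : {set T}) (x v : T) : bool :=
  ~~ e x v && [forall u in I, (u != v) ==> e x u].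

Lemma missesP (T : finType) (e : rel T) (I : {set T}) (x v : T) :
  reflect (~~ e x v /\ forall u, u \in I -> u != v -> e x u) (misses e I x v).
Proof.
apply: (iffP andP) => -[nxv]; first by move=> /forall_inP H; split=> // u /H/implyP.
by move=> H; split=> //; apply/forall_inP => u uI; apply/implyP; exact: H.
Qed.

Section LongestPath.
Variables (T : finType) (e : rel T).
Hypotheses (symE : symmetric e) (irrE : irreflexive e).
Variables (A St : {set T}) (W : {set T} -> {set T}).
Hypothesis sWA : forall I, W I \subset A.

(** The section serves twice: for a side [A] of a cut-vertex, where [St] consists of the neighbours
    of that vertex, and for the whole graph, where any vertex may start a path. [W I] limits where
    the missing vertex is sought. *)
Definition missed (I : {set T}) (v : T) : bool := [exists w in W I, misses e I w v].

Hypothesis star : forall (I : {set T}) u v, I \subset A -> indep e I -> 3 <= #|I| ->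
  u \in I -> v \in I -> u != v -> missed I u || missed I v.

Variables (x0 : T) (s : seq T) (m : nat).
Hypotheses (ss : sorted e s) (us : uniq s) (szs : size s = m) (sA : {subset s <= A}).
Hypothesis m_gt0 : 0 < m.
Hypothesis sSt : nth x0 s 0 \in St.
Hypothesis longest : forall S x y, ham_path e S x y -> S \subset A -> x \in St -> #|S| <= m.

Variables (C : {set T}) (y : T).
Hypotheses (yC : y \in C) (sCA : C \subset A) (Cs : forall x, x \in C -> x \notin s).
Hypothesis connC : forall u v, u \in C -> v \in C -> exists2 B : {set T}, B \subset C & ham_path e B u v.
Hypothesis cloC : forall u z, u \in C -> z \in A -> e u z -> (z \in C) || (z \in s).

Local Notation X k := (nth x0 s k).

(* [C] is a component of [A] minus the longest path [s], [Es] consists of the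
   path vertices with a neighbour in [C], and [L] of their predecessors together
   with the last vertex of the path. *)
Definition attached k := (k < m) && [exists c in C, e (X k) c].
Definition pre_attached k := (k < m) && ((k.+1 == m) || attached k.+1).
Definition Es := [set x in s | attached (index x s)].
Definition L := [set x in s | pre_attached (index x s)].

Lemma attm k : attached k -> k < m. Proof. by case/andP. Qed.
Lemma islm k : pre_attached k -> k < m. Proof. by case/andP. Qed.

Lemma edgeX k : k.+1 < m -> e (X k) (X k.+1).
Proof. by rewrite -szs; exact: (sortedP x0 ss). Qed.

Lemma seg_forward i j : i <= j < m -> ham_path e (seg s i j) (X i) (X j).
Proof. by rewrite -szs; exact: ham_path_seg. Qed.

Lemma seg_backward i j : i <= j < m -> ham_path e (seg s i j) (X j) (X i).
Proof. by move=> ij; apply: ham_path_rev => //; apply: seg_forward. Qed.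

(** Every rerouting below ends here; only the pieces and their junctions differ. *)
Lemma longer S x z c : ham_path e S x z -> (forall v, v \in S -> (v \in s) || (v \in C)) ->
  (forall v, v \in s -> v \in S) -> c \in S -> c \in C -> x \in St -> False.
Proof.
move=> pS sS cS cinS cC xSt.
have: #|S| <= m.
  apply: longest pS _ xSt; apply/subsetP => v /sS/orP[/sA//|]; exact: subsetP.
apply/negP; rewrite -ltnNge -szs -(card_uniqP us).
apply: (@leq_trans #|c |: [set v in s]|).
  by rewrite cardsU1 inE (Cs cC) add1n ltnS cardsE.
by apply/subset_leq_card/subsetP => v; rewrite !inE => /predU1P[->//|/cS].
Qed.

Lemma joinC i j : attached i -> attached j -> exists B u v,
  [/\ ham_path e B u v, e (X i) u, e v (X j), u \in B & forall z, z \in B -> z \in C].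
Proof.
case/andP=> _ /exists_inP[u uC iu] /andP[_ /exists_inP[v vC jv]].
have [B sB pB] := connC uC vC; exists B, u, v; split=> //.
- by rewrite symE.
- exact: ham_path_inl pB.
exact/subsetP.
Qed.

Lemma endC i : attached i -> exists B u v,
  [/\ ham_path e B u v, e (X i) u, u \in B & forall z, z \in B -> z \in C].
Proof. by move=> ai; have [B [u [v [*]]]] := joinC ai ai; exists B, u, v. Qed.

Lemma idxm z : z \in s -> index z s < m. Proof. by rewrite -szs index_mem. Qed.

Local Ltac dis sB :=
  let z := fresh "z" in
  move=> z; move: (Cs (x := z)) (sB z) (@idxm z); rewrite !inE; keepnat;
  case: (z \in s) => /=; move: (index z s); lia.
Local Ltac fin sB uB := first [by [] | by dis sB | by rewrite symE | by apply: sB | by rewrite !inE uB ?orbT].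

Lemma att_ltm k : attached k -> k.+1 < m.
Proof.
move=> ak; have km := attm ak; case: (ltnP k.+1 m) => // le; exfalso.
have [B [u [v [pB eu uB sB]]]] := endC ak.
have S1 : ham_path e (seg s 0 k) (X 0) (X k) by apply: seg_forward; nlia.
by apply: (longer (ham_path_cat S1 pB eu _) _ _ (c := u)); fin sB uB.
Qed.

Lemma last_isl : pre_attached m.-1.
Proof. by rewrite /pre_attached; apply/andP; split; [lia | apply/orP; left; apply/eqP; lia]. Qed.

Lemma isl_succ k : pre_attached k -> k.+1 < m -> attached k.+1.
Proof. by case/andP=> _ /orP[/eqP ek|//] lt; rewrite -ek ltnn in lt. Qed.

Lemma att_pred k : attached k.+1 -> pre_attached k.
Proof. by move=> ak; have lt := attm ak; rewrite /pre_attached ak orbT andbT; nlia. Qed.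

(** Between two consecutive attached vertices a detour through [C] could be inserted. *)
Lemma isl_att k : pre_attached k -> ~~ attached k.
Proof.
move=> lk; apply/negP => ak; have lt := att_ltm ak; have ak1 := isl_succ lk lt.
have [B [u [v [pB eu ev uB sB]]]] := joinC ak ak1.
have S1 : ham_path e (seg s 0 k) (X 0) (X k) by apply: seg_forward; nlia.
have S2 : ham_path e (seg s k.+1 m.-1) (X k.+1) (X m.-1) by apply: seg_forward; nlia.
by apply: (longer (ham_path_cat (ham_path_cat S1 pB eu _) S2 ev _) _ _ (c := u)); fin sB uB.
Qed.

(** With such an edge, run to [X i], jump to [X j], return to [X i.+1], and pass through [C] to
    [X j.+1], or stop in [C] if [j] is last. *)
Lemma isl_nadj i j : i < j -> pre_attached i -> pre_attached j -> ~~ e (X i) (X j).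
Proof.
move=> ij li lj; apply/negP => eij; have jm := islm lj.
have ai : attached i.+1 by apply: isl_succ li _; nlia.
have S1 : ham_path e (seg s 0 i) (X 0) (X i) by apply: seg_forward; nlia.
have S2 : ham_path e (seg s i.+1 j) (X j) (X i.+1) by apply: seg_backward; nlia.
have [lt|le] := ltnP j.+1 m; last first.
  have [B [u [v [pB eu uB sB]]]] := endC ai.
  by apply: (longer (ham_path_cat (ham_path_cat S1 S2 eij _) pB eu _) _ _ (c := u)); fin sB uB.
have [B [u [v [pB eu ev uB sB]]]] := joinC ai (isl_succ lj lt).
have S3 : ham_path e (seg s j.+1 m.-1) (X j.+1) (X m.-1) by apply: seg_forward; nlia.
by apply: (longer (ham_path_cat (ham_path_cat (ham_path_cat S1 S2 eij _) pB eu _) S3 ev _) _ _ (c := u)); fin sB uB.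
Qed.

Lemma last_nbr v : v \in A -> e (X m.-1) v -> v \in s.
Proof.
move=> vA ev; apply/negPn/negP => vs.
have S1 : ham_path e (seg s 0 m.-1) (X 0) (X m.-1) by apply: seg_forward; nlia.
have pS : ham_path e (seg s 0 m.-1 :|: [set v]) (X 0) v.
  by apply: ham_path_cat S1 (ham_path1 e v) ev _ => z; rewrite !inE => /andP[zs _] /eqP ez; rewrite -ez zs in vs.
suff : #|seg s 0 m.-1 :|: [set v]| <= m.
  have -> : seg s 0 m.-1 = [set z in s].
    by apply/setP => z; move: (@idxm z); rewrite !inE; keepnat; case: (z \in s) => /=; lia.
  by rewrite setUC cardsU1 inE vs cardsE (card_uniqP us) szs add1n ltnn.
apply: longest pS _ sSt; apply/subsetP => z; rewrite !inE => /orP[/andP[/sA->]//|/eqP->//].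
Qed.

Lemma idxX k : k < m -> index (X k) s = k.
Proof. by rewrite -szs => km; rewrite index_uniq. Qed.

Lemma memX k : k < m -> X k \in s.
Proof. by rewrite -szs => km; rewrite mem_nth. Qed.

Lemma Xinj i j : i < m -> j < m -> X i = X j -> i = j.
Proof. by move=> im jm eX; rewrite -(idxX im) eX idxX. Qed.

Lemma LX k : pre_attached k -> X k \in L.
Proof. by move=> lk; rewrite inE memX ?idxX // islm. Qed.

Lemma EsX k : attached k -> X k \in Es.
Proof. by move=> ak; rewrite inE memX ?idxX // attm. Qed.

Lemma XEs k : k < m -> (X k \in Es) = attached k.
Proof. by move=> km; rewrite inE memX ?idxX. Qed.

Lemma LP v : v \in L -> exists2 k, pre_attached k & v = X k.
Proof. by rewrite inE => /andP[vs lv]; exists (index v s); rewrite ?nth_index. Qed.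

Lemma EsP v : v \in Es -> exists2 k, attached k & v = X k.
Proof. by rewrite inE => /andP[vs lv]; exists (index v s); rewrite ?nth_index. Qed.

Lemma L_C v c : v \in L -> c \in C -> ~~ e v c.
Proof.
move=> /LP[k lk ->] cC; apply: contra (isl_att lk) => vc.
by rewrite /attached (islm lk); apply/exists_inP; exists c.
Qed.

Lemma L_A : L \subset A.
Proof. by apply/subsetP => v; rewrite inE => /andP[/sA]. Qed.

Lemma y_notin_L : y \notin L.
Proof. by rewrite inE (negPf (Cs yC)). Qed.

Lemma indepL : indep e L.
Proof.
move=> u v /LP[i li ->] /LP[j lj ->]; case: (ltngtP i j) => ij.
- exact: isl_nadj ij li lj.
- by rewrite symE; exact: isl_nadj ij lj li.
by rewrite ij irrE.
Qed.

(** The successor map is a bijection from [L] without the last path vertex to [Es] without [X 0].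
    Hence [L] exceeds [Es] by one exactly when [X 0] is unattached. *)
Lemma card_L : #|L| = #|Es :\ X 0|.+1.
Proof.
rewrite (cardsD1 (X m.-1) L) (LX last_isl) add1n; congr _.+1.
pose h x := X (index x s).+1.
have hL x : x \in L :\ X m.-1 -> exists k, [/\ k.+1 < m, attached k.+1, x = X k & h x = X k.+1].
  rewrite in_setD1 => /andP[xm /LP[k lk ex]]; have km := islm lk.
  have km1 : k.+1 < m.
    by case: (ltnP k.+1 m) => // le; rewrite ex (_ : k = m.-1) ?eqxx // in xm; nlia.
  by exists k; split; [| exact: isl_succ lk km1 | | rewrite /h ex idxX].
have injh : {in L :\ X m.-1 &, injective h}.
  move=> u v /hL[i [im _ -> ->]] /hL[j [jm _ -> ->]] /(Xinj im jm) [] ->.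
  by [].
rewrite -(card_in_imset injh); apply: eq_card => x; apply/imsetP/idP.
  move=> [u /hL[k [km ak _ ->]] ->]; rewrite in_setD1 EsX // andbT.
  by apply/eqP => /Xinj; lia.
rewrite in_setD1 => /andP[x0' /EsP[[|k] ak ex]]; first by rewrite ex eqxx in x0'.
have km := attm ak; exists (X k); last by rewrite /h idxX // ltnW.
rewrite in_setD1 LX ?att_pred // andbT; apply/eqP => /Xinj; nlia.
Qed.

(** By [star] at most one member of [y |: J] is unmissed. A vertex missing [v] sees [y] and another
    member of [J]; since [J] has no neighbour in [C], that vertex is on the path, hence in [Es]. It
    misses only one member, whence injectivity. *)
Lemma missers (J : {set T}) : J \subset A -> indep e J ->
  (forall j c, j \in J -> c \in C -> ~~ e j c) -> y \notin J -> 1 < #|J| ->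
  exists (f : T -> T) (Jm : {set T}), [/\ Jm \subset J, {in Jm &, injective f},
    (forall v, v \in Jm -> f v \in Es :&: W (y |: J) /\ misses e (y |: J) (f v) v)
    & Jm = J \/ missed (y |: J) y /\
        exists2 q, q \in J & Jm = J :\ q /\ ~~ missed (y |: J) q].
Proof.
move=> sJ iJ JC yJ J2; set I := y |: J.
have sI : I \subset A by rewrite subUset sub1set sJ andbT; exact: subsetP sCA _ yC.
have iI : indep e I.
  move=> u v; rewrite !in_setU1 => /predU1P[->|uJ] /predU1P[->|vJ]; rewrite ?irrE //.
  - by rewrite symE; exact: JC.
  - exact: JC.
  exact: iJ.
have I3 : 2 < #|I| by rewrite cardsU1 yJ.
pose Jm := [set v in J | missed I v].
pose f v := odflt y [pick w in W I | misses e I w v].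
have fP v : v \in Jm -> f v \in W I /\ misses e I (f v) v.
  rewrite inE => /andP[_ /exists_inP[w wW wv]]; rewrite /f.
  by case: pickP => [z /andP[]|/(_ w)] //=; rewrite wW wv.
have fE v : v \in Jm -> f v \in Es.
  move=> vJm; have [fW /missesP[nfv fall]] := fP v vJm.
  have vJ : v \in J by move: vJm; rewrite inE => /andP[].
  have vy : y != v by apply: contraNneq yJ => ->.
  have fy : e (f v) y by apply: fall; rewrite ?setU11.
  have fA : f v \in A by exact: subsetP (sWA I) _ fW.
  have [u uJ uv] : exists2 u, u \in J & u != v.
    move: J2; rewrite (cardsD1 v) vJ add1n ltnS card_gt0 => /set0Pn[u].
    by rewrite in_setD1 => /andP[uv uJ]; exists u.
  have fu : e (f v) u by apply: fall; rewrite // in_setU1 uJ orbT.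
  have /orP[fC|fs] := cloC yC fA (etrans (symE y (f v)) fy).
    by have := JC u _ uJ fC; rewrite symE fu.
  rewrite inE fs /attached idxm //=; apply/exists_inP; exists y => //.
  by rewrite nth_index.
exists f, Jm; split.
- by apply/subsetP => v; rewrite inE => /andP[].
- move=> u v uJm vJm efuv; apply/eqP/negPn/negP => uv.
  have [_ /missesP[_ fu]] := fP u uJm; have [_ /missesP[nfv _]] := fP v vJm.
  have vJ : v \in J by move: vJm; rewrite inE => /andP[].
  by case/negP: nfv; rewrite -efuv; apply: fu; rewrite ?in_setU1 ?vJ ?orbT // eq_sym.
- by move=> v vJm; have [fW fm] := fP v vJm; rewrite inE fE.
have [/existsP[q /andP[qJ nq]]|/existsPn all] := boolP [exists q, (q \in J) && ~~ missed I q].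
  right; split.
    have yq : y != q by apply: contraNneq yJ => ->.
    by have := star sI iI I3 (setU11 _ _) (setU1r y qJ) yq; rewrite (negPf nq) orbF.
  exists q => //; split=> //; apply/setP => v; rewrite !inE; case: eqVneq => [->|vq].
    by rewrite (negPf nq) andbF.
  case: (boolP (v \in J)) => //= vJ.
  by have := star sI iI I3 (setU1r y vJ) (setU1r y qJ) vq; rewrite (negPf nq) orbF.
left; apply/setP => v; rewrite inE; case: (boolP (v \in J)) => //= vJ.
by have := all v; rewrite vJ /= negbK.
Qed.

Lemma missers_le (J : {set T}) : J \subset A -> indep e J ->
  (forall j c, j \in J -> c \in C -> ~~ e j c) -> y \notin J -> 1 < #|J| -> #|J| <= #|Es|.+1.
Proof.
move=> sJ iJ JC yJ J2; have [f [Jm [_ fi fE cas]]] := missers sJ iJ JC yJ J2.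
have le : #|Jm| <= #|Es|.
  rewrite -(card_in_imset fi); apply/subset_leq_card/subsetP => _ /imsetP[v /fE[fv _] ->].
  by move: fv; rewrite inE => /andP[].
case: cas => [<-|[_ [q qJ [eJm _]]]]; first by rewrite ltnW.
by rewrite (cardsD1 q J) qJ -eJm.
Qed.

(** Equality leaves no slack: some member [q] of [J] is unmissed, so [y] is missed, and the vertices
    missing the other members exhaust [Es]. *)
Lemma missers_tight (J : {set T}) : J \subset A -> indep e J ->
  (forall j c, j \in J -> c \in C -> ~~ e j c) -> y \notin J -> 1 < #|J| ->
  #|J| = #|Es|.+1 ->
  missed (y |: J) y /\ exists2 q, q \in J & [/\ ~~ missed (y |: J) q,
    (forall x, x \in Es -> exists2 v, v \in J :\ q & misses e (y |: J) x v) &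
    {in Es &, forall x x' v, v \in J -> ~~ e x v -> ~~ e x' v -> x = x'}].
Proof.
move=> sJ iJ JC yJ J2 cJ; have [f [Jm [sJm fi fE cas]]] := missers sJ iJ JC yJ J2.
have sfE : f @: Jm \subset Es.
  by apply/subsetP => _ /imsetP[v /fE[fv _] ->]; move: fv; rewrite inE => /andP[].
have le : #|Jm| <= #|Es| by rewrite -(card_in_imset fi) subset_leq_card.
case: cas => [eJm|[my [q qJ [eJm nq]]]]; first by rewrite eJm cJ ltnn in le.
split=> //; exists q => //; rewrite nq.
have cJm : #|Jm| = #|Es| by have := cardsD1 q J; rewrite qJ -eJm cJ add1n => -[].
have eE : f @: Jm = Es by apply/eqP; rewrite eqEcard sfE card_in_imset // cJm leqnn.
have pre x : x \in Es -> exists2 v, v \in Jm & x = f v by rewrite -eE => /imsetP.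
split=> // [x /pre[v vJm ->]|].
  by exists v; [rewrite -eJm | case: (fE v vJm)].
move=> _ _ /pre[u uJm ->] /pre[u' uJm' ->] v vJ nv nv'.
have [_ /missesP[_ a]] := fE u uJm; have [_ /missesP[_ a']] := fE u' uJm'.
have vI : v \in y |: J by rewrite in_setU1 vJ orbT.
have -> : u = v by apply/eqP/negPn/negP => h; case/negP: nv; apply: a; rewrite // eq_sym.
by apply/congr1/eqP/negPn/negP => h; case/negP: nv'; apply: a'.
Qed.

Lemma isl_att_lt i j : attached i -> attached j -> i < j -> i.+1 < j.
Proof.
move=> ai aj ij; rewrite ltn_neqAle ij andbT; apply/negP => /eqP eij.
by have := isl_att (att_pred (etrans (congr1 attached eij) aj)); rewrite ai.
Qed.

Lemma two_att : 1 < #|Es| -> exists i j, [/\ attached i, attached j & i < j].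
Proof.
case/card_gt1P => _ [_ [/EsP[i ai ->] /EsP[j aj ->] nX]].
by case: (ltngtP i j) => ij; [exists i, j | exists j, i | rewrite ij eqxx in nX].
Qed.

(** * Rotations at an unattached vertex adjacent to all of [L] *)

Section Rotations.
Variables (z j : nat).
Hypotheses (zm : z.+1 < m) (naz : ~~ attached z.+1) (na0 : ~~ attached 0).
Hypothesis wl : forall i, pre_attached i -> e (X z.+1) (X i).
Hypotheses (lj : pre_attached j) (ezj : e (X z) (X j)).
Hypothesis two : exists i1 i2, [/\ attached i1, attached i2 & i1 < i2].

Let wlast : e (X m.-1) (X z.+1). Proof. by rewrite symE; exact: wl last_isl. Qed.
Let wpred i : attached i.+1 -> e (X i) (X z.+1).
Proof. by move=> ai; rewrite symE; apply/wl/att_pred. Qed.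

(** If [j] is not last, the route is [0..z], [j..z.+1], [m.-1..j.+1], then [C]. If it is last, a
    pre-attached position before [z] also gives a route ending in [C]; failing that, all attached
    positions come after [z.+1] and two of them carry a detour through [C]. *)
Lemma rotate_after : z.+1 < j -> False.
Proof.
move=> zj; have jm := islm lj.
have S1 : ham_path e (seg s 0 z) (X 0) (X z) by apply: seg_forward; nlia.
have [lt|le] := ltnP j.+1 m.
  have [B [u [v [pB eu uB sB]]]] := endC (isl_succ lj lt).
  have S2 : ham_path e (seg s z.+1 j) (X j) (X z.+1) by apply: seg_backward; nlia.
  have S3 : ham_path e (seg s j.+1 m.-1) (X m.-1) (X j.+1) by apply: seg_backward; nlia.
  have wl1 := wl last_isl.
  by apply: (longer (ham_path_cat (ham_path_cat (ham_path_cat S1 S2 ezj _) S3 wl1 _) pB eu _) _ _ (c := u)); fin sB uB.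
have ezl : e (X z) (X m.-1) by rewrite (_ : m.-1 = j) //; nlia.
have [/existsP[r /andP[lr rz]]|/existsPn none] := boolP [exists r : 'I_m, pre_attached r && (r < z.+1)].
  have rz' : r < z.
    rewrite ltn_neqAle -ltnS rz andbT; apply/negP => /eqP erz.
    by case/negP: naz; rewrite -erz; apply: isl_succ lr _; rewrite erz.
  have ar : attached r.+1 by apply: isl_succ lr _; nlia.
  have [B [u [v [pB eu uB sB]]]] := endC ar.
  have S0 : ham_path e (seg s 0 r) (X 0) (X r) by apply: seg_forward; nlia.
  have S2 : ham_path e (seg s z.+1 m.-1) (X z.+1) (X m.-1) by apply: seg_forward; nlia.
  have S3 : ham_path e (seg s r.+1 z) (X z) (X r.+1) by apply: seg_backward; nlia.
  have e1 : e (X m.-1) (X z) by rewrite symE.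
  by apply: (longer (ham_path_cat (ham_path_cat (ham_path_cat S0 S2 (wpred ar) _) S3 e1 _) pB eu _) _ _ (c := u)); fin sB uB.
have big i : attached i -> z.+1 < i.
  case: i => [|i] ai; first by rewrite (negPf na0) in ai.
  have li := att_pred ai; have := none (Ordinal (islm li)).
  by rewrite /= li /= -leqNgt ltnS.
have [i1 [i2 [a1 a2 i12]]] := two.
have lt12 := isl_att_lt a1 a2 i12; have b1 := big _ a1; have m2 := attm a2.
have [B [u [v [pB eu ev uB sB]]]] := joinC a2 a1.
have S2 : ham_path e (seg s i2 m.-1) (X m.-1) (X i2) by apply: seg_backward; nlia.
have S3 : ham_path e (seg s z.+1 i1) (X i1) (X z.+1) by apply: seg_backward; nlia.
have S4 : ham_path e (seg s i1.+1 i2.-1) (X i2.-1) (X i1.+1) by apply: seg_backward; nlia.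
have e1 : e (X z.+1) (X i2.-1) by apply/wl/att_pred; rewrite prednK //; nlia.
by apply: (longer (ham_path_cat (ham_path_cat (ham_path_cat (ham_path_cat S1 S2 ezl _) pB eu _) S3 ev _) S4 e1 _) _ _ (c := u)); fin sB uB.
Qed.

(** A second attached position [i] lies before [j.+1], between [j.+1] and [z.+1], or after [z.+1].
    Only the first case uses the hypothesis on the last vertex, which must see [X i] or [X j.+1] to
    continue the route. *)
Lemma rotate_before : j < z ->
  (forall i i', attached i -> attached i' -> i != i' -> e (X m.-1) (X i) || e (X m.-1) (X i')) -> False.
Proof.
move=> jz one; have jm := islm lj; have aj : attached j.+1 by apply: isl_succ lj _; nlia.
have ejz : e (X j) (X z) by rewrite symE.
have [i ai ij] : exists2 i, attached i & i != j.+1.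
  have [i1 [i2 [a1 a2 i12]]] := two; case: (eqVneq i1 j.+1) => [e1|]; last by exists i1.
  by exists i2 => //; rewrite -e1; nlia.
have im := attm ai.
have S0 : ham_path e (seg s 0 j) (X 0) (X j) by apply: seg_forward; nlia.
have S5 : ham_path e (seg s z.+1 m.-1) (X z.+1) (X m.-1) by apply: seg_forward; nlia.
case: (ltngtP i z.+1) => iz; last by rewrite iz (negPf naz) in ai.
  case: (ltngtP i j.+1) => ij'; last by rewrite ij' eqxx in ij.
    case: i => [|q] in ai ij im iz ij'; first by rewrite (negPf na0) in ai.
    have T0 : ham_path e (seg s 0 q) (X 0) (X q) by apply: seg_forward; nlia.
    have /orP[eq|eq] := one q.+1 j.+1 ai aj ij.
      have [B [u [v [pB eu uB sB]]]] := endC aj.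
      have S3 : ham_path e (seg s q.+1 j) (X q.+1) (X j) by apply: seg_forward; nlia.
      have S4 : ham_path e (seg s j.+1 z) (X z) (X j.+1) by apply: seg_backward; nlia.
      by apply: (longer (ham_path_cat (ham_path_cat (ham_path_cat (ham_path_cat T0 S5 (wpred ai) _) S3 eq _) S4 ejz _) pB eu _) _ _ (c := u)); fin sB uB.
    have [B [u [v [pB eu uB sB]]]] := endC ai.
    have S3 : ham_path e (seg s q.+1 j) (X j) (X q.+1) by apply: seg_backward; nlia.
    have S4 : ham_path e (seg s j.+1 z) (X j.+1) (X z) by apply: seg_forward; nlia.
    by apply: (longer (ham_path_cat (ham_path_cat (ham_path_cat (ham_path_cat T0 S5 (wpred ai) _) S4 eq _) S3 ezj _) pB eu _) _ _ (c := u)); fin sB uB.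
  case: i => [//|q] in ai ij im iz ij'.
  have [B [u [v [pB eu ev uB sB]]]] := joinC ai aj.
  have S3 : ham_path e (seg s q.+1 z) (X z) (X q.+1) by apply: seg_backward; nlia.
  have S4 : ham_path e (seg s j.+1 q) (X j.+1) (X q) by apply: seg_forward; nlia.
  by apply: (longer (ham_path_cat (ham_path_cat (ham_path_cat (ham_path_cat S0 S3 ejz _) pB eu _) S4 ev _) S5 (wpred ai) _) _ _ (c := u)); fin sB uB.
have [B [u [v [pB eu ev uB sB]]]] := joinC aj ai.
have S3 : ham_path e (seg s j.+1 z) (X z) (X j.+1) by apply: seg_backward; nlia.
have S4 : ham_path e (seg s i m.-1) (X i) (X m.-1) by apply: seg_forward; nlia.
have S6 : ham_path e (seg s z.+1 i.-1) (X z.+1) (X i.-1) by apply: seg_forward; nlia.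
by apply: (longer (ham_path_cat (ham_path_cat (ham_path_cat (ham_path_cat S0 S3 ejz _) pB eu _) S4 ev _) S6 wlast _) _ _ (c := u)); fin sB uB.
Qed.

End Rotations.

(** Now [L] has one vertex more than [Es], the count is tight, and [y] is missed by some [w]. This
    [w] sees all of [L], so it lies on the path, unattached. The rotations exclude every position
    but the first, and with [w] first a member of [L] in [St] could start a longer path. *)
Lemma start_unattached : ~~ attached 0 -> 1 < #|Es| ->
  exists2 q, q \in L & (forall x, x \in Es -> exists2 v, v \in L :\ q & misses e (y |: L) x v)
    /\ (forall l, l \in L -> l \notin St).
Proof.
move=> na0 two; have [i1 [i2 [a1 a2 i12]]] := two_att two.
have cL : #|L| = #|Es|.+1.
  by rewrite card_L (cardsD1 (X 0) Es) XEs // (negPf na0).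
have L2 : 1 < #|L| by rewrite cL ltnW.
have [my [q qL [_ bij inj]]] := missers_tight L_A indepL L_C y_notin_L L2 cL.
exists q => //; split=> //.
case/exists_inP: my => w wW /missesP[nwy wall].
have wL l : l \in L -> e w l.
  by move=> lL; apply: wall; [rewrite in_setU1 lL orbT | apply: contraNneq y_notin_L => <-].
have wA := subsetP (sWA _) _ wW.
have ws : w \in s by apply: last_nbr wA _; rewrite symE; apply/wL/LX/last_isl.
have [p pm ew] : exists2 p, p < m & w = X p by exists (index w s); rewrite ?idxm ?nth_index.
have wl i : pre_attached i -> e (X p) (X i) by move=> li; rewrite -ew; apply/wL/LX.
have nap : ~~ attached p.
  apply/negP => /EsX; rewrite -ew => /bij[v].
  by rewrite in_setD1 => /andP[_ vL] /missesP[]; rewrite wL.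
have nlp : ~~ pre_attached p by apply/negP => /wl; rewrite irrE.
case: p => [|z] in pm ew wl nap nlp.
  move=> _ /LP[i li ->]; apply/negP => iSt; have im := islm li.
  have a1pos : 0 < i1 by rewrite lt0n; apply: contraNneq na0 => <-.
  have [lt|le] := ltnP i.+1 m.
    have [B [u [v [pB eu uB sB]]]] := endC (isl_succ li lt).
    have S1 : ham_path e (seg s 0 i) (X i) (X 0) by apply: seg_backward; nlia.
    have S2 : ham_path e (seg s i.+1 m.-1) (X m.-1) (X i.+1) by apply: seg_backward; nlia.
    by apply: (longer (ham_path_cat (ham_path_cat S1 S2 (wl _ last_isl) _) pB eu _) _ _ (c := u)); fin sB uB.
  have ei : i = m.-1 by nlia.
  have m2 := attm a2.
  have [B [u [v [pB eu ev uB sB]]]] := joinC a2 a1.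
  have S1 : ham_path e (seg s i2 i) (X i) (X i2) by apply: seg_backward; nlia.
  have S2 : ham_path e (seg s i1 i2.-1) (X i1) (X i2.-1) by apply: seg_forward; nlia.
  have S3 : ham_path e (seg s 0 i1.-1) (X 0) (X i1.-1) by apply: seg_forward; nlia.
  have e1 : e (X i2.-1) (X 0) by rewrite symE; apply/wl/att_pred; rewrite prednK //; nlia.
  by apply: (longer (ham_path_cat (ham_path_cat (ham_path_cat S1 pB eu _) S2 ev _) S3 e1 _) _ _ (c := u)); fin sB uB.
exfalso; have zm : z < m := ltnW pm.
have nlz : ~~ pre_attached z by rewrite /pre_attached (negPf nap) orbF zm; nlia.
(* If the predecessor of [w] is attached, its own predecessor is in [L]. If it is unattached without
   neighbour in [L], adding it to [L] breaks the bound of [missers_le]. *)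
have [j lj ezj] : exists2 j, pre_attached j & e (X z) (X j).
  have [az|naz] := boolP (attached z).
    have z0 : 0 < z by rewrite lt0n; apply: contraNneq na0 => <-.
    exists z.-1; first by apply: att_pred; rewrite prednK.
    by rewrite symE -{2}(prednK z0); apply: edgeX; rewrite prednK.
  have [/exists_inP[l /LP[j lj ->] zj]|/exists_inPn none] := boolP [exists l in L, e (X z) l].
    by exists j.
  have zL : X z \notin L by rewrite inE memX // idxX.
  have zC c : c \in C -> ~~ e (X z) c.
    by move=> cC; apply: contra naz => zc; rewrite /attached zm; apply/exists_inP; exists c.
  have : #|X z |: L| <= #|Es|.+1.
    apply: missers_le.
    - by rewrite subUset sub1set sA ?memX // L_A.
    - move=> u v; rewrite !in_setU1 => /predU1P[->|uL] /predU1P[->|vL]; rewrite ?irrE //.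
      + exact: none.
      + by rewrite symE; exact: none.
      exact: indepL.
    - by move=> l c; rewrite in_setU1 => /predU1P[->|lL]; [exact: zC | exact: L_C].
    - by rewrite in_setU1 negb_or y_notin_L andbT; apply: contraNneq (Cs yC) => ->; rewrite memX.
    - by rewrite cardsU1 zL; nlia.
  by rewrite cardsU1 zL cL; nlia.
have two' : exists i1 i2, [/\ attached i1, attached i2 & i1 < i2] by exists i1, i2.
case: (ltngtP j z.+1) => jz; last by rewrite -jz lj in nlp.
  have jz' : j < z.
    rewrite ltn_neqAle -ltnS jz andbT; apply/negP => /eqP ej; by rewrite ej irrE in ezj.
  apply: (rotate_before pm nap na0 wl lj ezj two' jz') => i i' ai ai' nii'.
  apply/negPn/negP; rewrite negb_or => /andP[ni ni'].
  case/eqP: nii'; apply: Xinj; rewrite ?attm //.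
  by apply: (inj _ _ (EsX ai) (EsX ai') (X m.-1)); rewrite 1?symE //; exact/LX/last_isl.
exact: (rotate_after pm nap na0 wl lj ezj two' jz).
Qed.

(** * Longest paths that start in a clique *)

Section CliqueStart.
Hypotheses (sStA : St \subset A) (cliqueSt : {in St &, forall u v, u != v -> e u v}).
Hypothesis WSt : forall I : {set T}, (forall x, x \in I -> x \notin St) -> W I \subset St.
Hypothesis star_clique : forall (I : {set T}) n v, I \subset A -> indep e I -> 3 <= #|I| ->
  n \in I -> n \in St -> v \in I -> v != n -> missed I v.
Hypothesis star_dom : forall (I : {set T}) u v, I \subset A -> indep e I -> 3 <= #|I| ->
  (forall x, x \in I -> x \notin St) -> u \in I -> v \in I -> u != v ->
  exists a b w, [/\ (a = u /\ b = v) \/ (a = v /\ b = u), w \in St, misses e I w b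
    & forall r, r \in A -> r \notin St -> r != b -> [|| r == a, e r a | e r w]].
(* When [A] is a side of [c], [Z] is the part inside [A] of a smaller connected
   dominating set of the graph with the edge from [c] to [r]. *)
Hypothesis local : forall r, r \in A -> r \notin St -> exists Z : {set T},
  [/\ #|Z| <= 2,
      forall p, p \in Z -> p \notin St -> p != r -> exists2 p', p' \in Z & p' != p /\ e p p',
      forall a, a \in A -> a \notin St -> a != r -> a \in Z \/ exists2 z, z \in Z & e a z,
      r \notin Z -> forall z, z \in Z -> ~~ e r z
    & r \notin Z -> Z != set0 -> exists2 z, z \in Z & z \in St].
Hypothesis no_simplicial : forall r r', r \in A -> r \notin St -> r' \in A -> r' \notin St ->
  r != r' -> ~ simplicial e r.
Hypothesis inner : forall r z, r \in A -> r \notin St -> e r z -> z \in A.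

Lemma St_s v : v \in St -> v \in s.
Proof.
move=> vSt; apply/negPn/negP => vs.
have v0 : v != X 0 by apply: contraNneq vs => ->; rewrite memX.
have pS : ham_path e ([set v] :|: seg s 0 m.-1) v (X m.-1).
  apply: ham_path_cat (ham_path1 e v) (seg_forward _) (cliqueSt vSt sSt v0) _; first by nlia.
  by move=> z; rewrite !inE => /eqP-> /andP[zs _]; rewrite zs in vs.
have := longest pS _ vSt; rewrite subUset sub1set (subsetP sStA _ vSt) /=.
have -> : seg s 0 m.-1 = [set z in s].
  by apply/setP => z; move: (@idxm z); rewrite !inE; keepnat; case: (z \in s) => /=; lia.
rewrite cardsU1 inE vs cardsE (card_uniqP us) szs add1n ltnn => /(_ _)/negP[] //.
by apply/subsetP => z; rewrite inE; exact: sA.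
Qed.

Lemma C_St c : c \in C -> c \notin St.
Proof. by move=> /Cs; apply: contra; exact: St_s. Qed.

Lemma nbr_Es x c : x \in s -> c \in C -> e x c -> x \in Es.
Proof.
move=> xs cC xc; rewrite inE xs /attached idxm //; apply/exists_inP; exists c => //.
by rewrite nth_index.
Qed.

Lemma L_notC l : l \in L -> l \notin C.
Proof. by rewrite inE => /andP[ls _]; apply: contraL ls => /Cs. Qed.

(** The set [Z] that [local] gives at [q] has to take care of [y] and [l], which forces some [x] of
    [Es] into it. As [x] sees [q], also [q] is in [Z], so [Z] is [{q, x}]; but the member of [J]
    that [x] does not see is adjacent to neither. *)
Lemma kill (J : {set T}) q l : J \subset A -> (forall x, x \in J -> x \notin St) -> indep e J ->
  y \in J -> q \in J -> q != y -> l \in J -> l != y -> l != q ->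
  (forall j c, j \in J -> j != y -> c \in C -> ~~ e j c /\ j \notin C) ->
  (forall x, x \in Es -> e x q /\ exists2 v, v \in J & v != q /\ ~~ e x v) -> False.
Proof.
move=> sJ JSt iJ yJ qJ qy lJ ly lq JC EJ.
have inA := subsetP sJ.
have [Z [Z2 Zc Zd Zn _]] := local (inA _ qJ) (JSt _ qJ).
have only a b z : a \in Z -> b \in Z -> a != b -> z \in Z -> z = a \/ z = b.
  move=> aZ bZ ab zZ; case: (eqVneq z a) => [|za]; first by left.
  case: (eqVneq z b) => [|zb]; first by right.
  exfalso; move: Z2; rewrite (cardsD1 a) aZ (cardsD1 b) !inE eq_sym ab bZ.
  by rewrite (cardsD1 z) !inE za zb zZ.
have [x xZ xE] : exists2 x, x \in Z & x \in Es.
  have sp p c : p \in A -> c \in C -> e c p -> p \notin C -> p \in Es.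
    move=> pA cC cp pC; have := cloC cC pA cp; rewrite (negPf pC) /= => ps.
    by apply: (nbr_Es ps cC); rewrite symE.
  have [p pZ pE] : exists2 p, p \in Z & (p \in C) || (p \in Es).
    have yq : y != q by rewrite eq_sym.
    have [yZ|[z zZ yz]] := Zd _ (inA _ yJ) (JSt _ yJ) yq; first by exists y; rewrite ?yC.
    exists z => //; case: (boolP (z \in C)) => //= zC; apply: (sp z y) => //.
    by apply: inner yz; rewrite ?inA ?JSt.
  (* If [Z] meets [C] in [p], its other vertex lies outside [C], since [l] has no neighbour in [C];
     and this other vertex is adjacent to [p]. *)
  case/orP: pE => [pC|]; last by exists p.
  have [p' p'Z p'C] : exists2 p', p' \in Z & p' \notin C.
    have [lZ|[z zZ lz]] := Zd _ (inA _ lJ) (JSt _ lJ) lq.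
      by exists l => //; case: (JC l y lJ ly yC).
    by exists z => //; apply/negP => zC; case: (JC l z lJ ly zC); rewrite lz.
  have pq : p != q by apply: contraTneq pC => ->; case: (JC q y qJ qy yC).
  have [p'' p''Z [np ep]] := Zc p pZ (C_St pC) pq.
  have pp' : p != p' by apply: contraNneq p'C => <-.
  have [ep''|ep''] := only p p' p'' pZ p'Z pp' p''Z; first by rewrite ep'' eqxx in np.
  exists p' => //; rewrite -ep''; apply: (sp p'' p) => //; last by rewrite ep''.
  exact: inner (subsetP sCA _ pC) (C_St pC) ep.
have [xq [v vJ [vq xv]]] := EJ x xE.
have [qZ|qZ] := boolP (q \in Z); last by have := Zn qZ x xZ; rewrite symE xq.
have qx : q != x by apply: contraTneq xq => <-; rewrite irrE.
have [vZ|[z zZ vz]] := Zd _ (inA _ vJ) (JSt _ vJ) vq.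
  have [ev|ev] := only q x v qZ xZ qx vZ; first by rewrite ev eqxx in vq.
  by move: (iJ _ _ vJ qJ); rewrite ev xq.
have [ez|ez] := only q x z qZ xZ qx zZ; rewrite ez in vz.
  by move: (iJ _ _ vJ qJ); rewrite vz.
by rewrite symE vz in xv.
Qed.

Lemma pred_notin_L z : z.+1 < m -> ~~ attached z.+1 -> X z \notin L.
Proof. by move=> zm nz; rewrite inE memX ?idxX ?(ltnW zm) // /pre_attached (negPf nz) (ltnW zm) orbF; nlia. Qed.

Lemma natt_C z c : z < m -> ~~ attached z -> c \in C -> ~~ e (X z) c.
Proof.
by move=> zm nz cC; apply: contra nz => zc; rewrite /attached zm; apply/exists_inP; exists c.
Qed.

Lemma predL_ok z : z.+1 < m -> ~~ attached z -> ~~ attached z.+1 -> (forall l, l \in L -> ~~ e (X z) l) ->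
  [/\ X z |: L \subset A, indep e (X z |: L),
      forall j c, j \in X z |: L -> c \in C -> ~~ e j c,
      y \notin X z |: L & #|X z |: L| = #|L|.+1].
Proof.
move=> zm naz nz none; have zm' := ltnW zm; split.
- by rewrite subUset sub1set sA ?memX // L_A.
- move=> u v; rewrite !in_setU1 => /predU1P[->|uL] /predU1P[->|vL]; rewrite ?irrE //.
  + exact: none.
  + by rewrite symE; exact: none.
  exact: indepL.
- by move=> l c; rewrite in_setU1 => /predU1P[->|lL]; [exact: natt_C | exact: L_C].
- by rewrite in_setU1 negb_or y_notin_L andbT; apply: contraNneq (Cs yC) => ->; rewrite memX.
by rewrite cardsU1 pred_notin_L.
Qed.

(** Adding [X z] to [L] restores the tight count although [X 0] is attached; the unmissed member is
    then seen by all of [Es], as [kill] requires. *)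
Lemma isolated_kill z : attached 0 -> 1 < #|Es| -> z.+1 < m -> ~~ attached z -> ~~ attached z.+1 ->
  (forall l, l \in L -> ~~ e (X z) l) -> (forall l, l \in L -> l \notin St) ->
  X z \notin St -> False.
Proof.
move=> a0 two zm naz nz none LSt zSt.
have [sJ iJ JC yJ cJ] := predL_ok zm naz nz none; set J := X z |: L in sJ iJ JC yJ cJ.
have cE : #|J| = #|Es|.+1 by rewrite cJ card_L (cardsD1 (X 0) Es) EsX.
have J2 : 1 < #|J| by rewrite cE ltnW.
have [_ [q qJ [_ bij _]]] := missers_tight sJ iJ JC yJ J2 cE.
have sI : y |: J \subset A by rewrite subUset sub1set sJ (subsetP sCA).
have JSt x : x \in J -> x \notin St by rewrite in_setU1 => /predU1P[->|/LSt].
have JnC x : x \in J -> x \notin C.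
  rewrite in_setU1 => /predU1P[->|]; last exact: L_notC.
  by apply: contraL (memX (ltnW zm)) => /Cs.
clearbody J.
have qy : q != y by apply: contraTneq qJ => ->.
have [l lJ lq] : exists2 l, l \in J & l != q.
  move: J2; rewrite (cardsD1 q) qJ add1n ltnS card_gt0 => /set0Pn[l].
  by rewrite in_setD1 => /andP[? ?]; exists l.
have ly : l != y by apply: contraTneq lJ => ->.
apply: (@kill (y |: J) q l) => //; rewrite ?setU11 ?in_setU1 ?qJ ?lJ ?orbT //.
- by move=> x; rewrite in_setU1 => /predU1P[->|/JSt //]; exact: C_St.
- move=> u v; rewrite !in_setU1 => /predU1P[->|uJ] /predU1P[->|vJ]; rewrite ?irrE //.
  + by rewrite symE; exact: JC.
  + exact: JC.
  exact: iJ.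
- move=> j c; rewrite in_setU1 => /predU1P[->|jJ]; first by rewrite eqxx.
  by move=> _ cC; split; [exact: JC | exact: JnC].
move=> x /bij[v]; rewrite in_setD1 => /andP[vq vJ] /missesP[nv vall]; split.
  by apply: vall; rewrite ?in_setU1 ?qJ ?orbT // eq_sym.
by exists v; rewrite // in_setU1 vJ orbT.
Qed.

Lemma indep_y J : indep e J -> (forall j c, j \in J -> c \in C -> ~~ e j c) -> indep e (y |: J).
Proof.
move=> iJ JC u v; rewrite !in_setU1 => /predU1P[->|uJ] /predU1P[->|vJ]; rewrite ?irrE //.
- by rewrite symE; exact: JC.
- exact: JC.
exact: iJ.
Qed.

Lemma other_in (S : {set T}) x : 1 < #|S| -> x \in S -> exists2 z, z \in S & z != x.
Proof.
rewrite (cardsD1 x) => S2 xS; move: S2; rewrite xS add1n ltnS card_gt0 => /set0Pn[z].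
by rewrite in_setD1 => /andP[? ?]; exists z.
Qed.

Lemma kill_L q : (forall l, l \in L -> l \notin St) -> 1 < #|L| -> q \in L ->
  (forall x, x \in Es -> e x q /\ exists2 v, v \in y |: L & v != q /\ ~~ e x v) -> False.
Proof.
move=> LSt L2 qL; have [l lL lq] := other_in L2 qL.
have Ly v : v \in L -> v != y by apply: contraTneq => ->; exact: y_notin_L.
apply: (@kill (y |: L) q l); rewrite ?setU11 ?Ly ?in_setU1 ?qL ?lL ?orbT //.
- by rewrite subUset sub1set (subsetP sCA) // L_A.
- by move=> x; rewrite in_setU1 => /predU1P[->|/LSt //]; exact: C_St.
- exact: indep_y indepL L_C.
move=> j c; rewrite in_setU1 => /predU1P[->|jL]; first by rewrite eqxx.
by move=> _ cC; split; [exact: L_C | exact: L_notC].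
Qed.

Section AttachedStart.
Hypothesis a0 : attached 0.

(** A path could start at such a vertex, run back to [X 0] and enter [C] there. *)
Lemma L_notSt l : l \in L -> l \notin St.
Proof.
move=> /LP[i li ->]; apply/negP => iSt; have im := islm li.
have S1 : ham_path e (seg s 0 i) (X i) (X 0) by apply: seg_backward; nlia.
have [lt|le] := ltnP i.+1 m.
  have [B [u [v [pB eu ev uB sB]]]] := joinC a0 (isl_succ li lt).
  have S2 : ham_path e (seg s i.+1 m.-1) (X i.+1) (X m.-1) by apply: seg_forward; nlia.
  by apply: (longer (ham_path_cat (ham_path_cat S1 pB eu _) S2 ev _) _ _ (c := u)); fin sB uB.
have [B [u [v [pB eu uB sB]]]] := endC a0.
by apply: (longer (ham_path_cat S1 pB eu _) _ _ (c := u)); fin sB uB.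
Qed.

(** * Paths restarted at a later vertex of the clique *)

Section Turn.
Variable z : nat.
Hypotheses (zm : z.+1 < m) (zSt : X z.+1 \in St).

Lemma turn_after j : z.+1 <= j -> pre_attached j -> ~~ e (X z) (X j).
Proof.
move=> zj lj; apply/negP => ezj; have jm := islm lj.
have ejz : e (X j) (X z) by rewrite symE.
have S1 : ham_path e (seg s z.+1 j) (X z.+1) (X j) by apply: seg_forward; nlia.
have S2 : ham_path e (seg s 0 z) (X z) (X 0) by apply: seg_backward; nlia.
have [lt|le] := ltnP j.+1 m.
  have [B [u [v [pB eu ev uB sB]]]] := joinC a0 (isl_succ lj lt).
  have S3 : ham_path e (seg s j.+1 m.-1) (X j.+1) (X m.-1) by apply: seg_forward; nlia.
  by apply: (longer (ham_path_cat (ham_path_cat (ham_path_cat S1 S2 ejz _) pB eu _) S3 ev _) _ _ (c := u)); fin sB uB.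
have [B [u [v [pB eu uB sB]]]] := endC a0.
by apply: (longer (ham_path_cat (ham_path_cat S1 S2 ejz _) pB eu _) _ _ (c := u)); fin sB uB.
Qed.

Variable j : nat.
Hypotheses (jz : j < z) (lj : pre_attached j) (ezj : e (X z) (X j)).

Let ejz : e (X j) (X z). Proof. by rewrite symE. Qed.
Lemma turn_att : attached j.+1. Proof. by apply: isl_succ lj _; nlia. Qed.

(** Start at [X z.+1], run to [X r], then cover [0..z] as two segments joined by the edge between
    [X z] and [X j]. The two directions of this detour give this lemma and [turn_0]. *)
Lemma turn_E r : z.+1 <= r -> pre_attached r -> ~~ e (X j.+1) (X r).
Proof.
move=> zr lr; apply/negP => ejr; have rm := islm lr.
have erj : e (X r) (X j.+1) by rewrite symE.
have S1 : ham_path e (seg s z.+1 r) (X z.+1) (X r) by apply: seg_forward; nlia.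
have S2 : ham_path e (seg s j.+1 z) (X j.+1) (X z) by apply: seg_forward; nlia.
have S3 : ham_path e (seg s 0 j) (X j) (X 0) by apply: seg_backward; nlia.
have [lt|le] := ltnP r.+1 m.
  have [B [u [v [pB eu ev uB sB]]]] := joinC a0 (isl_succ lr lt).
  have S4 : ham_path e (seg s r.+1 m.-1) (X r.+1) (X m.-1) by apply: seg_forward; nlia.
  by apply: (longer (ham_path_cat (ham_path_cat (ham_path_cat (ham_path_cat S1 S2 erj _) S3 ezj _) pB eu _) S4 ev _) _ _ (c := u)); fin sB uB.
have [B [u [v [pB eu uB sB]]]] := endC a0.
by apply: (longer (ham_path_cat (ham_path_cat (ham_path_cat S1 S2 erj _) S3 ezj _) pB eu _) _ _ (c := u)); fin sB uB.
Qed.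

Lemma turn_0 r : z.+1 <= r -> pre_attached r -> ~~ e (X 0) (X r).
Proof.
move=> zr lr; apply/negP => e0r; have rm := islm lr.
have er0 : e (X r) (X 0) by rewrite symE.
have S1 : ham_path e (seg s z.+1 r) (X z.+1) (X r) by apply: seg_forward; nlia.
have S2 : ham_path e (seg s j.+1 z) (X z) (X j.+1) by apply: seg_backward; nlia.
have S3 : ham_path e (seg s 0 j) (X 0) (X j) by apply: seg_forward; nlia.
have [lt|le] := ltnP r.+1 m.
  have [B [u [v [pB eu ev uB sB]]]] := joinC turn_att (isl_succ lr lt).
  have S4 : ham_path e (seg s r.+1 m.-1) (X r.+1) (X m.-1) by apply: seg_forward; nlia.
  by apply: (longer (ham_path_cat (ham_path_cat (ham_path_cat (ham_path_cat S1 S3 er0 _) S2 ejz _) pB eu _) S4 ev _) _ _ (c := u)); fin sB uB.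
have [B [u [v [pB eu uB sB]]]] := endC turn_att.
by apply: (longer (ham_path_cat (ham_path_cat (ham_path_cat S1 S3 er0 _) S2 ejz _) pB eu _) _ _ (c := u)); fin sB uB.
Qed.

Lemma turn_other q : attached q -> 0 < q -> q <= z -> q != j.+1 -> ~~ e (X q) (X m.-1).
Proof.
move=> aq q0 qz qj; apply/negP => eqm; have emq : e (X m.-1) (X q) by rewrite symE.
have S1 : ham_path e (seg s z.+1 m.-1) (X z.+1) (X m.-1) by apply: seg_forward; nlia.
case: (ltngtP q j.+1) => qj'; last by rewrite qj' eqxx in qj.
  have S2 : ham_path e (seg s q j) (X q) (X j) by apply: seg_forward; nlia.
  have S3 : ham_path e (seg s j.+1 z) (X z) (X j.+1) by apply: seg_backward; nlia.
  have S4 : ham_path e (seg s 0 q.-1) (X 0) (X q.-1) by apply: seg_forward; nlia.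
  have [B [u [v [pB eu ev uB sB]]]] := joinC turn_att a0.
  by apply: (longer (ham_path_cat (ham_path_cat (ham_path_cat (ham_path_cat S1 S2 emq _) S3 ejz _) pB eu _) S4 ev _) _ _ (c := u)); fin sB uB.
have S2 : ham_path e (seg s q z) (X q) (X z) by apply: seg_forward; nlia.
have S3 : ham_path e (seg s 0 j) (X j) (X 0) by apply: seg_backward; nlia.
have S4 : ham_path e (seg s j.+1 q.-1) (X j.+1) (X q.-1) by apply: seg_forward; nlia.
have [B [u [v [pB eu ev uB sB]]]] := joinC a0 turn_att.
by apply: (longer (ham_path_cat (ham_path_cat (ham_path_cat (ham_path_cat S1 S2 emq _) S3 ezj _) pB eu _) S4 ev _) _ _ (c := u)); fin sB uB.
Qed.

End Turn.

Lemma second_last i : attached i -> 1 < i -> ~~ e (X 1) (X m.-1).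
Proof.
move=> ai i1; apply/negP => e1m; have im := att_ltm ai.
have S1 : ham_path e (seg s 0 0) (X 0) (X 0) by apply: seg_forward; nlia.
have S2 : ham_path e (seg s 1 i) (X i) (X 1) by apply: seg_backward; nlia.
have S3 : ham_path e (seg s i.+1 m.-1) (X m.-1) (X i.+1) by apply: seg_backward; nlia.
have [B [u [v [pB eu ev uB sB]]]] := joinC a0 ai.
by apply: (longer (ham_path_cat (ham_path_cat (ham_path_cat S1 pB eu _) S2 ev _) S3 e1m _) _ _ (c := u)); fin sB uB.
Qed.

Lemma card_L0 : #|L| = #|Es|.
Proof. by rewrite card_L (cardsD1 (X 0) Es) EsX. Qed.

Lemma isl_pred_turn z j : z.+1 < m -> ~~ attached z.+1 -> X z.+1 \in St -> pre_attached j ->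
  e (X z) (X j) -> j < z.
Proof.
move=> zm nz zSt lj ezj; case: (ltngtP j z) => // jz.
  by have := turn_after zm zSt jz lj; rewrite ezj.
by rewrite jz irrE in ezj.
Qed.

(** Every vertex of [Es] sees [y], so the set that [local] gives at [y] yields an unattached vertex
    of [St]. Restarting at the first such vertex on the path shows that [X 0] and another attached
    vertex both miss the last vertex, against injectivity. *)
Lemma all_miss : 1 < #|Es| ->
  (forall x, x \in Es -> exists2 v, v \in L & misses e (y |: L) x v) ->
  {in Es &, forall x x' v, v \in L -> ~~ e x v -> ~~ e x' v -> x = x'} -> False.
Proof.
move=> two bij inj; have LSt := L_notSt; have inA := subsetP L_A.
have yA := subsetP sCA _ yC; have ySt := C_St yC.
have misL x : x \in Es -> e x y.
  move=> /bij[v vL /missesP[_]]; apply; rewrite ?setU11 //.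
  by apply: contraNneq y_notin_L => ->.
have L2 : 1 < #|L| by rewrite card_L0.
have [u uSt uE] : exists2 u, u \in St & u \notin Es.
  have [Z [Z2 Zc Zd Zn Zs]] := local yA ySt.
  have ly l : l \in L -> l != y by apply: contraTneq => ->; exact: y_notin_L.
  have [yZ|yZ] := boolP (y \in Z); last first.
    have Z0 : Z != set0.
      have /card_gt0P[l lL] : 0 < #|L| by rewrite ltnW.
      have [lZ|[z zZ _]] := Zd l (inA _ lL) (LSt _ lL) (ly _ lL); apply/set0Pn; by [exists l|exists z].
    have [z zZ zSt] := Zs yZ Z0; exists z => //; apply/negP => /misL.
    by rewrite symE (negPf (Zn yZ z zZ)).
  have only a b z : a \in Z -> b \in Z -> a != b -> z \in Z -> z = a \/ z = b.
    move=> aZ bZ ab zZ; case: (eqVneq z a) => [|za]; first by left.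
    case: (eqVneq z b) => [|zb]; first by right.
    exfalso; move: Z2; rewrite (cardsD1 a) aZ (cardsD1 b) !inE eq_sym ab bZ.
    by rewrite (cardsD1 z) !inE za zb zZ.
  have noL l l' : l \in L -> l' \in L -> l != l' -> l \notin Z.
    move=> lL lL' ll'; apply/negP => lZ; have yl : y != l by rewrite eq_sym ly.
    have [l'Z|[z zZ lz]] := Zd l' (inA _ lL') (LSt _ lL') (ly _ lL').
      have [el|el] := only y l l' yZ lZ yl l'Z; first by have := ly _ lL'; rewrite el eqxx.
      by rewrite el eqxx in ll'.
    have [ez|ez] := only y l z yZ lZ yl zZ; rewrite ez in lz.
      by have := L_C lL' yC; rewrite lz.
    by have := indepL lL' lL; rewrite lz.
  have {}noL l : l \in L -> exists2 z, z \in Z & e l z /\ z != y.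
    move=> lL; have [l' l'L ll'] : exists2 l', l' \in L & l != l'.
      move: L2; rewrite (cardsD1 l) lL add1n ltnS card_gt0 => /set0Pn[l'].
      by rewrite in_setD1 eq_sym => /andP[? ?]; exists l'.
    have lZ := noL l l' lL l'L ll'.
    have [lZ'|[z zZ lz]] := Zd l (inA _ lL) (LSt _ lL) (ly _ lL); first by rewrite lZ' in lZ.
    by exists z => //; split=> //; apply: contraTneq lz => ->; exact: L_C.
  have /card_gt0P[l lL] : 0 < #|L| by rewrite ltnW.
  have [w wZ [lw wy]] := noL l lL; have yw : y != w by rewrite eq_sym.
  have wL l' : l' \in L -> e w l'.
    move=> l'L; have [w' w'Z [lw' w'y]] := noL l' l'L.
    have [ew|ew] := only y w w' yZ wZ yw w'Z; first by rewrite ew eqxx in w'y.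
    by rewrite symE -ew.
  have wE : w \notin Es.
    by apply/negP => /bij[v vL /missesP[]]; rewrite wL.
  exists w => //; apply/negPn/negP => wSt.
  have [p pZ [pw ep]] := Zc w wZ wSt wy.
  have [epp|epp] := only y w p yZ wZ yw pZ; last by rewrite epp eqxx in pw.
  have wC : w \notin C by apply: contraTN lw => wC; exact: L_C.
  have wA : w \in A by apply: inner lw; [exact: inA | exact: LSt].
  have := cloC yC wA; rewrite (negPf wC) symE -epp ep => /(_ isT) /= ws.
  by case/negP: wE; apply: (nbr_Es ws yC); rewrite -epp.
have ex : exists p, (p < m) && (X p \in St) && ~~ attached p.
  have us' := St_s uSt; exists (index u s); rewrite idxm //= nth_index // uSt /=.
  by apply: contra uE; rewrite inE us'.
(* Minimality keeps an unattached predecessor out of [St], as [isolated_kill] requires. *)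
case: (ex_minnP ex) => -[|z] /andP[/andP[pm pSt] nap] minp; first by rewrite a0 in nap.
have zm : z < m := ltnW pm.
suff [j lj ezj] : exists2 j, pre_attached j & e (X z) (X j).
  have jz := isl_pred_turn pm nap pSt lj ezj.
  have mz : z.+1 <= m.-1 by nlia.
  have n1 := turn_E pm pSt jz ezj mz last_isl; have n2 := turn_0 pm pSt jz lj ezj mz last_isl.
  have aj := turn_att pm jz lj.
  have e0 := inj _ _ (EsX a0) (EsX aj) _ (LX last_isl) n2 n1.
  by have := Xinj m_gt0 (attm aj) e0.
have [az|naz] := boolP (attached z).
  have [v vL /missesP[nv vall]] := bij _ (EsX az).
  move: L2; rewrite (cardsD1 v) vL add1n ltnS card_gt0 => /set0Pn[l].
  rewrite in_setD1 => /andP[lv lL]; have [j lj el] := LP lL.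
  by exists j => //; rewrite -el; apply: vall; rewrite // in_setU1 lL orbT.
have [/exists_inP[l /LP[j lj ->] zj]|/exists_inPn none] := boolP [exists l in L, e (X z) l].
  by exists j.
have zSt : X z \notin St.
  by apply/negP => zSt; have := minp z; rewrite zm zSt naz ltnn => /(_ isT).
exfalso; exact: (isolated_kill a0 two pm naz nap none LSt zSt).
Qed.

(** Now [L] and [Es] have equal size. If all of [L] is missed, [all_miss] applies. Otherwise [y] is
    missed by some [w] of [St] adjacent to all of [L], and one vertex of [Es] remains outside the
    set [F] of missing vertices. The cases depend on [w] and its predecessor on the path. *)
Lemma start_attached : 1 < #|Es| -> False.
Proof.
move=> two; have L2 : 1 < #|L| by rewrite card_L0.
have Ly v : v \in L -> v != y by apply: contraTneq => ->; exact: y_notin_L.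
have yA := subsetP sCA _ yC; have ySt := C_St yC.
have iI := indep_y indepL L_C.
have sI : y |: L \subset A by rewrite subUset sub1set yA L_A.
have ISt x : x \in y |: L -> x \notin St by rewrite in_setU1 => /predU1P[->|/L_notSt].
have I3 : 2 < #|y |: L| by rewrite cardsU1 y_notin_L.
have [f [Jm [sJm fi fE cas]]] := missers L_A indepL L_C y_notin_L L2.
pose F := f @: Jm.
have sFE : F \subset Es.
  by apply/subsetP => _ /imsetP[v /fE[fv _] ->]; move: fv; rewrite inE => /andP[].
have cF : #|F| = #|Jm| by rewrite card_in_imset.
have Fmis x v : x \in F -> v \in L -> ~~ e x v -> v \in Jm /\ x = f v.
  move=> /imsetP[u uJm ->] vL nv; have [_ /missesP[_ fu]] := fE u uJm.
  suff <- : u = v by [].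
  apply/eqP/negPn/negP => uv; case/negP: nv; apply: fu; first by rewrite in_setU1 vL orbT.
  by rewrite eq_sym.
have FX x : x \in F -> exists2 v, v \in Jm & misses e (y |: L) x v.
  by case/imsetP=> v vJm ->; exists v; case: (fE v vJm).
case: cas => [eJm|[my [q qL [eJm nq]]]].
  have eF : F = Es by apply/eqP; rewrite eqEcard sFE cF eJm card_L0 leqnn.
  apply: all_miss => //.
    by move=> x; rewrite -eF => /FX[v vJm ?]; exists v; rewrite // -eJm.
  move=> x x' xE xE' v vL nv nv'; rewrite -eF in xE xE'.
  by have [_ ->] := Fmis x v xE vL nv; have [_ ->] := Fmis x' v xE' vL nv'.
have cFE : #|Es| = #|F|.+1.
  by rewrite -card_L0 (cardsD1 q) qL cF eJm.
have [w wW wmis] := exists_inP my; have wSt := subsetP (WSt ISt) _ wW.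
have [nwy wall] := missesP _ _ _ _ wmis.
have wL l : l \in L -> e w l by move=> lL; apply: wall; rewrite ?Ly // in_setU1 lL orbT.
have FJ v : v \in Jm -> v \in L /\ v != q by rewrite eJm in_setD1 => /andP[].
have [wE|wE] := boolP (w \in Es).
  have wF : w \notin F.
    apply/negP => /FX[v vJm /missesP[_ vall]]; case/negP: nwy; apply: vall; first exact: setU11.
    by rewrite eq_sym Ly //; case: (FJ v vJm).
  have eF : w |: F = Es.
    by apply/eqP; rewrite eqEcard subUset sub1set wE sFE cardsU1 wF cFE leqnn.
  apply: (kill_L L_notSt L2 qL) => x; rewrite -eF in_setU1 => /predU1P[->|/FX[v vJm /missesP[nv vall]]].
    by split; [exact: wL | exists y; rewrite ?setU11 // eq_sym Ly].
  have [vL vq] := FJ v vJm; split; last by exists v; rewrite // in_setU1 vL orbT.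
  by apply: vall; rewrite ?in_setU1 ?qL ?orbT // eq_sym.
have ws := St_s wSt.
have [p pm ew] : exists2 p, p < m & w = X p by exists (index w s); rewrite ?idxm ?nth_index.
have nap : ~~ attached p by rewrite -XEs // -ew.
case: p => [|z] in pm ew nap; first by rewrite a0 in nap.
have pSt : X z.+1 \in St by rewrite -ew.
have zm : z < m := ltnW pm.
have [/exists_inP[l /LP[j lj ->] ezj]|/exists_inPn none] := boolP [exists l in L, e (X z) l].
  have jz := isl_pred_turn pm nap pSt lj ezj.
  have aj := turn_att pm jz lj.
  have mz : z.+1 <= m.-1 by nlia.
  have n1 := turn_E pm pSt jz ezj mz last_isl; have n2 := turn_0 pm pSt jz lj ezj mz last_isl.
  have jL := LX lj; have mL := LX last_isl.
  have jm : X j != X m.-1 by apply/eqP => /(Xinj (islm lj) (islm last_isl)) ejm; clear -ejm jz mz; lia.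
  have n0j : X 0 != X j.+1 by apply/eqP => /(Xinj m_gt0 (attm aj)).
  have one x x' : x \in F -> x' \in F -> ~~ e x (X m.-1) -> ~~ e x' (X m.-1) -> x = x'.
    by move=> xF xF' /(Fmis _ _ xF mL)[_ ->] /(Fmis _ _ xF' mL)[_ ->].
  have out x x' : x \in Es -> x \notin F -> x' \in Es -> x' != x -> x' \in F.
    move=> xE xF xE' nx; apply/negPn/negP => xF'.
    have : #|[set x; x'] :|: F| <= #|Es|.
      by apply/subset_leq_card; rewrite !subUset !sub1set xE xE' sFE.
    by rewrite -setUA !cardsU1 in_setU1 negb_or eq_sym nx xF xF' cFE add1n ltnn.
  have [o oF [o0 no]] : exists2 o, o \in F & (o = X 0 \/ o = X j.+1) /\ ~~ e o (X m.-1).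
    have [F0|F0] := boolP (X 0 \in F); first by exists (X 0); rewrite ?n2; auto.
    exists (X j.+1); last by auto.
    by apply: (out (X 0)); rewrite ?EsX // eq_sym.
  have noE r : z.+1 <= r -> pre_attached r -> ~~ e o (X r).
    move=> zr lr; case: o0 => ->; [exact (turn_0 pm pSt jz lj ezj zr lr)|].
    exact (turn_E pm pSt jz ezj zr lr).
  (* A third attached vertex would lie in [F] and see the last vertex. Before [w] this contradicts
     [turn_other]; after [w], the vertex [o] would miss both the predecessor of the third vertex and
     the last vertex. *)
  have only x : x \in Es -> x = X 0 \/ x = X j.+1.
    move=> xE; case: (eqVneq x (X 0)) => [|x0']; first by left.
    case: (eqVneq x (X j.+1)) => [|xj]; first by right.
    exfalso; have [i ai ex] := EsP xE.
    have xF : x \in F.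
      have [F0|F0] := boolP (X 0 \in F); last by apply: (out (X 0)); rewrite ?EsX.
      have [Fj|Fj] := boolP (X j.+1 \in F); last by apply: (out (X j.+1)); rewrite ?EsX.
      by case/eqP: n0j; exact: one.
    have ex' : e x (X m.-1).
      apply/negPn/negP => nx; have eo := one x o xF oF nx no.
      by case: o0 => eo0; rewrite eo eo0 eqxx in x0' xj.
    have i0 : 0 < i by rewrite lt0n; apply: contraNneq x0' => i0; rewrite ex i0.
    have ij : i != j.+1 by apply: contraNneq xj => eij; rewrite ex eij.
    have [iz|zi] := leqP i z.
      by have := turn_other pm pSt jz lj ezj ai i0 iz ij; rewrite -ex ex'.
    have iz : i != z.+1 by apply: contraTneq ai => ->.
    have zi' : z.+1 < i by rewrite ltn_neqAle eq_sym iz.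
    have im := attm ai; have li : pre_attached i.-1 by apply: att_pred; rewrite prednK.
    have zi1 : z.+1 <= i.-1 by nlia.
    have [_ e1] := Fmis o _ oF (LX li) (noE _ zi1 li).
    have [vJ e2] := Fmis o _ oF mL no; have [vJ' _] := Fmis o _ oF (LX li) (noE _ zi1 li).
    have /(Xinj (islm li) (islm last_isl)) ei : X i.-1 = X m.-1.
      by apply: fi; rewrite // -e1 -e2.
    by clear -ei im i0; lia.
  have [F0|F0] := boolP (X 0 \in F).
    apply: (kill_L L_notSt L2 jL) => x xE; split; last first.
      exists (X m.-1); first by rewrite in_setU1 mL orbT.
      by rewrite eq_sym; split=> //; case: (only x xE) => ->.
    case: (only x xE) => ->; last by rewrite symE; apply: edgeX; exact: attm.
    apply/negPn/negP => n0; have [vJ e1] := Fmis _ _ F0 jL n0.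
    have [vJ' e2] := Fmis _ _ F0 mL n2.
    by case/eqP: jm; apply: fi; rewrite // -e1 -e2.
  have Fj : X j.+1 \in F by apply: (out (X 0)); rewrite ?EsX // eq_sym.
  have jSt : X j.+1 \in St.
    have/imsetP[v /fE[]] := Fj; rewrite in_setI => /andP[_ fW] _ ->.
    exact: subsetP (WSt ISt) _ fW.
  have noE' x : x \in Es -> ~~ e x (X m.-1) by move=> /only[] ->.
  have jI : X j \in y |: L by rewrite in_setU1 jL orbT.
  have mI : X m.-1 \in y |: L by rewrite in_setU1 mL orbT.
  have yj : y != X j by rewrite eq_sym Ly.
  (* The surviving alternative shrinks [C] to [y]. The neighbours of [y] are then among two attached
     vertices of the clique [St], so [y] is simplicial. *)
  have [a [b [w' [ab wSt' /missesP[nw' wall'] dom]]]] := star_dom sI iI I3 ISt (setU11 _ _) jI yj.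
  have ws' := St_s wSt'.
  case: ab => [[ea eb]|[ea eb]]; rewrite {}ea {}eb in nw' wall' dom.
    have wE' : w' \in Es by apply: (nbr_Es ws' yC); apply: wall'; rewrite ?setU11.
    by have := noE' _ wE'; rewrite wall' // eq_sym.
  have wm : e w' (X m.-1) by apply: wall'; rewrite // Ly.
  have C1 r : r \in C -> r = y.
    move=> rC; apply/eqP/negPn/negP => ry.
    have := dom r (subsetP sCA _ rC) (C_St rC) ry.
    rewrite [e r (X j)]symE (negPf (L_C jL rC)) orFb.
    have -> : (r == X j) = false by apply: contraTF rC => /eqP->; exact: L_notC.
    by rewrite /= symE => /(nbr_Es ws' rC)/noE'; rewrite wm.
  have nb u : e y u -> u \in Es.
    move=> yu; have uA := inner yA ySt yu; have := cloC yC uA yu.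
    have -> : (u \in C) = false.
      by apply: contraTF yu => /C1->; rewrite irrE.
    by move=> us'; apply: (nbr_Es us' yC); rewrite symE.
  apply: (no_simplicial yA ySt (subsetP L_A _ jL) (L_notSt jL) yj).
  by move=> u v /nb/only[]-> /nb/only[]->; rewrite ?eqxx //; exact: cliqueSt.
have [az|naz] := boolP (attached z).
  have [z0|z0] := posnP z.
    have [i1 [i2 [a1 a2 i12]]] := two_att two.
    have i2' : 1 < i2.
      rewrite ltn_neqAle; apply/andP; split; last by nlia.
      by apply: contraNneq nap => e12; rewrite z0 e12.
    have := wL _ (LX last_isl); rewrite ew z0 => e1.
    by have := second_last a2 i2'; rewrite e1.
  have lz : pre_attached z.-1 by apply: att_pred; rewrite prednK.
  have := none _ (LX lz); rewrite symE -{2}(prednK z0) edgeX //.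
  by rewrite prednK.
have [zSt|zSt] := boolP (X z \in St); last first.
  exact: (isolated_kill a0 two pm naz nap none L_notSt zSt).
have [sJ iJ JC yJ cJ] := predL_ok pm naz nap none.
have sLJ : L \subset X z |: L by rewrite subsetUr.
have zJ : X z \in X z |: L by rewrite setU11.
have JL v : v \in X z |: L -> v != X z -> v \in L by rewrite in_setU1 => /predU1P[->|//]; rewrite eqxx.
move: (X z |: L) sJ iJ JC yJ cJ sLJ zJ JL => J sJ iJ JC yJ cJ sLJ zJ JL.
have J2 : 1 < #|J| by rewrite cJ ltnW.
have [_ [q' qJ [nq' bij inj]]] := missers_tight sJ iJ JC yJ J2 (etrans cJ (congr1 succn card_L0)).
have sI' : y |: J \subset A by rewrite subUset sub1set yA.
(* By [star_clique] every member other than [X z] is missed, so the missing vertices of [L] alone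
   exhaust [Es]. *)
have eq' : q' = X z.
  apply/eqP/negPn/negP => nqz; case/negP: nq'.
  apply: (star_clique sI' (indep_y iJ JC) _ _ zSt _ nqz); rewrite ?in_setU1 ?zJ ?qJ ?orbT //.
  by rewrite cardsU1 yJ.
apply: all_miss => // [x /bij[v]|x x' xE xE' v vL].
  rewrite in_setD1 eq' => /andP[vz vJ] /missesP[nv vall]; exists v; first exact: JL.
  apply/missesP; split=> // u uI; apply: vall; move: uI; rewrite !in_setU1 => /orP[->//|uL].
  by rewrite (subsetP sLJ) ?orbT.
by apply: inj => //; exact: subsetP sLJ _ vL.
Qed.

End AttachedStart.

Lemma clique_start : 1 < #|Es| -> False.
Proof.
move=> two; have [a0|na0] := boolP (attached 0); first exact: start_attached a0 two.
have [q qL [bij LSt]] := start_unattached na0 two.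
have L2 : 1 < #|L|.
  have e0 : Es :\ X 0 = Es by apply/setDidPl; rewrite disjoint_sym disjoints1 XEs.
  by rewrite card_L e0; apply: leq_trans two _; exact: leqnSn.
apply: (kill_L LSt L2 qL) => x /bij[v]; rewrite in_setD1 => /andP[vq vL] /missesP[nv vall].
split; first by apply: vall; rewrite ?in_setU1 ?qL ?orbT // eq_sym.
by exists v; rewrite // in_setU1 vL orbT.
Qed.

End CliqueStart.

(** A single attachment would separate [C] from [o] and so be a cut-vertex. *)
Lemma two_attached o : (forall v, v \in A -> v \notin cut_vertices e) ->
  (forall r z, r \in C -> e r z -> z \in A) -> o \notin C -> o \notin Es ->
  (forall Y : {set T}, o \notin Y -> y \in Y -> exists u v, [/\ u \in Y, v \notin Y & e u v]) -> 1 < #|Es|.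
Proof.
move=> ncut innerC oC oE out; have sCE u v : u \in C -> v \notin C -> e u v -> v \in Es.
  move=> uC vC uv; have := cloC uC (innerC _ _ uC uv) uv; rewrite (negPf vC) /= => vs.
  rewrite inE vs /attached idxm //; apply/exists_inP; exists u => //.
  by rewrite nth_index // symE.
rewrite ltnNge; apply/negP => le1; have [u [v [uC vC uv]]] := out C oC yC.
have vE := sCE u v uC vC uv.
have one x : x \in Es -> x = v.
  move=> xE; apply/eqP/negPn/negP => xv; move: le1.
  by rewrite (cardsD1 x) xE (cardsD1 v) !inE eq_sym xv; move: vE; rewrite inE => ->.
have vA : v \in A by exact: innerC uv.
case/negP: (ncut v vA); apply/cut_verticesP => //; exists C; split=> //.
- by apply/set0Pn; exists y.
- apply/set0Pn; exists o; rewrite inE in_setU1 negb_or oC andbT.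
  by apply: contraNneq oE => ->.
by move=> a b aC bC /(sCE a b aC bC)/one.
Qed.
End LongestPath.

(** * Spanning paths of a side without cut-vertices *)

Section Existence.
Variables (T : finType) (e : rel T).
Hypothesis symE : symmetric e.
Implicit Types A N : {set T}.

Lemma longest_path A N x0 : x0 \in A -> x0 \in N -> exists s,
  [/\ sorted e s, uniq s, {subset s <= A}, 0 < size s & nth x0 s 0 \in N] /\
  forall S x y, ham_path e S x y -> S \subset A -> x \in N -> #|S| <= size s.
Proof.
move=> xA xN.
pose P n := [exists t : n.-tuple T,
  [&& sorted e t, uniq t, all (mem A) t & nth x0 t 0 \in N]].
have P11 : P 1 by apply/existsP; exists [tuple x0]; rewrite /= xA xN.
have P1 : exists n, P n by exists 1.
have Pm n : P n -> n <= #|T|.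
  by case/existsP=> t /and4P[_ ut _ _]; rewrite -(size_tuple t) -(card_uniqP ut) max_card.
case: (ex_maxnP P1 Pm) => n /existsP[t /and4P[st ut /allP At Nt]] maxn.
exists t; split; last first.
  move=> S x y /ham_path_card[q [sq uq zq eS]] sS xN'; rewrite size_tuple; apply: maxn.
  have sz : size (x :: q) == #|S| by rewrite /= zq.
  apply/existsP; exists (Tuple sz); apply/and4P; split=> //.
  by apply/allP => z zin; apply: (subsetP sS); rewrite -eS; exact: zin.
by split=> //; rewrite size_tuple; exact: maxn P11.
Qed.

Lemma component A (s : seq T) y : y \in A -> y \notin s -> exists C : {set T},
  [/\ y \in C, C \subset A, forall x, x \in C -> x \notin s,
      forall u v, u \in C -> v \in C -> exists2 B : {set T}, B \subset C & ham_path e B u v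
    & forall u z, u \in C -> z \in A -> e u z -> (z \in C) || (z \in s)].
Proof.
move=> yA ys; pose U := A :\: [set x in s].
have yU : y \in U by rewrite !inE ys.
pose C := [set z in U | connect (induced e U) y z].
have cs := sym_connect_sym (induced_sym symE U).
exists C; split.
- by rewrite inE yU connect0.
- by apply/subsetP => z; rewrite !inE => /andP[/andP[]].
- by move=> z; rewrite !inE => /andP[/andP[]].
- move=> u v uC vC.
  have : connect (induced e C) u v.
    have uv : connect (induced e U) u v.
      move: uC vC; rewrite !inE => /andP[_ yu] /andP[_ yv].
      by apply: connect_trans yv; rewrite cs.
    case/connectP: uv => p pp ->; elim: p u uC pp => [|w p IH] u uC /=; first by rewrite connect0.
    case/andP=> uw pw; have wC : w \in C.
      move: uC; rewrite !inE => /andP[_ yu]; case/and3P: (uw) => _ wU _.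
      by move: wU; rewrite !inE => ->; apply: connect_trans yu (connect1 uw).
    apply: connect_trans (IH w wC pw); apply: connect1.
    by case/and3P: uw => _ _ uw; rewrite /induced /= uC wC.
  by case/(ham_path_connect uC) => B sB pB; exists B.
move=> u z; rewrite [in u \in C]inE => /andP[uU yu] zA uz.
case: (boolP (z \in s)) => [|zs]; rewrite ?orbT //= orbF inE.
have zU : z \in U by rewrite !inE zs.
by rewrite zU; apply: connect_trans yu (connect1 _); rewrite /induced /= uU zU.
Qed.

End Existence.

Section SideEnd.
Variables (T : finType) (e : rel T) (D0 : {set T}) (c : T) (A : {set T}).
Hypotheses (critE : crit e D0) (sA : side e c A) (small : #|D0 :&: A| <= 3).
Implicit Types I X : {set T}.

Let symE : symmetric e. Proof. by have [[sym _] _ _ _ _] := critE. Qed.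
Let irrE : irreflexive e. Proof. destruct critE as [[_ irr] _ _ _ _]; exact irr. Qed.
Let cA : c \notin A. Proof. by have [_ H _ _] := sA. Qed.
Let clA a b : a \in A -> b \notin A -> e a b -> b = c.
Proof. by case: sA => _ _ _ H; exact: H. Qed.

Definition Nc := [set a in A | e c a].

Let NcA : Nc \subset A. Proof. by apply/subsetP => a; rewrite inE => /andP[]. Qed.
Let NcP a : a \in A -> (a \in Nc) = e c a. Proof. by move=> aA; rewrite inE aA. Qed.
Let cliqueN : {in Nc &, forall u v, u != v -> e u v}.
Proof.
move=> u v; rewrite !inE => /andP[uA cu] /andP[vA cv] uv.
exact: (side_clique critE sA).
Qed.
Let nc a : a \in A -> a != c. Proof. by apply: contraTneq => ->. Qed.

(** If [I] avoids the neighbours of [c], the missing vertices can be found among these neighbours,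
    that is, in the clique where paths may start. *)
Definition Wc I : {set T} := if [forall x in I, x \notin Nc] then Nc else A.

Lemma not_good X : X \subset A -> #|X| < #|D0 :&: A| -> connected_on e (c |: X) ->
  (forall a, a \in A -> a \notin X -> exists2 z, z \in c |: X & e a z) -> False.
Proof.
move=> sX ltX cX dX; have := side_replace critE sA sX cX dX; by rewrite leqNgt ltX.
Qed.

Lemma two_only X a b z : #|X| <= 2 -> a \in X -> b \in X -> a != b -> z \in X -> z = a \/ z = b.
Proof.
move=> X2 aX bX ab zX; case: (eqVneq z a) => [|za]; first by left.
case: (eqVneq z b) => [|zb]; first by right.
exfalso; move: X2; rewrite (cardsD1 a) aX (cardsD1 b) !inE eq_sym ab bX.
by rewrite (cardsD1 z) !inE za zb zX.
Qed.

Lemma vertex_out (f : rel T) X x y : connected_on f X -> x \in X -> y \in X -> x != y ->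
  exists2 z, z \in X & z != x /\ f x z.
Proof.
move=> /connected_onP cut xX yX xy.
have [||| u [z [/set1P->]]] := cut [set x].
- by rewrite sub1set.
- by apply/set0Pn; exists x; rewrite set11.
- by apply: contraNneq xy => eX; move: yX; rewrite -eX inE eq_sym.
by rewrite !inE => /andP[zx zX] xz; exists z.
Qed.

(** Joining [u] and [v] leaves at most two vertices in [A]. They are not both ends, as neither end
    is a neighbour of [c], and not without an end, as the edge would be idle. So they are one end
    [a] and a vertex [w] linking it to [c], and [w] does not see the other end [b], or the edge
    would again be idle. *)
Lemma outer_pair I u v : I \subset A -> indep e I -> u \in I -> v \in I ->
  u \notin Nc -> v \notin Nc -> u != v ->
  exists a b w, [/\ (a = u /\ b = v) \/ (a = v /\ b = u), w \in Nc, misses e I w b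
    & forall r, r \in A -> r \notin Nc -> r != b -> [|| r == a, e r a | e r w]].
Proof.
move=> sI iI uI vI uN vN uv; have inA := subsetP sI.
have uA := inA _ uI; have vA := inA _ vI; have nE := iI _ _ uI vI.
have ucA : u \in c |: A by rewrite in_setU1 uA orbT.
have vcA : v \in c |: A by rewrite in_setU1 vA orbT.
have [X [sX ltX cX dX]] := side_local critE sA ucA vcA uv nE.
have X2 : #|X| <= 2 by rewrite -ltnS; exact: leq_trans ltX small.
have half a b : a \in I -> b \in I -> a != b -> a \notin Nc -> a \in X -> b \notin X ->
    (forall x z, add_edge e u v x z -> e x z \/ (x = a /\ z = b) \/ (x = b /\ z = a)) ->
    exists2 w, w \in Nc & misses e I w b /\
      forall r, r \in A -> r \notin Nc -> r != b -> [|| r == a, e r a | e r w].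
  move=> aI bI ab aN aX bX spec; have aA := inA _ aI; have bA := inA _ bI.
  have bcX : b \notin c |: X by rewrite in_setU1 negb_or nc.
  have cE : connected_on e (c |: X).
    apply: connected_on_mono cX => x z xX zX /spec[//|[[_ ez]|[ex _]]].
      by rewrite -ez zX in bcX.
    by rewrite -ex xX in bcX.
  have acX : a \in c |: X by rewrite in_setU1 aX orbT.
  have ca : c != a by rewrite eq_sym nc.
  have [w wX [wc cw]] := vertex_out cE (setU11 _ _) acX ca.
  have {}wX : w \in X by move: wX; rewrite in_setU1 (negPf wc).
  have wA := subsetP sX _ wX; have wN : w \in Nc by rewrite NcP.
  have wa : w != a by apply: contraNneq aN => <-.
  have aw' : a != w by rewrite eq_sym.
  have ca' : a != c by rewrite eq_sym.
  have [w' w'X [w'a aw]] := vertex_out cE acX (setU11 _ _) ca'.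
  have ew' : w' = w.
    move: w'X; rewrite in_setU1 => /predU1P[ew|w'X].
      by case/negP: aN; rewrite NcP // symE -ew.
    by case: (two_only X2 aX wX aw' w'X) => // ew; rewrite ew eqxx in w'a.
  rewrite {w'X w'a}ew' in aw.
  have only z : z \in c |: X -> [\/ z = c, z = a | z = w].
    rewrite in_setU1 => /predU1P[->|zX]; first by constructor 1.
    by case: (two_only X2 aX wX aw' zX) => ->; [constructor 2 | constructor 3].
  have domE x : x \in A -> x \notin X -> x != b -> exists2 z, z \in c |: X & e x z.
    move=> xA xX xb; have [z zX /spec[xz|[[ex _]|[ex _]]]] := dX x xA xX; first by exists z.
      by rewrite ex aX in xX.
    by rewrite ex eqxx in xb.
  have nwb : ~~ e w b.
    apply/negP => wb; apply: (not_good sX ltX cE) => x xA xX.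
    have [->|xb] := eqVneq x b; last exact: domE.
    by exists w; [rewrite in_setU1 wX orbT | rewrite symE].
  exists w => //; split.
    apply/missesP; split=> // t tI tb; have [->|ta] := eqVneq t a; first by rewrite symE.
    have tA := inA _ tI; have [tX|tX] := boolP (t \in X).
      case: (two_only X2 aX wX aw' tX) => et; first by rewrite et eqxx in ta.
      by have := iI _ _ aI tI; rewrite et aw.
    have [z /only[]-> tz] := domE t tA tX tb.
    - apply: cliqueN => //; first by rewrite NcP // symE.
      by apply: contraNneq tX => <-.
    - by have := iI _ _ tI aI; rewrite tz.
    by rewrite symE.
  move=> r rA rN rb; have [rX|rX] := boolP (r \in X).
    case: (two_only X2 aX wX aw' rX) => ->; first by rewrite eqxx.
    by rewrite symE aw orbT.
  have [z /only[]-> rz] := domE r rA rX rb; rewrite ?rz ?orbT //.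
  by case/negP: rN; rewrite NcP // symE.
have spec x z : add_edge e u v x z -> e x z \/ (x = u /\ z = v) \/ (x = v /\ z = u).
  by move=> xz; case: (boolP (e x z)) => [|/(add_edge_neq xz)]; [left | right].
have [uX|uX] := boolP (u \in X); have [vX|vX] := boolP (v \in X).
- have ucX : u \in c |: X by rewrite in_setU1 uX orbT.
  have cu : c != u by rewrite eq_sym nc.
  have [z zX [zc cz]] := vertex_out cX (setU11 _ _) ucX cu.
  have {}zX : z \in X by move: zX; rewrite in_setU1 (negPf zc).
  have := two_only X2 uX vX uv zX; case: (spec _ _ cz) => [cz'|[[ec _]|[ec _]]].
  + by case=> ez; [case/negP: uN | case/negP: vN]; rewrite NcP // -ez.
  + by have := nc uA; rewrite -ec eqxx.
  by have := nc vA; rewrite -ec eqxx.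
- have [w wN [wm wd]] := half u v uI vI uv uN uX vX spec.
  by exists u, v, w; split=> //; left.
- have vu : v != u by rewrite eq_sym.
  have spec' x z : add_edge e u v x z -> e x z \/ (x = v /\ z = u) \/ (x = u /\ z = v).
    by case/spec=> [|[|]]; auto.
  have [w wN [wm wd]] := half v u vI uI vu vN vX uX spec'.
  by exists v, u, w; split=> //; right.
have ncX a : a \in A -> a \notin X -> a \notin c |: X by move=> aA aX; rewrite in_setU1 negb_or nc.
exfalso; apply: (not_good sX ltX).
  by apply: connected_on_addN cX; rewrite ncX.
move=> a aA aX; have [z zX /spec[az|[[_ ez]|[_ ez]]]] := dX a aA aX; first by exists z.
  by have := ncX v vA vX; rewrite -ez zX.
by have := ncX u uA uX; rewrite -ez zX.
Qed.

(** As [c] dominates [n] anyway, the new edge helps only if [n] is one of the two vertices left; the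
    third member of [I] forces the other one to be the vertex that misses [v]. *)
Lemma clique_pair I n v : I \subset A -> indep e I -> 3 <= #|I| ->
  n \in I -> n \in Nc -> v \in I -> v != n -> missed e Wc I v.
Proof.
move=> sI iI I3 nI nN vI vn; have inA := subsetP sI.
have nA := inA _ nI; have vA := inA _ vI; have nE := iI _ _ nI vI.
have cn : e c n by rewrite -NcP.
have noN t : t \in I -> t \in Nc -> t = n.
  move=> tI tN; apply/eqP/negPn/negP => tn; have := iI _ _ tI nI.
  by rewrite cliqueN.
have notI t : t \in I -> t != n -> ~~ e t c.
  by move=> tI tn; apply: contraNN tn => tc; rewrite (noN t tI) // NcP ?inA // symE.
have ncA : n \in c |: A by rewrite in_setU1 nA orbT.
have vcA : v \in c |: A by rewrite in_setU1 vA orbT.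
have nv : n != v by rewrite eq_sym.
have [X [sX ltX cX dX]] := side_local critE sA ncA vcA nv nE.
have X2 : #|X| <= 2 by rewrite -ltnS; exact: leq_trans ltX small.
have spec x z : add_edge e n v x z -> e x z \/ (x = n /\ z = v) \/ (x = v /\ z = n).
  by move=> xz; case: (boolP (e x z)) => [|/(add_edge_neq xz)]; [left | right].
have [t tI [tn tv]] : exists2 t, t \in I & t != n /\ t != v.
  move: I3; rewrite (cardsD1 n) nI (cardsD1 v) !inE vn vI !add1n !ltnS card_gt0 => /set0Pn[t].
  by rewrite !inE => /and3P[tv tn tI]; exists t.
have tA := inA _ tI.
have far t' : t' \in I -> t' != n -> t' != v -> t' \notin X -> exists2 z, z \in X & e t' z.
  move=> t'I t'n t'v t'X; have [z zX /spec[tz|[[et _]|[et _]]]] := dX _ (inA _ t'I) t'X.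
  - move: zX; rewrite in_setU1 => /predU1P[ez|]; last by exists z.
    by have := notI t' t'I t'n; rewrite -ez tz.
  - by rewrite et eqxx in t'n.
  by rewrite et eqxx in t'v.
have [nX|nX] := boolP (n \in X); last first.
  exfalso; have ncX : n \notin c |: X by rewrite in_setU1 negb_or nc.
  apply: (not_good sX ltX); first by apply: connected_on_addN cX; rewrite ncX.
  move=> a aA aX; have [z zX /spec[az|[[ea _]|[_ ez]]]] := dX a aA aX; first by exists z.
    by exists c; rewrite ?setU11 // ea symE.
  by rewrite -ez zX in ncX.
have [vX|vX] := boolP (v \in X).
  have tX : t \notin X by apply/negP => /(two_only X2 nX vX nv)[] et; rewrite et eqxx in tn tv.
  have [z zX tz] := far t tI tn tv tX.
  case: (two_only X2 nX vX nv zX) => ez; rewrite ez in tz.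
    by have := iI _ _ tI nI; rewrite tz.
  by have := iI _ _ tI vI; rewrite tz.
have vcX : v \notin c |: X by rewrite in_setU1 negb_or nc.
have cE : connected_on e (c |: X) by apply: connected_on_addN cX; rewrite vcX orbT.
have [w wX [wn wt]] : exists2 w, w \in X & w != n /\ ((w == t) || e t w).
  have [tX|tX] := boolP (t \in X); first by exists t; rewrite ?eqxx.
  have [z zX tz] := far t tI tn tv tX; exists z => //; rewrite tz orbT; split=> //.
  by apply: contraTneq tz => ->; exact: iI.
have wA := subsetP sX _ wX.
have nw : n != w by rewrite eq_sym.
have only z : z \in X -> z = n \/ z = w := two_only X2 nX wX nw.
have ewn : e w n.
  have [wN|wN] := boolP (w \in Nc); first exact: cliqueN.
  have wcX : w \in c |: X by rewrite in_setU1 wX orbT.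
  have [z zX [zw wz]] := vertex_out cE wcX (setU11 _ _) (nc wA).
  move: zX; rewrite in_setU1 => /predU1P[ez|/only[<-//|ez]]; last by rewrite ez eqxx in zw.
  by case/negP: wN; rewrite NcP // symE -ez.
have wI : w \notin I by apply/negP => wI; have := iI _ _ wI nI; rewrite ewn.
have nvw : ~~ e w v.
  apply/negP => wv; apply: (not_good sX ltX cE) => a aA aX.
  have [z zX /spec[az|[[ea _]|[ea _]]]] := dX a aA aX; first by exists z.
    by rewrite ea nX in aX.
  by exists w; [rewrite in_setU1 wX orbT | rewrite ea symE].
apply/exists_inP; exists w.
  rewrite /Wc; case: ifP => // /forall_inP/(_ n nI); by rewrite nN.
apply/missesP; split=> // t' t'I t'v; have [->//|t'n] := eqVneq t' n.
have t'X : t' \notin X.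
  by apply/negP => /only[] et; [rewrite et eqxx in t'n | rewrite -et t'I in wI].
have [z /only[]-> tz] := far t' t'I t'n t'v t'X; last by rewrite symE.
by have := iI _ _ t'I nI; rewrite tz.
Qed.

Lemma Wc_sub I : Wc I \subset A.
Proof. by rewrite /Wc; case: ifP. Qed.

Lemma side_star I u v : I \subset A -> indep e I -> 3 <= #|I| ->
  u \in I -> v \in I -> u != v -> missed e Wc I u || missed e Wc I v.
Proof.
move=> sI iI I3 uI vI uv; have [uN|uN] := boolP (u \in Nc).
  by rewrite (clique_pair sI iI I3 uI uN vI) ?orbT // eq_sym.
have [vN|vN] := boolP (v \in Nc); first by rewrite (clique_pair sI iI I3 vI vN uI).
have [a [b [w [ab wN wm _]]]] := outer_pair sI iI uI vI uN vN uv.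
have wW : w \in Wc I by rewrite /Wc; case: ifP => // _; exact: subsetP NcA _ wN.
have : missed e Wc I b by apply/exists_inP; exists w.
by case: ab => [][_ ->] ->; rewrite ?orbT.
Qed.

Lemma side_pair_c r : r \in A -> r \notin Nc -> exists Z : {set T},
  [/\ #|Z| <= 2,
      forall p, p \in Z -> p \notin Nc -> p != r -> exists2 p', p' \in Z & p' != p /\ e p p',
      forall a, a \in A -> a \notin Nc -> a != r -> a \in Z \/ exists2 z, z \in Z & e a z,
      r \notin Z -> forall z, z \in Z -> ~~ e r z
    & r \notin Z -> Z != set0 -> exists2 z, z \in Z & z \in Nc].
Proof.
move=> rA rN; have nE : ~~ e c r by rewrite -NcP.
have rcA : r \in c |: A by rewrite in_setU1 rA orbT.
have cr : c != r by rewrite eq_sym nc.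
have [X [sX ltX cX dX]] := side_local critE sA (setU11 _ _) rcA cr nE.
have X2 : #|X| <= 2 by rewrite -ltnS; exact: leq_trans ltX small.
have spec x z : add_edge e c r x z -> e x z \/ (x = c /\ z = r) \/ (x = r /\ z = c).
  by move=> xz; case: (boolP (e x z)) => [|/(add_edge_neq xz)]; [left | right].
have cE : r \notin X -> connected_on e (c |: X).
  by move=> rX; apply: connected_on_addN cX; rewrite [r \in _]in_setU1 negb_or nc // rX orbT.
exists X; split=> //.
- move=> p pX pN pr; have pA := subsetP sX _ pX.
  have pcX : p \in c |: X by rewrite in_setU1 pX orbT.
  have [z zX [zp /spec[pz|[[ep _]|[ep _]]]]] := vertex_out cX pcX (setU11 _ _) (nc pA).
  + move: zX; rewrite in_setU1 => /predU1P[ez|]; last by exists z.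
    by case/negP: pN; rewrite NcP // symE -ez.
  + by have := nc pA; rewrite ep eqxx.
  by rewrite ep eqxx in pr.
- move=> a aA aN ar; have [|aX] := boolP (a \in X); [by left | right].
  have [z zX /spec[az|[[ea _]|[ea _]]]] := dX a aA aX.
  + move: zX; rewrite in_setU1 => /predU1P[ez|]; last by exists z.
    by case/negP: aN; rewrite NcP // symE -ez.
  + by have := nc aA; rewrite ea eqxx.
  by rewrite ea eqxx in ar.
- move=> rX z0 z0X; apply/negP => rz; apply: (not_good sX ltX (cE rX)) => a aA aX.
  have [z zX /spec[az|[[ea _]|[ea _]]]] := dX a aA aX; first by exists z.
    by have := nc aA; rewrite ea eqxx.
  by exists z0; [rewrite in_setU1 z0X orbT | rewrite ea].
move=> rX /set0Pn[x xX]; have xA := subsetP sX _ xX.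
have xcX : x \in c |: X by rewrite in_setU1 xX orbT.
have cx : c != x by rewrite eq_sym nc.
have [z zX [zc cz]] := vertex_out (cE rX) (setU11 _ _) xcX cx.
have {}zX : z \in X by move: zX; rewrite in_setU1 (negPf zc).
by exists z => //; rewrite NcP // (subsetP sX).
Qed.

Lemma side_inner r z : r \in A -> r \notin Nc -> e r z -> z \in A.
Proof.
move=> rA rN rz; apply/negPn/negP => zA; case/negP: rN.
by rewrite NcP // symE -(clA rA zA rz).
Qed.

Hypothesis ncut : forall v, v \in A -> v \notin cut_vertices e.
Hypothesis nosim : 1 < #|D0 :&: A| -> forall r, r \in A -> ~ simplicial e r.

(** In a light side, joining [c] to [r'] leaves no vertex in [A], so [c] sees all of [A] but [r']; a
    second non-neighbour [r] cannot exist. *)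
Lemma side_no_simplicial r r' : r \in A -> r \notin Nc -> r' \in A -> r' \notin Nc ->
  r != r' -> ~ simplicial e r.
Proof.
move=> rA rN r'A r'N rr'; case: (ltnP 1 #|D0 :&: A|) => [lt|le]; first exact: nosim.
have nE : ~~ e c r' by rewrite -NcP.
have rcA : r' \in c |: A by rewrite in_setU1 r'A orbT.
have cr : c != r' by rewrite eq_sym nc.
have [X [_ ltX _ dX]] := side_local critE sA (setU11 _ _) rcA cr nE.
have X0 : X = set0 by apply/eqP; rewrite -cards_eq0; move: (leq_trans ltX le); rewrite ltnS leqn0.
have [|z] := dX r rA; first by rewrite X0 inE.
rewrite X0 setU0 inE => /eqP-> /orP[rc|/orP[]/andP[/eqP er /eqP ec]].
- by case/negP: rN; rewrite NcP // symE.
- by have := nc rA; rewrite er eqxx.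
by rewrite er eqxx in rr'.
Qed.

Lemma end_path : exists x y, [/\ x \in A, e c x & ham_path e A x y].
Proof.
have [x0 x0A cx0] := side_nbr critE sA.
have x0N : x0 \in Nc by rewrite NcP.
have [s [[ss us sSA s0 sN] lng]] := longest_path e x0A x0N.
have [all|] := boolP [forall y in A, y \in s].
  exists (nth x0 s 0), (last x0 s).
  have x1A : nth x0 s 0 \in A by exact: subsetP NcA _ sN.
  split; rewrite -?NcP //; case: s ss us sSA s0 all {sN lng x1A} => //= x s ps us sSA _ /forall_inP all.
  by exists s; split=> // z; apply/idP/idP => [/sSA|/all].
case/forall_inPn => y yA ys.
have [C [yC sCA Cs connC cloC]] := component symE yA ys.
have Cn z : z \in C -> z \notin Nc.
  move=> zC; apply: contra (Cs z zC) => zN.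
  exact: (St_s ss us (erefl _) sSA s0 sN lng NcA cliqueN).
exfalso.
have cC : c \notin C by apply: contra cA; exact: subsetP.
apply: (clique_start symE irrE Wc_sub side_star ss us (erefl _) sSA s0 sN lng yC sCA Cs connC cloC
  NcA cliqueN _ clique_pair _ side_pair_c side_no_simplicial side_inner).
- by move=> I noN; rewrite /Wc; case: ifP => // /forall_inP[]; exact: noN.
- by move=> I u v sI iI _ noN uI vI uv; apply: outer_pair; rewrite ?noN.
apply: (two_attached symE (erefl _) yC cloC (o := c) ncut) => //.
- move=> r z rC rz; exact: side_inner (subsetP sCA _ rC) (Cn _ rC) rz.
- by apply: contra cA; rewrite inE => /andP[/sSA].
by move=> Y cY yY; exact: (crit_edge_out critE yY cY).
Qed.

End SideEnd.

(** * Small connected domination number *)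

Section SmallGamma.
Variables (T : finType) (e : rel T) (D0 : {set T}).
Hypotheses (critE : crit e D0) (small : #|D0| <= 3).
Hypothesis ncut : forall v, v \notin cut_vertices e.

Let symE : symmetric e. Proof. by have [[sym _] _ _ _ _] := critE. Qed.
Let irrE : irreflexive e. Proof. by have [[_ irr] _ _ _ _] := critE. Qed.

(** At most two vertices dominate the graph with the edge [uv], and a third member of [I] forces
    them to be exactly one of [u], [v] and a vertex that misses the other. *)
Lemma small_star (I : {set T}) u v : I \subset setT -> indep e I -> 3 <= #|I| ->
  u \in I -> v \in I -> u != v -> missed e (fun=> setT) I u || missed e (fun=> setT) I v.
Proof.
move=> _ iI I3 uI vI uv; have nE := iI _ _ uI vI.
have [_ _ _ minD /(_ u v uv nE)[D cD ltD]] := critE.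
have not_cds : ~ conn_dominating e D by move=> /minD; rewrite leqNgt ltD.
have D2 : #|D| <= 2 by rewrite -ltnS; exact: leq_trans ltD small.
case/andP: cD => /dominatingP dD cD.
have spec x z : add_edge e u v x z -> e x z \/ (x = u /\ z = v) \/ (x = v /\ z = u).
  by move=> xz; case: (boolP (e x z)) => [|/(add_edge_neq xz)]; [left | right].
have [t tI [tu tv]] : exists2 t, t \in I & t != u /\ t != v.
  move: I3; rewrite (cardsD1 u) uI (cardsD1 v) !inE eq_sym uv vI !add1n !ltnS card_gt0.
  by case/set0Pn=> t; rewrite !inE => /and3P[tv tu tI]; exists t.
have far t' : t' \in I -> t' != u -> t' != v -> t' \notin D -> exists2 z, z \in D & e t' z.
  move=> t'I t'u t'v t'D; have [z zD /spec[tz|[[et _]|[et _]]]] := dD _ t'D; first by exists z.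
    by rewrite et eqxx in t'u.
  by rewrite et eqxx in t'v.
have half a b : a \in I -> b \in I -> a != b -> a \in D -> b \notin D ->
    (forall x, x != u -> x != v -> x != a /\ x != b) ->
    (forall x, x != a -> x != b -> x != u /\ x != v) ->
    (forall x z, add_edge e u v x z -> e x z \/ (x = a /\ z = b) \/ (x = b /\ z = a)) ->
    missed e (fun=> setT) I b.
  move=> aI bI ab aD bD uvab abuv spec'.
  have cE : connected_on e D.
    apply: connected_on_mono cD => x z xD zD /spec'[//|[[_ ez]|[ex _]]].
      by rewrite -ez zD in bD.
    by rewrite -ex xD in bD.
  have [ta tb] := uvab t tu tv.
  have [w wD wa] : exists2 w, w \in D & w != a.
    have [tD|tD] := boolP (t \in D); first by exists t.
    have [z zD tz] := far t tI tu tv tD; exists z => //.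
    by apply: contraTneq tz => ->; exact: iI.
  have aw' : a != w by rewrite eq_sym.
  have only z : z \in D -> z = a \/ z = w := two_only D2 aD wD aw'.
  have [w' w'D [w'a aw]] := vertex_out cE aD wD aw'.
  have ew' : w' = w by case: (only w' w'D) => // ew; rewrite ew eqxx in w'a.
  rewrite {w'D w'a}ew' in aw.
  have nwb : ~~ e w b.
    apply/negP => wb; apply: not_cds; rewrite /conn_dominating cE andbT; apply/dominatingP => x xD.
    have [z zD /spec'[xz|[[ex _]|[ex _]]]] := dD x xD; first by exists z.
      by rewrite ex aD in xD.
    by exists w; rewrite // ex symE.
  apply/exists_inP; exists w; rewrite ?inE //; apply/missesP; split=> // t' t'I t'b.
  have [->|t'a] := eqVneq t' a; first by rewrite symE.
  have t'D : t' \notin D.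
    apply/negP => /only[] et; first by rewrite et eqxx in t'a.
    by have := iI _ _ aI t'I; rewrite et aw.
  have [t'u t'v] := abuv t' t'a t'b.
  have [z /only[]-> tz] := far t' t'I t'u t'v t'D; last by rewrite symE.
  by have := iI _ _ t'I aI; rewrite tz.
have [uD|uD] := boolP (u \in D); have [vD|vD] := boolP (v \in D).
- have tD : t \notin D by apply/negP => /(two_only D2 uD vD uv)[] et; rewrite et eqxx in tu tv.
  have [z zD tz] := far t tI tu tv tD.
  case: (two_only D2 uD vD uv zD) => ez; rewrite ez in tz.
    by have := iI _ _ tI uI; rewrite tz.
  by have := iI _ _ tI vI; rewrite tz.
- by apply/orP; right; apply: (half u v).
- apply/orP; left; apply: (half v u) => //; first by rewrite eq_sym.
  + by move=> x z /spec[|[|]]; auto.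
case: not_cds; apply/andP; split; last by apply: connected_on_addN cD; rewrite uD.
apply/dominatingP => x xD; have [z zD /spec[xz|[[_ ez]|[_ ez]]]] := dD x xD; first by exists z.
  by rewrite -ez zD in vD.
by rewrite -ez zD in uD.
Qed.

Lemma small_traceable : traceable e.
Proof.
have [T0|/card_gt0P[x0 _]] := posnP #|T|.
  by exists [::]; split=> // x; have := fintype0 x T0.
have [s [[ss us sT s0 sN] lng]] := @longest_path T e setT setT x0 (in_setT _) (in_setT _).
have [/forallP all|] := boolP [forall y, y \in s]; first by exists s.
rewrite negb_forall => /existsP[y ys]; exfalso.
have [C [yC sCA Cs connC cloC]] := component symE (in_setT y) ys.
have ll := last_isl ss us (erefl _) s0 sN yC sCA.
(* Any vertex may start a path here, so a neighbour in [C] of the first vertex could be put in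
   front. *)
have na0 : ~~ attached e x0 s (size s) C 0.
  apply/negP => /andP[_ /exists_inP[c cC c0]].
  have S1 : ham_path e (seg s 0 (size s).-1) (nth x0 s 0) (nth x0 s (size s).-1).
    by apply: (seg_forward x0 ss us (erefl _)); nlia.
  have c0' : e c (nth x0 s 0) by rewrite symE.
  have pS : ham_path e ([set c] :|: seg s 0 (size s).-1) c (nth x0 s (size s).-1).
    apply: ham_path_cat (ham_path1 e c) S1 c0' _ => z; rewrite !inE => /eqP-> /andP[zs _].
    by have := Cs c cC; rewrite zs.
  apply: (longer us (erefl _) sT lng sCA Cs pS (c := c)) => //.
  - by move=> v; rewrite !inE => /orP[/eqP->|/andP[->]//]; rewrite cC orbT.
  - move=> v vs; have vm : index v s < size s by rewrite index_mem.
    by rewrite !inE vs /=; apply/orP; right; nlia.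
  by rewrite !inE eqxx.
have lt1 : (size s).-1 < size s by nlia.
have two : 1 < #|Es e x0 s (size s) C|.
  apply: (two_attached symE (erefl _) yC cloC (o := nth x0 s (size s).-1)) => //.
  - by apply: contraL (mem_nth x0 lt1) => /Cs.
  - rewrite (XEs _ _ us (erefl _)) //.
    exact: (isl_att symE ss us (erefl _) sT s0 sN lng sCA Cs connC ll).
  by move=> Y oY yY; exact: (crit_edge_out critE yY oY).
have [q _ [_ LSt]] := start_unattached symE irrE (fun _ => subsetT _) small_star ss us (erefl _)
  sT s0 sN lng yC sCA Cs connC cloC na0 two.
by have := LSt _ (LX us (erefl _) ll); rewrite in_setT.
Qed.

End SmallGamma.

(** * Decomposition at the cut-vertices *)

Lemma ham_path_clique (T : finType) (e : rel T) (M : {set T}) a b :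
  {in M &, forall u v, u != v -> e u v} -> a \in M -> b \in M -> a != b -> ham_path e M a b.
Proof.
move=> clM aM bM ab; set R := M :\ a :\ b.
exists (rcons (enum R) b); split.
- have inM : all (mem M) (a :: rcons (enum R) b).
    apply/allP => x; rewrite inE mem_rcons inE mem_enum !inE.
    by case/or3P=> [/eqP->|/eqP->|/and3P[]].
  have un : uniq (a :: rcons (enum R) b).
    by rewrite /= mem_rcons rcons_uniq inE !mem_enum enum_uniq !inE !eqxx andbF (negPf ab).
  suff gen s y : all (mem M) (y :: s) -> uniq (y :: s) -> path e y s by exact: gen inM un.
  elim: s y => //= x s IH y /and3P[yM xM sM].
  rewrite inE negb_or => /and3P[/andP[yx ys] xs us].
  by rewrite clM //= IH ?xM //= xs.
- by rewrite last_rcons.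
- by rewrite /= mem_rcons rcons_uniq inE !mem_enum enum_uniq !inE !eqxx andbF (negPf ab).
move=> x; rewrite inE mem_rcons inE mem_enum !inE.
by case: eqVneq => [->|_]; [rewrite aM | case: eqVneq => [->|_]].
Qed.

Lemma card_sum_mem (T : finType) (S : {set T}) : #|S| = \sum_x (x \in S : nat).
Proof. by rewrite -sum1_card big_mkcond; apply: eq_bigr => x _; case: (x \in S). Qed.

Lemma card_disjoint3 (T : finType) (P X Y Z : {set T}) :
  (forall x, (x \in X) + (x \in Y) + (x \in Z) <= 1) ->
  #|P :&: X| + #|P :&: Y| + #|P :&: Z| <= #|P|.
Proof.
move=> dis; rewrite !card_sum_mem -!big_split; apply: leq_sum => x _.
by have := dis x; rewrite !inE; do 4!case: (x \in _).
Qed.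

Section Decomposition.
Variables (T : finType) (e : rel T) (D0 : {set T}).
Hypothesis critE : crit e D0.

Let symE : symmetric e. Proof. by have [[sym _] _ _ _ _] := critE. Qed.

(** Take a side of [c'] that avoids [c]. An edge leaving its part outside [A] would either enter
    [A], and start at [c], or leave the side, and end at [c'], which is in [A]. *)
Lemma side_inside c A c' : side e c A -> c' \in A -> c' \in cut_vertices e ->
  exists A', [/\ side e c' A', A' \subset A & c \notin A'].
Proof.
move=> sA c'A /cut_verticesP[A1 sA1]; have [_ cA _ clA] := sA.
have [A2 sA2 cA2] : exists2 A2, side e c' A2 & c \notin A2.
  have [cA1|] := boolP (c \in A1); last by exists A1.
  by exists (~: (c' |: A1)); [exact: side_compl | rewrite !inE cA1 orbT].
exists A2; split=> //; apply/subsetP => x xA2; apply/negPn/negP => xA.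
have [_ c'A2 _ clA2] := sA2.
have xX : x \in A2 :\: A by rewrite inE xA.
have cX : c \notin A2 :\: A by rewrite inE (negPf cA2) andbF.
have [u [v [uX vX uv]]] := crit_edge_out critE xX cX.
case/setDP: uX => uA2 uA; rewrite inE negb_and negbK in vX.
have [vA|vA] := boolP (v \in A).
  by have eu := clA v u vA uA; rewrite symE uv in eu; rewrite -eu ?uA2 in cA2.
have vA2 : v \notin A2 by case/orP: vX => // vA'; rewrite vA' in vA.
by have ev := clA2 _ _ uA2 vA2 uv; rewrite ev c'A in vA.
Qed.

(* [#|P :&: A|] counts the vertices of the minimum connected dominating set
   in [A] beyond the unavoidable cut-vertices. *)
Let P := D0 :\: cut_vertices e.

Lemma cut_free_exc (A : {set T}) : (forall v, v \in A -> v \notin cut_vertices e) -> D0 :&: A = P :&: A.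
Proof.
move=> nc; apply/setP => x; rewrite !inE; case xA: (x \in A); rewrite ?andbF // !andbT.
by have := nc x xA; rewrite inE => ->.
Qed.

(** Descend to an innermost side: it contains no cut-vertex, so [P] and [D0] agree on it. *)
Lemma light_tip c A : side e c A -> #|P :&: A| <= 1 -> exists2 x, x \in A & simplicial e x.
Proof.
have [n] := ubnP #|A|; elim: n c A => // n IH c A ltn sA le1.
have [/existsP[c' /andP[c'A c'C]]|] := boolP [exists c', (c' \in A) && (c' \in cut_vertices e)].
  have [A' [sA' sub cA']] := side_inside sA c'A c'C; have [_ c'A' _ _] := sA'.
  have lt : #|A'| < #|A|.
    by apply: proper_card; rewrite properE sub; apply/subsetPn; exists c'.
  have [||x xA' sx] := IH c' A' _ sA'.
  - exact: leq_trans lt _.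
  - exact: leq_trans (subset_leq_card (setIS _ sub)) le1.
  by exists x => //; exact: (subsetP sub).
rewrite negb_exists => /forallP nc; apply: (light_side_simplicial critE sA).
rewrite cut_free_exc // => v vA; by have := nc v; rewrite vA.
Qed.

Lemma light_sides c A c' A' : side e c A -> side e c' A' -> A' \subset ~: (c |: A) ->
  #|P :&: A| <= 1 -> #|P :&: A'| <= 1 -> False.
Proof.
move=> sA sA' /subsetP sub lA lA'.
have [x xA sx] := light_tip sA lA; have [y yA' sy] := light_tip sA' lA'.
have := sub y yA'; rewrite !inE negb_or => /andP[yc yA].
have xy : x != y by apply: contraNneq yA => <-.
have [_ _ _ clA] := sA.
by move: yc; rewrite (clA x y xA yA (simplicial_adjacent critE sx sy xy)) eqxx.
Qed.

Hypothesis few : #|P| <= 3.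

Definition sideb c (A : {set T}) := [&& A != set0, c \notin A, ~: (c |: A) != set0 &
  [forall a in A, forall b, (b \notin A) && e a b ==> (b == c)]].

Lemma sideP c A : reflect (side e c A) (sideb c A).
Proof.
apply: (iffP and4P) => [[nA cA nB /forall_inP clA]|[nA cA nB clA]]; split=> //.
  by move=> a b aA bA ab; apply/eqP/(implyP (forallP (clA a aA) b)); rewrite bA.
by apply/forall_inP => a aA; apply/forallP => b; apply/implyP => /andP[bA /clA->].
Qed.

(** * The piece between a cut-vertex and a largest side nested in its side *)

Section Middle.
Variables (c c' : T) (A A' : {set T}).
Hypotheses (sA : side e c A) (c'A : c' \in A) (sA' : side e c' A') (subA : A' \subset A).
Hypothesis maxA' : forall c'' A'', side e c'' A'' -> c'' \in A -> A'' \subset A -> #|A''| <= #|A'|.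

Let M := A :\: (c' |: A').
Let B0 := ~: (c |: A).
Let sB0 : side e c B0. Proof. exact: side_compl sA. Qed.

Lemma middle_far : B0 \subset ~: (c' |: A').
Proof. by rewrite setCS subUset sub1set inE c'A orbT (subset_trans subA (subsetUr _ _)). Qed.

Lemma middle_exc : #|P :&: M| + #|P :&: A'| + #|P :&: B0| <= 3.
Proof.
apply: leq_trans few; apply: card_disjoint3 => x; rewrite [x \in M]in_setD [x \in B0]in_setC !in_setU1.
have [->|_] := eqVneq x c'; first by rewrite c'A orbT /=; case: (_ \in _).
case xA': (x \in A') => /=; first by rewrite (subsetP subA x xA') orbT.
by case: (x \in A); case: (x == c).
Qed.

Lemma middle_edge m v : m \in M -> v \notin M -> e m v -> v = c \/ v = c'.
Proof.
case/setDP=> mA; rewrite !inE negb_or => /andP[mc' mA'] vM mv.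
have [_ _ _ clA] := sA; have [_ _ _ clA'] := sA'.
have [vA|vA] := boolP (v \in A); last by left; exact: clA vA mv.
right; move: vM; rewrite vA andbT negbK => /orP[/eqP //|vA'].
by move: mc'; rewrite (clA' v m vA' mA') ?eqxx // symE.
Qed.

(** By maximality of [A'], a side [A2] of a cut-vertex in [M] cannot contain [c' |: A']; this set is
    connected, so [A2] is disjoint from it. Then [A'], [A2] and [B0] share at most three vertices of
    [P], and two of them are light. *)
Lemma middle_ncut v : v \in M -> v \notin cut_vertices e.
Proof.
move=> vM; apply/negP => vC; have vA : v \in A by case/setDP: vM.
have [A2 [sA2 sub2 cA2]] := side_inside sA vA vC.
have le2 := maxA' sA2 vA sub2.
have [_ c'A' _ _] := sA'; have [_ vA2 _ clA2] := sA2.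
have vc'A' : v \notin c' |: A' by case/setDP: vM.
have sub3 : A2 \subset ~: (c' |: A').
  have [_ conT _ _ _] := critE.
  have := side_conn symE sA' (in_setT _) conT; rewrite setTI => /connected_onP con.
  rewrite -disjoints_subset -setI_eq0; apply/negPn/negP => nX.
  have [Y|nY] := eqVneq (A2 :&: (c' |: A')) (c' |: A').
    have : c' |: A' \subset A2 by rewrite -Y subsetIl.
    move/subset_leq_card; rewrite cardsU1 c'A' add1n => lt.
    by have := leq_trans lt le2; rewrite ltnn.
  have [x [y [xX yY xy]]] := con _ (subsetIr _ _) nX nY.
  case/setIP: xX => xA2 _; case/setDP: yY => yS; rewrite inE yS andbT => yA2.
  by rewrite -(clA2 _ _ xA2 yA2 xy) yS in vc'A'.
have far2 : B0 \subset ~: (v |: A2).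
  by rewrite setCS subUset sub1set inE vA orbT (subset_trans sub2 (subsetUr _ _)).
have h1 := light_sides sA' sA2 sub3.
have h2 := light_sides sA' sB0 middle_far.
have h3 := light_sides sA2 sB0 far2.
have : #|P :&: A2| + #|P :&: A'| + #|P :&: B0| <= 3.
  apply: leq_trans few; apply: card_disjoint3 => x; rewrite [x \in B0]inE in_setU1.
  case xA': (x \in A'); first rewrite (subsetP subA x xA') orbT /=.
    case xA2: (x \in A2) => //; have := subsetP sub3 x xA2.
    by rewrite !inE xA' orbT.
  case xA2: (x \in A2) => //; last by case: (_ || _).
  by rewrite (subsetP sub2 x xA2) orbT.
move=> sum; have [l|l] := leqP #|P :&: A'| 1.
  have [l2|l2] := leqP #|P :&: A2| 1; first exact: h1.
  by apply: h2 => //; clear - sum l2; lia.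
by apply: h3; clear - sum l; lia.
Qed.

(** Two vertices in [M] would leave at most one for [A'] and [B0] together, and both would be
    light. *)
Lemma middle_light : #|D0 :&: M| <= 1.
Proof.
rewrite (cut_free_exc middle_ncut) leqNgt; apply/negP => l; have sum := middle_exc.
by apply: (light_sides sA' sB0 middle_far); clear - sum l; lia.
Qed.

Lemma middle_card D : #|D :&: A| = (c' \in D) + #|D :&: A'| + #|D :&: M|.
Proof.
have [_ c'A' _ _] := sA'.
have -> : (c' \in D) = #|D :&: [set c']| :> nat.
  rewrite card_sum_mem (bigD1 c') //= big1 => [|x /negPf xc]; first by rewrite !inE eqxx andbT addn0.
  by rewrite !inE xc andbF.
rewrite !card_sum_mem -!big_split; apply: eq_bigr => x _; rewrite !inE.
case: eqVneq => [->|_]; rewrite /= ?c'A ?(negPf c'A') ?andbF ?andbT ?addn0 //.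
case xA': (x \in A'); first by rewrite (subsetP subA x xA') /= ?andbF ?andbT ?addn0.
by rewrite !andbF.
Qed.

(** By [side_keep] nothing is saved in [A'] or [B0], and [c], [c'] remain forced; so the saving
    removes the only vertex that [M] can hold. *)
Lemma middle_add u v : u \in M -> v \in c |: (c' |: M) -> u != v -> ~~ e u v ->
  exists D, [/\ D :&: M = set0, c \in D, c' \in D, conn_dominating (add_edge e u v) D &
    ~ conn_dominating e D].
Proof.
move=> uM vS uv nE; have [_ _ cD0 minD /(_ u v uv nE)[D cD ltD]] := critE.
have [uA uA'] := setDP uM.
have [_ cA _ _] := sA; have [_ c'A' _ _] := sA'.
have MA : M \subset A := subsetDl _ _.
have ucA : u \in c |: A by rewrite !inE uA orbT.
have vcA : v \in c |: A.
  by move: vS; rewrite !inE => /or3P[->//|/eqP->|/andP[_ ->]]; rewrite ?c'A orbT.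
have cc' : c != c' by apply: contraNneq cA => ->.
have cA' : c \notin A' by apply: contra cA; exact: (subsetP subA).
have vA' : v \notin A'.
  move: vS; rewrite !inE => /or3P[/eqP->//|/eqP->//|/andP[]].
  by rewrite negb_or => /andP[].
have uA'' : u \notin A' by move: uA'; rewrite inE negb_or => /andP[].
have keepA' := side_keep critE sA' uA'' vA' uv cD.
have uB0 : u \notin B0 by rewrite in_setC negbK.
have vB0 : v \notin B0 by rewrite in_setC negbK.
have keepB0 := side_keep critE sB0 uB0 vB0 uv cD.
have symE' := add_edge_sym symE u v.
have cinD : c \in D := side_mem symE' (side_add sA ucA vcA) cD.
have c'inD : c' \in D := side_mem symE' (side_add_out sA' uA'' vA') cD.
have c0 : c \in D0 := side_mem symE sA cD0.
have c'0 : c' \in D0 := side_mem symE sA' cD0.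
exists D; split=> //; last by move/minD; rewrite leqNgt ltD.
move: ltD; rewrite (side_card cA cinD) (side_card cA c0) -/B0 !middle_card c'inD c'0 => ltD.
have ml := middle_light; apply/eqP; rewrite -cards_eq0; clear - ltD ml keepA' keepB0; lia.
Qed.

Lemma middle_clique : {in M &, forall u v, u != v -> e u v}.
Proof.
move=> u v uM vM uv; apply/negPn/negP => nE.
have [|D [DM _ _ /andP[/dominatingP dD cD]]] := middle_add uM _ uv nE.
  by rewrite !inE; move: vM; rewrite !inE => ->; rewrite !orbT.
have offD w : w \in M -> w \notin D.
  by move=> wM; apply/negP => wD; have := in_setI w D M; rewrite DM in_set0 wD wM.
case; apply/andP; split; last by apply: connected_on_addN cD; rewrite offD.
apply/dominatingP => x xD; have [z zD xz] := dD x xD; exists z => //.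
move: xz => /orP[//|/orP[]/andP[_ /eqP ez]]; rewrite ez in zD.
  by have := offD v vM; rewrite zD.
by have := offD u uM; rewrite zD.
Qed.

(** The smaller set for the graph with the edge [m p] contains [q], which dominates [m] already. *)
Lemma middle_twin m p q : m \in M -> (p == c) && (q == c') || (p == c') && (q == c) ->
  e m q -> e m p.
Proof.
move=> mM pq mq; apply/negPn/negP => nE.
have [_ cA _ _] := sA.
have MA : M \subset A := subsetDl _ _.
have mp : m != p.
  by case/orP: pq => /andP[/eqP-> _]; apply: contraTneq mM => ->; rewrite !inE ?(negPf cA) ?eqxx ?andbF.
have [|D [DM cD c'D /andP[/dominatingP dD cnD]]] := middle_add mM _ mp nE.
  by case/orP: pq => /andP[/eqP-> _]; rewrite !inE eqxx ?orbT.
have mD : m \notin D.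
  by apply/negP => wD; have := in_setI m D M; rewrite DM in_set0 wD mM.
have qD : q \in D by case/orP: pq => /andP[_ /eqP->].
case; apply/andP; split; last by apply: connected_on_addN cnD; rewrite mD.
apply/dominatingP => x xD; have [z zD xz] := dD x xD.
move: xz => /orP[xz|/orP[]/andP[/eqP ex /eqP ez]]; first by exists z.
  by exists q; rewrite // ex.
by rewrite -ez zD in mD.
Qed.

(** The route enters [M] at a vertex seeing [c] and leaves it at another seeing [c']. If only one
    vertex of a larger [M] saw them, it would be a cut-vertex. *)
Lemma middle_path x' y' : e c' x' -> x' \in A' -> ham_path e A' x' y' ->
  exists x y, [/\ x \in A, e c x & ham_path e A x y].
Proof.
move=> c'x' x'A' pA'; have [_ cA _ _] := sA; have [_ c'A' _ _] := sA'.
have p1 : ham_path e ([set c'] :|: A') c' y'.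
  by apply: ham_path_cat (ham_path1 e c') pA' c'x' _ => v; rewrite inE => /eqP->; rewrite (negPf c'A').
have [M0|/set0Pn[m mM]] := eqVneq M set0.
  have eA : [set c'] :|: A' = A.
    apply/eqP; rewrite eqEsubset subUset sub1set c'A subA /=.
    by rewrite -setD_eq0; apply/eqP.
  rewrite eA in p1; exists c', y'; split=> //.
  have [a aA ca] := side_nbr critE sA; move: aA ca; rewrite -eA !inE => /orP[/eqP->//|aA' ca].
  have [_ _ _ clA'] := sA'.
  have cA' : c \notin A' by apply: contra cA; exact: (subsetP subA).
  by have := clA' a c aA' cA'; rewrite symE => /(_ ca) ec; rewrite ec c'A in cA.
have cM : c \notin M by rewrite inE (negPf cA) andbF.
have [a [v [aM vM av]]] := crit_edge_out critE mM cM.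
have [ac ac'] : e a c /\ e a c'.
  have [ev|ev] := middle_edge aM vM av; rewrite ev in av; split=> //.
    by apply: (middle_twin (q := c)) av => //; rewrite !eqxx ?orbT.
  by apply: (middle_twin (q := c')) av => //; rewrite !eqxx ?orbT.
have aA : a \in A by case/setDP: aM.
have eA : M :|: ([set c'] :|: A') = A.
  apply/setP => z; rewrite !inE; case: eqVneq => [->|_] /=; first by rewrite c'A.
  by case zA': (z \in A'); rewrite ?(subsetP subA z zA') ?orbF.
have fin b : ham_path e M a b -> e b c' -> exists x y, [/\ x \in A, e c x & ham_path e A x y].
  move=> pM bc'; exists a, y'; split=> //; first by rewrite symE.
  rewrite -eA; apply: ham_path_cat pM p1 bc' _ => w /setDP[_]; rewrite !inE.
  by move=> /negP.
have [M1|/set0Pn[m1 m1M]] := eqVneq (M :\ a) set0.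
  apply: (fin a) => //; rewrite -(setD1K aM) M1 setU0; exact: ham_path1.
have : ~ side e a (M :\ a).
  by move=> s; have /negP := middle_ncut aM; apply; apply/cut_verticesP; exists (M :\ a).
have cMa : c \notin M :\ a by rewrite inE (negPf cM) andbF.
have [/existsP[b /andP[bMa bc]]|] := boolP [exists b, (b \in M :\ a) && (e b c)].
  move=> _; move: bMa; rewrite !inE => /andP[ba bM]; apply: (fin b).
    by apply: ham_path_clique => //; [exact: middle_clique | rewrite !inE | rewrite eq_sym].
  by apply: (middle_twin (q := c)) bc; rewrite ?eqxx ?orbT // !inE.
rewrite negb_exists => /forallP no; case; split.
- by apply/set0Pn; exists m1.
- by rewrite !inE eqxx.
- apply/set0Pn; exists c; rewrite !inE negb_or (negPf cA) !andbF andbT.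
  by apply: contraNneq cA => ->.
move=> x b xM bM xb; have xM' : x \in M by case/setD1P: xM.
apply/eqP; apply: contraNT bM => ba; rewrite in_setD1 ba /=; apply/negPn/negP => bM.
have := no x; rewrite xM /=; case: (middle_edge xM' bM xb) => eb; rewrite eb in xb.
  by rewrite xb.
by rewrite (middle_twin (q := c') xM') // !eqxx.
Qed.

End Middle.

Lemma ham_path_side c A : side e c A -> exists x y, [/\ x \in A, e c x & ham_path e A x y].
Proof.
have [n] := ubnP #|A|; elim: n c A => // n IH c A ltn sA; have [_ cA _ clA] := sA.
pose good (p : T * {set T}) := [&& sideb p.1 p.2, p.1 \in A & p.2 \subset A].
have [/existsP[p gp]|] := boolP [exists p, good p].
  have [[c' A'] /and3P[/= /sideP sA' c'A subA] mx] := arg_maxnP (fun p : T * {set T} => #|p.2|) gp.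
  have [_ c'A' _ _] := sA'.
  have lt : #|A'| < #|A|.
    by apply: proper_card; rewrite properE subA; apply/subsetPn; exists c'.
  have [|x' [y' [x'A' c'x' pA']]] := IH c' A' _ sA'; first exact: leq_trans lt _.
  apply: (middle_path sA c'A sA' subA _ c'x' x'A' pA') => c'' A'' s'' c''A sub''.
  by apply: (mx (c'', A'')); rewrite /good /= c''A sub'' !andbT; apply/sideP.
rewrite negb_exists => /forallP ng.
have nc v : v \in A -> v \notin cut_vertices e.
  move=> vA; apply/negP => /(side_inside sA vA)[A' [sA' sub _]].
  by have := ng (v, A'); rewrite /good /= vA sub !andbT => /sideP.
have sB := side_compl symE sA.
apply: (end_path critE sA) => //.
  by rewrite cut_free_exc //; apply: leq_trans few; exact: subset_leq_card (subsetIl _ _).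
(* If [A] holds two vertices of [P], the opposite side is light and has a simplicial vertex, to
   which a simplicial vertex of [A] would have to be adjacent. *)
rewrite cut_free_exc // => l r rA sr.
have lB : #|P :&: ~: (c |: A)| <= 1.
  have : #|P :&: A| + #|P :&: ~: (c |: A)| <= 3.
    apply: leq_trans few; rewrite -(cardsID A P) leq_add2l; apply: subset_leq_card.
    by apply/subsetP => x; rewrite !inE negb_or => /and3P[-> _ ->].
  by clear - l; lia.
have [x xB sx] := light_tip sB lB; move: xB; rewrite !inE negb_or => /andP[xc xA].
have rx : r != x by apply: contraNneq xA => <-.
by move: xc; rewrite (clA r x rA xA (simplicial_adjacent critE sr sx rx)) eqxx.
Qed.

Lemma few_traceable : traceable e.
Proof.
have [/existsP[c /cut_verticesP[A sA]]|] := boolP [exists c, c \in cut_vertices e].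
  have [_ cA _ _] := sA.
  have [x [y [xA cx pA]]] := ham_path_side sA.
  have [x' [y' [x'B cx' pB]]] := ham_path_side (side_compl symE sA).
  apply: (@ham_path_traceable _ _ y y').
  have -> : [set: T] = A :|: ([set c] :|: ~: (c |: A)).
    by apply/setP => z; rewrite !inE; case: (z \in A); case: (z == c).
  apply: ham_path_cat (ham_path_rev symE pA) (ham_path_cat (ham_path1 e c) pB cx' _) _ _.
  - by move=> v; rewrite !inE => /eqP->; rewrite eqxx.
  - by rewrite symE.
  move=> v vA; rewrite !inE vA orbT orbF => /eqP ev; by rewrite -ev vA in cA.
rewrite negb_exists => /forallP nc; apply: (small_traceable critE) => //.
apply: leq_trans few; rewrite (_ : D0 = P) //; apply/setP => x; rewrite !inE.
by have := nc x; rewrite inE => ->.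
Qed.

End Decomposition.

Lemma conn_dominating_setT (T : finType) (e : rel T) : connected_on e setT ->
  conn_dominating e setT.
Proof. by move=> cT; rewrite /conn_dominating cT andbT; apply/forallP => x; rewrite inE. Qed.

Lemma critical_crit (T : finType) (e : rel T) k : simple_graph e -> gamma_c_critical k e ->
  exists2 D0, crit e D0 & #|D0| = k.
Proof.
move=> sG [/andP[_ cT] gk critE]; move: gk; rewrite /gamma_c.
case: arg_minnP => [|D0 cD0 minD gk]; first exact: conn_dominating_setT.
exists D0 => //; split=> //.
move=> u v uv nE; move: (critE u v uv nE); rewrite /gamma_c.
have cT' : connected_on (add_edge e u v) setT.
  by apply: connected_on_mono cT => x y _ _ xy; rewrite /add_edge /= xy.
case: arg_minnP => [|D cD _ lt]; first exact: conn_dominating_setT.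
by exists D; rewrite ?gk.
Qed.

Lemma nontraceable_bounds (T : finType) (e : rel T) k : simple_graph e ->
  gamma_c_critical k e -> ~ traceable e -> #|cut_vertices e| + 4 <= k.
Proof.
move=> sG /(critical_crit sG)[D0 critE <-] nT.
have symE : symmetric e by case: sG.
rewrite leqNgt; apply/negP => lt; apply: nT; apply: (few_traceable critE).
have sub : cut_vertices e \subset D0.
  apply/subsetP => c /cut_verticesP[A sA]; have [_ _ cD0 _ _] := critE.
  exact: side_mem sA cD0.
by rewrite cardsD (setIidPr sub); clear - lt; lia.
Qed.

(** * Chains of cliques attached to a core *)

Lemma conn_dominating_mono (T : finType) (f g : rel T) (X : {set T}) :
  (forall x y, f x y -> g x y) -> conn_dominating f X -> conn_dominating g X.
Proof.
move=> fg /andP[/dominatingP dX cX]; apply/andP; split.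
  by apply/dominatingP => x /dX[y yX /fg]; exists y.
by apply: connected_on_mono cX => x y _ _; exact: fg.
Qed.

Lemma conn_dominating_connected (T : finType) (e : rel T) (D : {set T}) c : symmetric e ->
  c \in D -> conn_dominating e D -> connected_on e setT.
Proof.
move=> symE cD /andP[/dominatingP dD /connected_onP cnD].
apply: (@connected_onP1 _ _ symE _ c); rewrite ?inE // => Y _ /set0Pn[y yY] cY.
have [YD|YD] := eqVneq (Y :&: D) set0.
  have yD : y \notin D by apply/negP => yD; have := in_setI y Y D; rewrite YD yY yD inE.
  have [z zD yz] := dD y yD; exists y, z; split=> //; rewrite !inE andbT.
  by apply/negP => zY; have := in_setI z Y D; rewrite YD zY zD inE.
have [|x [z [xX zD xz]]] := cnD _ (subsetIr Y D) YD.
  by apply: contraNneq cY => eD; move: cD; rewrite -eD inE => /andP[].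
case/setIP: xX => xY _; case/setDP: zD => zD; rewrite inE zD andbT => zY.
by exists x, z; split=> //; rewrite !inE zY.
Qed.

Section ChainGraph.
Variables (A C : finType) (ce : rel A) (N : {set A}) (p : nat) (lay : C -> nat).

Hypotheses (ceC : symmetric ce) (ceI : irreflexive ce).
Hypothesis N_clique : {in N &, forall a b, a != b -> ce a b}.
Hypothesis N_proper : exists a, a \notin N.
(** [core_min] is for the lower bound, [core_in] for added edges that skip a layer, [core_out] shows
    that no core vertex is a cut-vertex, [core_far] is for edges from the top layer to the core, and
    [core_add] for edges inside the core. *)
Hypothesis core_min : forall X, conn_dominating ce X -> X :&: N != set0 -> 4 <= #|X|.
Hypothesis core_in : forall a, exists X,
  [/\ conn_dominating ce X, X :&: N != set0, a \in X & #|X| <= 4].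
Hypothesis core_out : forall a, exists X,
  [/\ conn_dominating ce X, X :&: N != set0, a \notin X & #|X| <= 4].
Hypothesis core_far : forall a, a \notin N -> exists X,
  [/\ conn_dominating ce X, a \in X & #|X| <= 3].
Hypothesis core_add : forall x y, x != y -> ~~ ce x y -> exists X,
  [/\ conn_dominating (add_edge ce x y) X, X :&: N != set0 & #|X| <= 3].

Hypothesis lay_le : forall t, lay t <= p.
Hypothesis lay_onto : forall j, j <= p -> exists t, lay t = j.
Variable z0 : C.
Hypothesis lay0 : forall t, (lay t == 0) = (t == z0).

Notation V := (A + C)%type.

Definition chain_rel : rel V := fun x y => match x, y with
  | inl a, inl b => ce a b
  | inr s, inr t => [&& s != t, lay s <= (lay t).+1 & lay t <= (lay s).+1]
  | inl a, inr t | inr t, inl a => (a \in N) && (lay t == p)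
  end.
Let e := chain_rel.

(** The core counts as one more layer above the top, so that edges change the level by at most
    one. *)
Definition lev (x : V) := if x is inr t then lay t else p.+1.

Lemma chain_sym : symmetric e.
Proof. by case=> [a|s] [b|t] //=; rewrite 1?ceC // eq_sym [X in _ && X]andbC. Qed.

Lemma chain_simple : simple_graph e.
Proof. by split; [exact: chain_sym | case=> [a|s] //=; rewrite ?ceI ?eqxx]. Qed.

Lemma chain_lev x y : e x y -> lev x <= (lev y).+1.
Proof.
case: x y => [a|s] [b|t] //=; first by case/andP=> _ /eqP->.
  by case/andP=> _ /eqP->; exact: leqW.
by case/and3P.
Qed.

Definition vset (X : {set A}) (K : {set C}) : {set V} :=
  [set x | match x with inl a => a \in X | inr t => t \in K end].

Lemma card_vset (X : {set A}) (K : {set C}) : #|vset X K| = #|X| + #|K|.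
Proof.
have -> : vset X K = inl @: X :|: inr @: K.
  apply/setP => [[a|t]]; rewrite !inE.
    rewrite mem_imset; last exact: inl_inj.
    by case: imsetP => [[? _ //]|]; rewrite orbF.
  rewrite mem_imset; last exact: inr_inj.
  by case: imsetP => [[? _ //]|].
rewrite cardsU (_ : _ :&: _ = set0) ?cards0 ?subn0; last first.
  by apply/setP => [[a|t]]; rewrite !inE; case: imsetP => [[? _ //]|_] //=;
    case: imsetP => [[? _ //]|_] //=; rewrite andbF.
by rewrite !card_imset //; [exact: inr_inj | exact: inl_inj].
Qed.

(** Connectedness comes from climbing: in a cut without core vertices, the edge that takes a topmost
    chain vertex higher or into [X] leaves the cut. *)
Lemma vset_cds (e' : rel V) (X : {set A}) (K : {set C}) : symmetric e' ->
  conn_dominating (fun a b => e' (inl a) (inl b)) X -> X != set0 ->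
  (forall t, t \in K -> (exists2 a, a \in X & e' (inr t) (inl a)) \/
    exists t', [/\ t' \in K, lay t < lay t' & e' (inr t) (inr t')]) ->
  (forall t, t \notin K -> (exists2 a, a \in X & e' (inr t) (inl a)) \/
    exists2 t', t' \in K & e' (inr t) (inr t')) ->
  conn_dominating e' (vset X K).
Proof.
move=> symE' /andP[/dominatingP dX /connected_onP cX] /set0Pn[a0 a0X] up dom.
apply/andP; split.
  apply/dominatingP => [[a|t]]; rewrite inE; first by move/dX=> [b bX ab]; exists (inl b); rewrite ?inE.
  by case/dom=> [[a aX ta]|[t' tK tt']]; [exists (inl a) | exists (inr t')]; rewrite ?inE.
apply: (@connected_onP1 _ _ symE' _ (inl a0)); rewrite ?inE // => Y /subsetP YD /set0Pn[y yY] a0Y.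
have [Y0|nY] := eqVneq [set a | inl a \in Y] set0.
  have noA a : inl a \notin Y by apply/negP => aY; have := in_set0 a; rewrite -Y0 inE aY.
  have Py : [pred t | inr t \in Y] (if y is inr t then t else z0).
    by case: y yY => [a|t] //= aY; have := noA a; rewrite aY.
  have [t tY mx] := arg_maxnP lay Py; rewrite /= in tY.
  have := YD _ tY; rewrite inE => /up[[a aX ta]|[t' [t'K lt tt']]].
    by exists (inr t), (inl a); split=> //; rewrite !inE noA.
  exists (inr t), (inr t'); split=> //; rewrite !inE t'K andbT.
  by apply/negP => /mx le; have := leq_trans lt le; rewrite ltnn.
have sub : [set a | inl a \in Y] \subset X.
  by apply/subsetP => a; rewrite inE => /YD; rewrite inE.
have [|a [b [aY bX ab]]] := cX _ sub nY.
  by apply: contraNneq a0Y => eX; move: a0X; rewrite -eX inE.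
exists (inl a), (inl b); move: aY bX; rewrite !inE => -> /andP[-> ->]; by split.
Qed.

Lemma reps u v : (lay u = lay v -> u = v) -> exists R : {set C},
  [/\ u \in R, v \in R, forall j, j <= p -> exists2 t, t \in R & lay t = j,
      {in R &, injective lay} & #|R| = p.+1].
Proof.
move=> uv.
have ch (j : 'I_p.+1) : exists t, lay t = j /\ (lay u = j -> t = u) /\ (lay v = j -> t = v).
  have [ju|ju] := eqVneq (lay u) j.
    by exists u; split=> //; split=> // jv; apply: uv; rewrite ju jv.
  have [jv|jv] := eqVneq (lay v) j.
    by exists v; split=> //; split=> // ju'; rewrite ju' eqxx in ju.
  have [|t tj] := lay_onto (j := j); first by rewrite -ltnS.
  by exists t; split=> //; split=> ej; [rewrite ej eqxx in ju | rewrite ej eqxx in jv].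
have [f fP] := fin_all_exists ch.
have lf j : lay (f j) = j by have [] := fP j.
exists (f @: setT); split.
- have lu : lay u < p.+1 by rewrite ltnS.
  by apply/imsetP; exists (Ordinal lu) => //; have [_ [/(_ erefl)]] := fP (Ordinal lu).
- have lv : lay v < p.+1 by rewrite ltnS.
  by apply/imsetP; exists (Ordinal lv) => //; have [_ [_ /(_ erefl)]] := fP (Ordinal lv).
- move=> j jp; have jp' : j < p.+1 by rewrite ltnS.
  by exists (f (Ordinal jp')); [exact: imset_f | rewrite lf].
- move=> s t /imsetP[i _ ->] /imsetP[j _ ->]; rewrite !lf => /val_inj->; by [].
rewrite card_imset ?cardsT ?card_ord // => i j /(congr1 lay); rewrite !lf; exact: val_inj.
Qed.

Section Reps.
Variables (R : {set C}) (e' : rel V).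
Hypotheses (onR : forall j, j <= p -> exists2 t, t \in R & lay t = j)
  (injR : {in R &, injective lay}) (cardR : #|R| = p.+1).
Hypotheses (symE' : symmetric e') (sub : forall x y, e x y -> e' x y).

Lemma z0R : z0 \in R.
Proof. by have [t tR /eqP] := onR (leq0n p); rewrite lay0 => /eqP <-. Qed.

Lemma rep_edge s t : s != t -> lay s <= (lay t).+1 -> lay t <= (lay s).+1 ->
  e' (inr s) (inr t).
Proof. by move=> *; apply: sub => /=; apply/and3P. Qed.

Lemma rep_up s t : lay t = (lay s).+1 -> e' (inr s) (inr t).
Proof.
move=> lt; apply: rep_edge; rewrite ?lt //; last by do 2!apply: leqW.
by apply/eqP => st; move: lt; rewrite st; exact: n_Sn.
Qed.

Lemma top_edge (X : {set A}) t : X :&: N != set0 -> lay t = p ->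
  exists2 a, a \in X & e' (inr t) (inl a).
Proof.
case/set0Pn=> a; rewrite inE => /andP[aX aN] tp; exists a => //.
by apply: sub; rewrite /= aN tp eqxx.
Qed.

Lemma layer_rep (K : {set C}) t s : t \notin K -> s \in K -> lay s = lay t ->
  exists2 t', t' \in K & e' (inr t) (inr t').
Proof.
move=> tK sK st; exists s => //; apply: rep_edge; rewrite ?st //.
by apply: contraNneq tK => ->.
Qed.

(** The bottom vertex [z0] is dominated from above, so the chain costs [p] and not [p.+1]. *)
Lemma full_cds (X : {set A}) : conn_dominating (fun a b => e' (inl a) (inl b)) X -> X != set0 ->
  (forall t, t \in R -> lay t = p -> exists2 a, a \in X & e' (inr t) (inl a)) ->
  conn_dominating e' (vset X (R :\ z0)).
Proof.
move=> cX X0 top; apply: vset_cds => // t.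
  case/setD1P=> tz tR; have := lay_le t; rewrite leq_eqVlt => /orP[/eqP tp|tp].
    by left; exact: top.
  right; have [t' t'R lt'] := onR tp; exists t'; split; rewrite ?lt' //.
    by rewrite in_setD1 t'R -lay0 lt'.
  exact: rep_up.
move=> tK; have [/eqP|t0] := posnP (lay t).
  rewrite lay0 => /eqP et; have [p0|p0] := posnP p.
    by left; apply: top; rewrite et ?z0R // p0; apply/eqP; rewrite lay0.
  right; have [s sR ls] := onR p0; have lt0 : lay t = 0 by apply/eqP; rewrite lay0 et.
  exists s; first by rewrite in_setD1 sR -lay0 ls.
  by apply: rep_up; rewrite ls lt0.
right; have [s sR ls] := onR (lay_le t); apply: (layer_rep tK (s := s)) => //.
by rewrite in_setD1 sR -lay0 ls -lt0n t0.
Qed.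

Lemma gap_cds (X : {set A}) u w : u \in R -> w \in R -> lay w = (lay u).+1 ->
  conn_dominating (fun a b => e' (inl a) (inl b)) X -> X :&: N != set0 ->
  (exists2 a, a \in X & e' (inr u) (inl a)) \/
    (exists t', [/\ t' \in R :\ z0 :\ w, lay u < lay t' & e' (inr u) (inr t')]) ->
  conn_dominating e' (vset X (R :\ z0 :\ w)).
Proof.
move=> uR wR lw cX XN link.
have X0 : X != set0 by apply: contraNneq XN => ->; rewrite set0I.
have inK s : s \in R -> 0 < lay s -> lay s != (lay u).+1 -> s \in R :\ z0 :\ w.
  move=> sR s0 su; rewrite !in_setD1 sR -lay0 -lt0n s0 !andbT.
  by apply: contraNneq su => ->; rewrite lw.
have wp : (lay u).+1 <= p by rewrite -lw.
apply: vset_cds => // t.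
  case/setD1P=> tw /setD1P[tz tR]; have [->//|tu] := eqVneq t u.
  have := lay_le t; rewrite leq_eqVlt => /orP[/eqP tp|tp]; first by left; exact: top_edge.
  right; have [t' t'R lt'] := onR tp; exists t'; split; rewrite ?lt' //.
    apply: inK; rewrite ?lt' // eqSS; apply: contraNneq tu => tu; apply/eqP; exact: injR.
  exact: rep_up.
move=> tK; have [/eqP|t0] := posnP (lay t).
  move=> lt0; have et : t = z0 by apply/eqP; rewrite -lay0.
  have [/eqP|u0] := posnP (lay u).
    rewrite lay0 => /eqP eu; have -> : t = u by rewrite et.
    case: link => [|[t' [? _ ?]]]; first by left.
    by right; exists t'.
  right; have [s sR ls] := onR (leq_trans (ltn0Sn _) wp).
  exists s; first by apply: inK; rewrite ?ls // eqSS eq_sym -lt0n.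
  by apply: rep_up; rewrite ls (eqP lt0).
have [tu|tu] := eqVneq (lay t) (lay u).+1; last first.
  right; have [s sR ls] := onR (lay_le t); apply: (layer_rep tK (s := s)) => //.
  by apply: inK; rewrite ?ls.
have [u0|u0] := posnP (lay u).
  have [p1|p1] := leqP p 1.
    by left; apply: top_edge => //; apply/eqP; rewrite eqn_leq lay_le; rewrite (leq_trans p1).
  right; have [s sR ls] := onR p1; exists s; first by apply: inK; rewrite ?ls ?u0.
  by apply: rep_up; rewrite ls tu u0.
right; exists u; first by apply: inK => //; rewrite eqn_leq ltnn andbF.
by rewrite symE'; apply: rep_up.
Qed.

Lemma card_full (X : {set A}) : #|vset X (R :\ z0)| = #|X| + p.
Proof. by have := cardsD1 z0 R; rewrite z0R cardR card_vset add1n => -[->]. Qed.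

Lemma card_gap (X : {set A}) w : w \in R -> 0 < lay w -> #|vset X (R :\ z0 :\ w)|.+1 = #|X| + p.
Proof.
move=> wR w0; rewrite card_vset; have h1 := cardsD1 z0 R; have h2 := cardsD1 w (R :\ z0).
by rewrite in_setD1 wR -lay0 -lt0n w0 z0R cardR in h1 h2; clear - h1 h2; lia.
Qed.

End Reps.

(** A cut-vertex lies in every connected dominating set, so a set avoiding [x] shows that [x] is
    none. The size bound is the upper estimate in [chain_critical]. *)
Lemma chain_cds_out x : (forall t, x = inr t -> lay t = 0 \/ exists2 s, s != t & lay s = lay t) ->
  exists D, [/\ conn_dominating e D, x \notin D & #|D| <= p + 4].
Proof.
move=> out.
have fin t X : conn_dominating ce X -> X :&: N != set0 -> #|X| <= 4 ->
    (if x is inl a then a \notin X else true) ->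
    (forall t', x = inr t' -> lay t' = 0 \/ lay t = lay t' /\ t != t') ->
    exists D, [/\ conn_dominating e D, x \notin D & #|D| <= p + 4].
  move=> cX XN X4 xX tx; have [|R [tR _ onR injR cR]] := reps (u := t) (v := t); first by [].
  have X0 : X != set0 by apply: contraNneq XN => ->; rewrite set0I.
  exists (vset X (R :\ z0)); split.
  - apply: full_cds => //; first exact: chain_sym.
    by move=> s _ sp; apply: top_edge.
  - rewrite inE; case: x xX tx out => [a //|t'] _ tx _; rewrite !inE negb_and negbK -lay0.
    have [->//|[lt nt]] := tx _ erefl; apply/orP; right; apply: contra nt => t'R.
    by apply/eqP; apply: injR.
  by rewrite card_full // addnC leq_add2l.
case: x out fin => [a|t] out fin.
  have [X [cX XN aX X4]] := core_out a; exact: (fin z0 X).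
have [a _] := N_proper; have [X [cX XN _ X4]] := core_in a.
have [t0|[s st ls]] := out t erefl; first by apply: (fin z0 X) => // _ [<-]; left.
by apply: (fin s X) => // _ [<-]; right.
Qed.

(** The set reaches from level at most 1 up to the core and levels change by at most one along
    edges, so it meets each of the layers 1 to [p]. Its core part is itself a connected dominating
    set meeting [N]: excursions into the chain leave and return through the clique [N]. *)
Lemma chain_min D : conn_dominating e D -> p + 4 <= #|D|.
Proof.
case/andP=> /dominatingP dD /connected_onP cD.
pose X := [set a | inl a \in D]; pose K := [set t | inr t \in D].
have eD : D = vset X K by apply/setP => [[a|t]]; rewrite !inE.
have [a0 a0N] := N_proper.
(* A core vertex outside [N] can only be dominated from the core. *)
have [b0 b0X] : exists b, b \in X.
  have [a0D|/dD[[b|t] bD]] := boolP (inl a0 \in D); first by exists a0; rewrite inE.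
    by exists b; rewrite inE.
  by rewrite /= (negPf a0N).
have lz : lay z0 = 0 by apply/eqP; rewrite lay0.
have low : exists2 x, x \in D & lev x <= 1.
  have [zD|/dD[[b|t] bD]] := boolP (inr z0 \in D); first by exists (inr z0) => //=; rewrite lz.
    by rewrite /= lz => /andP[_ /eqP p0]; exists (inl b); rewrite //= -p0.
  by rewrite /= lz => /and3P[_ _ lt]; exists (inr t).
have cross j x : x \in D -> lev x < j -> j <= p -> exists2 t, t \in K & lay t = j.
  move=> xD xj jp.
  have [|||u [v [uX vD uv]]] := cD [set y in D | lev y < j].
  - by apply/subsetP => y; rewrite inE => /andP[].
  - by apply/set0Pn; exists x; rewrite inE xD.
  - apply/eqP => /setP /(_ (inl b0)); move: b0X; rewrite !inE => -> /=.
    by rewrite ltnNge (leq_trans jp).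
  move: uX vD; rewrite !inE => /andP[uD uj] /andP[+ vD]; rewrite vD /= -leqNgt => vj.
  have lv : lev v = j.
    apply/eqP; rewrite eqn_leq vj andbT; apply: leq_trans uj; apply: chain_lev.
    by rewrite chain_sym.
  case: v vD lv {uv vj} => [b|t] vD /= lv; last by exists t; rewrite ?inE.
  by rewrite -lv ltnn in jp.
have hit j : 0 < j <= p -> exists2 t, t \in K & lay t = j.
  case/andP=> j0 jp; have [x xD] := low.
  rewrite leq_eqVlt ltnS leqn0 => /orP[/eqP x1|/eqP x0]; last by apply: (cross j x) => //; rewrite x0.
  have [j1|j1] := leqP j 1; last by apply: (cross j x) => //; rewrite x1.
  have ej : j = 1 by apply/eqP; rewrite eqn_leq j1.
  case: x xD x1 => [b|t] tD /= lt; first by case: lt => p0; rewrite p0 leqNgt j0 in jp.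
  by exists t; rewrite ?inE // lt ej.
have leK : p <= #|K|.
  have sub : [set~ (ord0 : 'I_p.+1)] \subset [set (inord (lay t) : 'I_p.+1) | t in K].
    apply/subsetP => j; rewrite !inE -val_eqE /= -lt0n => j0.
    have [|t tK lt] := hit j; first by rewrite j0 -ltnS ltn_ord.
    by apply/imsetP; exists t => //; rewrite lt inord_val.
  have := subset_leq_card sub; rewrite cardsC1 card_ord => h.
  exact: leq_trans h (leq_imset_card _ _).
have XN : X :&: N != set0.
  suff [b [bD bN]] : exists b, inl b \in D /\ b \in N by apply/set0Pn; exists b; rewrite !inE bD.
  have viaK t : inr t \in D -> exists b, inl b \in D /\ b \in N.
    move=> tD; have [|||x [y [xX yD xy]]] := cD [set y in D | if y is inl _ then true else false].
    - by apply/subsetP => y; rewrite inE => /andP[].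
    - by apply/set0Pn; exists (inl b0); move: b0X; rewrite !inE => ->.
    - by apply/eqP => /setP /(_ (inr t)); rewrite !inE tD.
    move: xX yD; rewrite !inE => /andP[xD xl] /andP[+ yD]; rewrite yD /=.
    by case: x y xD xl xy {yD} => [b|s] [b'|s'] //= bD _ /andP[bN _] _; exists b.
  have [zD|/dD[[b|t] bD]] := boolP (inr z0 \in D); first exact: viaK zD.
    by case/andP=> bN _; exists b.
  by move=> _; exact: viaK bD.
rewrite eD card_vset addnC leq_add //; apply: core_min (XN).
apply/andP; split.
  apply/dominatingP => a aX; have [|[b|t] bD ab] := dD (inl a); first by rewrite inE in aX.
    by exists b; rewrite ?inE.
  case/set0Pn: (XN) => b; rewrite inE => /andP[bX bN]; exists b => //.
  by case/andP: ab => aN _; apply: N_clique => //; apply: contraNneq aX => ->.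
have out (Y : {set A}) : Y \subset X -> Y != set0 -> Y != X ->
    (exists x y, [/\ x \in Y, y \in X :\: Y & ce x y]) \/ exists2 x, x \in Y & x \in N.
  move=> /subsetP sY /set0Pn[y yY] nY; have [|||u [v [uY vD uv]]] := cD (inl @: Y).
  - by apply/subsetP => _ /imsetP[x /sY xX ->]; rewrite inE in xX.
  - by apply/set0Pn; exists (inl y); exact: imset_f.
  - apply: contraNneq nY => eY; apply/eqP/setP => x; rewrite inE -eY mem_imset //; exact: inl_inj.
  case/imsetP: uY uv => x xY -> {u}; case/setDP: vD => vD vY; case: v vD vY => [z|t] vD vY /=.
    move=> xz; left; exists x, z; split=> //; rewrite !inE vD andbT.
    by apply: contraNN vY; exact: imset_f.
  by case/andP=> xN _; right; exists x.
apply/connected_onP => Y sY Y0 nY.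
have [//|[x xY xN]] := out Y sY Y0 nY.
have [|||[u [v [uX vD uv]]]|[y /setDP[yX yY] yN]] := out (X :\: Y).
- exact: subsetDl.
- by rewrite setD_eq0; apply: contra nY => XY; rewrite eqEsubset sY.
- apply: contraNneq Y0 => eY; apply/eqP/setP => z; rewrite inE; apply/negP => zY.
  by have := subsetP sY z zY; rewrite -eY inE zY.
- exists v, u; split; [|exact: uX|by rewrite ceC].
  by case/setDP: vD => vX; rewrite inE vX andbT negbK.
exists x, y; split=> //; first by rewrite inE yY.
by apply: N_clique => //; apply: contraNneq yY => <-.
Qed.

Lemma chain_add_core x y : x != y -> ~~ ce x y ->
  exists2 D, conn_dominating (add_edge e (inl x) (inl y)) D & #|D| < p + 4.
Proof.
move=> xy nE; have [X [cX XN X3]] := core_add xy nE.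
have [//|R [_ _ onR injR cR]] := reps (u := z0) (v := z0).
have X0 : X != set0 by apply: contraNneq XN => ->; rewrite set0I.
have sub := @add_edgeW _ e (inl x) (inl y).
exists (vset X (R :\ z0)); last by rewrite card_full // addnC -addnS leq_add2l.
apply: full_cds => //; first exact/add_edge_sym/chain_sym.
by move=> t _ tp; apply: top_edge.
Qed.

Lemma chain_add_mixed s a : ~~ e (inr s) (inl a) ->
  exists2 D, conn_dominating (add_edge e (inr s) (inl a)) D & #|D| < p + 4.
Proof.
move=> nE; have sub := @add_edgeW _ e (inr s) (inl a).
have symE' := add_edge_sym chain_sym (inr s) (inl a).
have sa : add_edge e (inr s) (inl a) (inr s) (inl a) by rewrite /add_edge /= !eqxx orbT.
have mono X : conn_dominating ce X ->
    conn_dominating (fun x y => add_edge e (inr s) (inl a) (inl x) (inl y)) X.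
  by apply: conn_dominating_mono => x y xy; apply: sub.
have [//|R [sR _ onR injR cR]] := reps (u := s) (v := s).
have [sp|sp] := ltnP (lay s) p.
  have [w wR lw] := onR _ sp; have [X [cX XN aX X4]] := core_in a.
  exists (vset X (R :\ z0 :\ w)).
    by apply: (gap_cds onR injR symE' sub sR wR lw (mono X cX) XN); left; exists a.
  have w0 : 0 < lay w by rewrite lw.
  rewrite addnC; apply: leq_trans (leq_add X4 (leqnn p)).
  exact: eq_leq (card_gap onR cR X wR w0).
have ep : lay s = p by apply/eqP; rewrite eqn_leq lay_le.
have aN : a \notin N by move: nE; rewrite /= ep eqxx andbT.
have [X [cX aX X3]] := core_far aN.
exists (vset X (R :\ z0)); last by rewrite card_full // addnC -addnS leq_add2l.
apply: full_cds => //; first exact: mono.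
  by apply/set0Pn; exists a.
by move=> t tR tp; exists a => //; rewrite (injR t s) // tp ep.
Qed.

Lemma chain_add_chain s t : s != t -> ~~ e (inr s) (inr t) -> lay s <= lay t ->
  exists2 D, conn_dominating (add_edge e (inr s) (inr t)) D & #|D| < p + 4.
Proof.
move=> st nE le; have sub := @add_edgeW _ e (inr s) (inr t).
have symE' := add_edge_sym chain_sym (inr s) (inr t).
have lt : (lay s).+1 < lay t.
  by rewrite ltnNge; apply: contraNN nE => h; rewrite /= st h (leqW le).
have [|R [sR tR onR injR cR]] := reps (u := s) (v := t).
  by move=> eq; clear - lt eq; lia.
have [w wR lw] := onR _ (leq_trans (ltnW lt) (lay_le t)).
have [a _] := N_proper; have [X [cX XN aX X4]] := core_in a.
exists (vset X (R :\ z0 :\ w)).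
  apply: (gap_cds onR injR symE' sub sR wR lw _ XN).
    by apply: conn_dominating_mono cX => x y xy; apply: sub.
  right; exists t; split; first by rewrite !in_setD1 tR -lay0 -lt0n andbT (leq_ltn_trans _ lt) ?andbT //;
    apply: contraTneq lt => ->; rewrite lw ltnn.
    exact: ltnW.
  by rewrite /add_edge /= !eqxx orbT.
have w0 : 0 < lay w by rewrite lw.
rewrite addnC; apply: leq_trans (leq_add X4 (leqnn p)).
  exact: eq_leq (card_gap onR cR X wR w0).
Qed.

Lemma chain_add u v : u != v -> ~~ e u v ->
  exists2 D, conn_dominating (add_edge e u v) D & #|D| < p + 4.
Proof.
have swap x y : (exists2 D, conn_dominating (add_edge e x y) D & #|D| < p + 4) ->
    exists2 D, conn_dominating (add_edge e y x) D & #|D| < p + 4.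
  by case=> D cD ltD; exists D => //; apply: conn_dominating_mono cD => a b; rewrite add_edgeC.
case: u v => [a|s] [b|t] uv nE.
- by apply: chain_add_core.
- by apply: swap; apply: chain_add_mixed; rewrite chain_sym.
- exact: chain_add_mixed.
have [le|le] := leqP (lay s) (lay t); first exact: chain_add_chain.
apply: swap; apply: chain_add_chain; rewrite ?(ltnW le) //; first by rewrite eq_sym.
by rewrite chain_sym.
Qed.

Lemma chain_critical : gamma_c_critical (p + 4) e.
Proof.
have [D [cD _ leD]] : exists D, [/\ conn_dominating e D, inr z0 \notin D & #|D| <= p + 4].
  by apply: chain_cds_out => t [<-]; left; apply/eqP; rewrite lay0.
have [x xD] : exists x, x \in D.
  apply/set0Pn; rewrite -card_gt0; have h := chain_min cD; clear - h; lia.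
have cT := conn_dominating_connected chain_sym xD cD.
split.
- by rewrite /connected_graph cT andbT; apply/card_gt0P; exists x.
- rewrite /gamma_c; case: arg_minnP => [|D' cD' min]; first exact: conn_dominating_setT.
  apply/eqP; rewrite eqn_leq chain_min // andbT; apply: leq_trans leD; exact: min.
move=> u v uv nE; have [D1 cD1 lt1] := chain_add uv nE.
rewrite /gamma_c; case: arg_minnP => [|D' cD' min]; last by apply: leq_ltn_trans lt1; exact: min.
by apply: conn_dominating_setT; apply: connected_on_add.
Qed.

Lemma chain_cut_core a : inl a \notin cut_vertices e.
Proof.
apply/negP => /cut_verticesP[B sB].
have inD := side_mem chain_sym sB.
by have [//|D [cD /negP xD _]] := @chain_cds_out (inl a); exact: xD (inD D cD).
Qed.

Lemma chain_cut t : reflect (0 < lay t /\ forall s, lay s = lay t -> s = t)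
  (inr t \in cut_vertices e).
Proof.
apply: (iffP (cut_verticesP _ _)) => [[B sB]|[t0 uniq_t]].
  have inD := side_mem chain_sym sB; split=> [|s st].
    rewrite lt0n; apply/negP => /eqP t0.
    have [_ [<-]|D [cD /negP xD _]] := @chain_cds_out (inr t); first by left.
    exact: xD (inD D cD).
  apply/eqP/negPn/negP => nst.
  have [_ [<-]|D [cD /negP xD _]] := @chain_cds_out (inr t); first by right; exists s.
  exact: xD (inD D cD).
have [a _] := N_proper.
exists [set x | lev x < lay t]; split.
- by apply/set0Pn; exists (inr z0); have /eqP := lay0 z0; rewrite eqxx inE /= => /eqP/eqP->.
- by rewrite inE /= ltnn.
- by apply/set0Pn; exists (inl a); rewrite !inE /= -leqNgt ltnW // ltnS.
move=> x y; rewrite !inE -leqNgt => xt ty xy.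
have ly : lev y = lay t.
  apply/eqP; rewrite eqn_leq ty andbT; apply: leq_trans xt; apply: chain_lev.
  by rewrite chain_sym.
case: y ly {ty xy} => [b|s] /= ly; last by rewrite (uniq_t s ly).
by have := lay_le t; rewrite -ly ltnn.
Qed.

End ChainGraph.

(** * The extremal graphs *)

(** A connectedness certificate that evaluates quickly: the list is in search order, so no
    transitive closure is computed. *)
Fixpoint grown (T : Type) (f : rel T) (seen s : seq T) : bool :=
  if s is x :: s' then has (f x) seen && grown f (x :: seen) s' else true.

Lemma grown_connected (T : finType) (f : rel T) seen s : symmetric f ->
  connected_on f [set x in seen] -> grown f seen s -> connected_on f [set x in seen ++ s].
Proof.
move=> symF; elim: s seen => [|x s IH] seen cS /=; first by rewrite cats0.
case/andP=> /hasP[y yS xy] gs.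
have -> : [set z in seen ++ x :: s] = [set z in (x :: seen) ++ s].
  by apply/setP => z; rewrite !inE !mem_cat !inE orbCA.
apply: IH gs.
have -> : [set z in x :: seen] = x |: [set z in seen] by apply/setP => z; rewrite !inE.
by apply: (connected_onU1 symF cS (x := y)); rewrite ?inE // symF.
Qed.

Definition vertices := iota 0 15.

(* The set listed by [s] is connected, each vertex being attached to an
   earlier one, and dominates all of [0..14]. *)
Definition cdsb (f : rel nat) (s : seq nat) : bool :=
  (if s is x :: s' then grown f [:: x] s' else false)
  && all (fun x => (x \in s) || has (f x) s) vertices.

(** Vertices [0], [1], [2] form the gate. Vertices [7] to [14] are pairwise non-adjacent, so
    deleting [0] to [6] leaves eight isolated core vertices, and the chain as ninth component. *)
Definition core_nbrs : seq (seq nat) :=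
  [:: [:: 1; 2; 5; 6; 8; 10; 12; 13; 14]; [:: 0; 2; 5; 6; 8; 9; 10; 11; 14];
      [:: 0; 1; 5; 6; 8; 9; 11; 12; 13]; [:: 4; 8; 9; 10; 11; 12; 13; 14];
      [:: 3; 6; 7; 8; 10; 11; 12]; [:: 0; 1; 2; 6; 7; 8; 9; 13; 14];
      [:: 0; 1; 2; 4; 5; 7; 8; 10; 11; 12]; [:: 4; 5; 6]; [:: 0; 1; 2; 3; 4; 5; 6];
      [:: 1; 2; 3; 5]; [:: 0; 1; 3; 4; 6]; [:: 1; 2; 3; 4; 6]; [:: 0; 2; 3; 4; 6];
      [:: 0; 2; 3; 5]; [:: 0; 1; 3; 5]].

Definition adj : rel nat := fun x y => y \in nth [::] core_nbrs x.
Definition adj_add (u v : nat) : rel nat := fun x y =>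
  [|| adj x y, (x == u) && (y == v) | (x == v) && (y == u)].

(** Certificates that meet the gate, chosen so that each core vertex lies in one of them and outside
    another. *)
Definition fours : seq (seq nat) :=
  [:: [:: 0; 1; 6; 4]; [:: 2; 5; 8; 3]; [:: 0; 1; 10; 4]; [:: 0; 1; 11; 4]; [:: 0; 1; 12; 4];
      [:: 0; 1; 6; 9]; [:: 0; 1; 6; 13]; [:: 0; 1; 6; 14]; [:: 0; 5; 7; 4]].
(** Certificates away from the gate, as [core_lower] demands for this size; together they cover all
    vertices from [3] on. *)
Definition threes : seq (seq nat) :=
  [:: [:: 3; 4; 6]; [:: 3; 8; 5]; [:: 3; 9; 5]; [:: 3; 13; 5]; [:: 3; 14; 5]; [:: 3; 10; 6];
      [:: 3; 11; 6]; [:: 3; 12; 6]; [:: 4; 7; 5]].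
Definition added_threes : seq (seq nat) :=
  [:: [:: 0; 1; 6]; [:: 0; 1; 8]; [:: 0; 6; 4]; [:: 0; 5; 8]; [:: 1; 5; 8]; [:: 1; 6; 4];
      [:: 2; 9; 3]; [:: 2; 5; 8]; [:: 2; 6; 4]; [:: 0; 1; 4]; [:: 3; 4; 2]; [:: 0; 5; 3];
      [:: 0; 5; 4]; [:: 0; 1; 10]; [:: 0; 1; 11]; [:: 0; 1; 12]; [:: 0; 13; 3]; [:: 0; 14; 3];
      [:: 0; 8; 4]; [:: 0; 10; 4]; [:: 0; 12; 4]; [:: 0; 6; 11]; [:: 0; 6; 13]; [:: 0; 6; 14];
      [:: 0; 5; 10]; [:: 0; 5; 12]; [:: 1; 5; 10]; [:: 1; 8; 4]; [:: 1; 10; 4]; [:: 1; 11; 4];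
      [:: 1; 6; 12]; [:: 1; 6; 14]; [:: 2; 8; 4]; [:: 2; 11; 4]; [:: 2; 12; 4]; [:: 2; 6; 10]].

Local Notation core := 'I_15.
Definition core_rel : rel core := fun x y => adj x y.
Definition core_gate : {set core} := [set a : core | a < 3].

Lemma all_core (P : pred nat) : all P vertices -> forall a : core, P a.
Proof. by move/allP=> allP a; apply: allP; rewrite mem_iota /=; exact: ltn_ord. Qed.

Lemma has_core (P : pred nat) : has P vertices -> exists a : core, P a.
Proof. by case/hasP=> a; rewrite mem_iota => la Pa; exists (Ordinal (la : a < 15)). Qed.

Lemma adj_sym_check : all (fun x => all (fun y => adj x y == adj y x) vertices) vertices.
Proof. by vm_compute. Qed.

Lemma core_sym : symmetric core_rel.
Proof.
by move=> a b; apply/eqP; exact: (all_core (all_core adj_sym_check a) b).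
Qed.

Lemma core_irr : irreflexive core_rel.
Proof.
have chk : all (fun x => ~~ adj x x) vertices by vm_compute.
by move=> a; apply/negbTE; exact: (all_core chk a).
Qed.

Lemma core_gate_clique : {in core_gate &, forall a b, a != b -> core_rel a b}.
Proof.
have chk : all (fun x => all (fun y => [&& x < 3, y < 3 & x != y] ==> adj x y) vertices) vertices.
  by vm_compute.
move=> a b; rewrite !inE => a3 b3 ab; have := all_core (all_core chk a) b.
by rewrite a3 b3 /= val_eqE ab.
Qed.

Definition core_set (s : seq nat) : {set core} := [set a : core | val a \in s].

Lemma card_core_set s : #|core_set s| <= size s.
Proof.
rewrite cardE -(size_map val); apply: uniq_leq_size.
  by rewrite map_inj_uniq ?enum_uniq //; exact: val_inj.
by move=> x /mapP[a]; rewrite mem_enum inE => ? ->.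
Qed.

Lemma core_set_gate s : has (fun x => x < 3) s -> core_set s :&: core_gate != set0.
Proof.
case/hasP=> x xs x3; have x15 : x < 15 by exact: leq_trans x3 _.
by apply/set0Pn; exists (Ordinal x15); rewrite !inE /= xs.
Qed.

Lemma core_set_cds (f : rel nat) (g : rel core) s : symmetric g -> g =2 (fun a b => f a b) ->
  all (fun x => x < 15) s -> cdsb f s -> conn_dominating g (core_set s).
Proof.
move=> symG gf s15 /andP[con dom].
have [t et] : exists t : seq core, s = map val t.
  elim: s s15 {con dom} => [|x s IH] /=; first by exists [::].
  by case/andP=> x15 /IH[t ->]; exists (Ordinal x15 :: t).
have -> : core_set s = [set a in t].
  by apply/setP => a; rewrite !inE et mem_map //; exact: val_inj.
apply/andP; split.
  apply/dominatingP => a; rewrite inE => aD; have := all_core dom a.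
  rewrite et (mem_map val_inj) (negPf aD) /= has_map => /hasP[b bt ab].
  by exists b; rewrite ?inE ?gf.
move: con; rewrite et; case: t {et} => // x t /=.
have tr seen u : grown f (map val seen) (map val u) -> grown g seen u.
  elim: u seen => //= y u IH seen /andP[hy /(IH (y :: seen))->]; rewrite andbT.
  by move: hy; rewrite has_map; apply: sub_has => z; rewrite gf.
move/(tr [:: x]); rewrite -cat1s; apply: grown_connected => //.
rewrite (_ : [set z in [:: x]] = [set x]); first exact: connected_on1.
by apply/setP => z; rewrite !inE.
Qed.

Lemma fours_cds s : s \in fours -> [/\ conn_dominating core_rel (core_set s),
  core_set s :&: core_gate != set0 & #|core_set s| <= 4].
Proof.
have chk : all (fun s => [&& all (fun x => x < 15) s, cdsb adj s, has (fun x => x < 3) s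
  & size s == 4]) fours by vm_compute.
move=> /(allP chk)/and4P[s15 cs gs /eqP s4].
split; [|exact: core_set_gate|exact: leq_trans (card_core_set s) (eq_leq s4)].
exact: core_set_cds core_sym _ s15 cs.
Qed.

Lemma core_in (a : core) : exists X, [/\ conn_dominating core_rel X,
  X :&: core_gate != set0, a \in X & #|X| <= 4].
Proof.
have chk : all (fun x => has (fun s => x \in s) fours) vertices by vm_compute.
have [s sF sa] := hasP (all_core chk a); have [? ? ?] := fours_cds sF.
by exists (core_set s); split; rewrite ?inE.
Qed.

Lemma core_out (a : core) : exists X, [/\ conn_dominating core_rel X,
  X :&: core_gate != set0, a \notin X & #|X| <= 4].
Proof.
have chk : all (fun x => has (fun s => x \notin s) fours) vertices by vm_compute.
have [s sF sa] := hasP (all_core chk a); have [? ? ?] := fours_cds sF.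
by exists (core_set s); split; rewrite ?inE.
Qed.

Lemma core_three a : a \notin core_gate -> exists X : {set core},
  [/\ conn_dominating core_rel X, a \in X & #|X| <= 3].
Proof.
have chk : all (fun s => [&& all (fun x => x < 15) s, cdsb adj s & size s == 3]) threes.
  by vm_compute.
have cin : all (fun x => (3 <= x) ==> has (fun s => x \in s) threes) vertices by vm_compute.
rewrite inE -leqNgt => a3; have /hasP[s sF sa] := implyP (all_core cin a) a3.
have /and3P[s15 cs /eqP s3] := allP chk s sF; exists (core_set s); split; rewrite ?inE //.
  exact: core_set_cds core_sym _ s15 cs.
exact: leq_trans (card_core_set s) (eq_leq s3).
Qed.

Lemma added_threes_ok :
  all (fun s => [&& all (fun x => x < 15) s, has (fun x => x < 3) s & size s == 3]) added_threes.
Proof. by vm_compute. Qed.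

Lemma added_threes_check : all (fun u => all (fun v =>
  if u < v then if adj u v then true else has (cdsb (adj_add u v)) added_threes else true)
  vertices) vertices.
Proof. by vm_compute. Qed.

Lemma core_three_add x y : x != y -> ~~ core_rel x y -> exists X : {set core},
  [/\ conn_dominating (add_edge core_rel x y) X, X :&: core_gate != set0 & #|X| <= 3].
Proof.
wlog lt : x y / x < y.
  move=> W xy nE; have [/W h|le] := ltnP x y; first exact: h.
  have [|||X [cX gX X3]] := W y x; rewrite 1?eq_sym 1?core_sym //.
    by rewrite ltn_neqAle le andbT val_eqE eq_sym.
  exists X; split; [|exact: gX|exact: X3].
  by apply: conn_dominating_mono cX => u v; rewrite add_edgeC.
move=> xy nE; have := all_core (all_core added_threes_check x) y.
rewrite lt (negPf (nE : ~~ adj x y)) => /hasP[s sF cs].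
have /and3P[s15 gs /eqP s3] := allP added_threes_ok s sF.
exists (core_set s); split; [|exact: core_set_gate|exact: leq_trans (card_core_set s) (eq_leq s3)].
exact: core_set_cds (add_edge_sym core_sym x y) _ s15 cs.
Qed.

(* Three vertices [a], [b], [c] that induce a connected subgraph, possibly with
   repetitions, and contain a gate vertex do not dominate the core. *)
Lemma gate_triples_check : all (fun a => all (fun b => all (fun c => [&& a < 3, (b == a) || adj a b
    & [|| c == a, adj a c | adj b c]] ==>
    has (fun x => (x \notin [:: a; b; c]) && ~~ has (adj x) [:: a; b; c]) vertices)
  vertices) vertices) vertices.
Proof. by vm_compute. Qed.

Lemma core_lower (X : {set core}) : conn_dominating core_rel X -> X :&: core_gate != set0 ->
  4 <= #|X|.
Proof.
move=> /andP[/dominatingP dX /connected_onP cX] /set0Pn[a]; rewrite !inE => /andP[aX a3].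
rewrite ltnNge; apply/negP => X3.
have [b [c [ab bc XS]]] : exists b c : core, [/\ (b == a) || core_rel a b,
    [|| c == a, core_rel a c | core_rel b c] & X \subset [set a; b; c]].
  have [eX|nX] := eqVneq X [set a].
    by exists a, a; rewrite eqxx eX; split=> //; apply/subsetP => z; rewrite !inE => ->.
  have [|||_ [b [/set1P-> /setDP[bX ba] ab]]] := cX [set a].
  - by rewrite sub1set.
  - by apply/set0Pn; exists a; rewrite inE.
  - by rewrite eq_sym.
  have [eX|nX2] := eqVneq X [set a; b].
    by exists b, a; rewrite ab eqxx orbT eX; split=> //; apply/subsetP => z; rewrite !inE => ->.
  have [|||z [c [zab /setDP[cX' cab] zc]]] := cX [set a; b].
  - by rewrite subUset !sub1set aX.
  - by apply/set0Pn; exists a; rewrite !inE eqxx.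
  - by rewrite eq_sym.
  exists b, c; rewrite ab orbT; split=> //.
    by case/set2P: zab zc => -> ->; rewrite !orbT.
  have eX : [set a; b; c] = X.
    apply/eqP; rewrite eqEcard !subUset !sub1set aX bX cX' /=; apply: leq_trans X3 _.
    rewrite setUC cardsU1 cab cards2; move: ba; rewrite inE eq_sym => ->; by [].
  by rewrite eX.
have := all_core (all_core (all_core gate_triples_check a) b) c.
rewrite a3 (ab : (val b == val a) || adj a b) (bc : [|| val c == val a, adj a c | adj b c]).
case/has_core=> x /andP[xn nx].
have abc (z : core) : z \in X -> val z \in [:: val a; val b; val c].
  by move/(subsetP XS); rewrite !inE -!val_eqE -orbA.
have xX : x \notin X by apply: contra xn; exact: abc.
have [z zX xz] := dX x xX; case/negP: nx; apply/hasP; exists (val z) => //; exact: abc.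
Qed.

(** * Components met by a path after deleting vertices *)

Section Colours.
Variables (T : eqType) (e : rel T) (E : pred T) (col : T -> nat).
Hypothesis col_edge : forall x y, e x y -> ~~ E x -> ~~ E y -> col x = col y.

Let colours s := size (undup [seq col y | y <- s & ~~ E y]).

(* A path falls into at most one more piece than the number of its vertices
   in [E], and each piece is monochromatic. *)
Lemma path_colours x s : path e x s -> colours (x :: s) + E x <= (count E (x :: s)).+1.
Proof.
elim: s x => [|y s IH] x; rewrite /colours /=; first by case: (E x).
case/andP=> xy /IH; rewrite /colours /=; have := @col_edge x y xy.
case: (E x) => /=; first by case: (E y) => /= _; clear; lia.
case: (E y) => /= [_|/(_ isT isT)->].
  by case: ifP => _ /=; clear; lia.
by rewrite inE eqxx /= !addn0.
Qed.

End Colours.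

(** * The extremal graph for given parameters *)

Section Witness.
Variables (zeta q : nat).

Notation chain := (unit + ('I_zeta + 'I_q * bool))%type.

(** The [unit] summand is the bottom layer, ['I_zeta] gives the one-vertex layers, which are the
    cut-vertices, and ['I_q * bool] the two-vertex layers, which raise the domination number without
    adding cut-vertices. *)
Definition layer (t : chain) : nat := match t with
  | inl _ => 0
  | inr (inl i) => i.+1
  | inr (inr (i, _)) => zeta + i.+1
  end.

Let e := chain_rel core_rel core_gate (zeta + q) layer.

Lemma layer_le t : layer t <= zeta + q.
Proof.
case: t => [[]|[i|[i b]]] //=; last by rewrite leq_add2l.
by apply: leq_trans (ltn_ord i) _; exact: leq_addr.
Qed.

Lemma layer_onto j : j <= zeta + q -> exists t, layer t = j.
Proof.
case: j => [|j] lj; first by exists (inl tt).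
have [lt|le] := ltnP j zeta; first by exists (inr (inl (Ordinal lt))).
have lt : j - zeta < q by clear - lj le; lia.
by exists (inr (inr (Ordinal lt, true))) => /=; clear - le; lia.
Qed.

Lemma layer0 t : (layer t == 0) = (t == inl tt).
Proof. by case: t => [[]|[i|[i b]]] //=; rewrite addnS. Qed.

Lemma witness_simple : simple_graph e.
Proof. exact: chain_simple core_sym core_irr. Qed.

Lemma gate_proper : exists a, a \notin core_gate.
Proof. by exists (Ordinal (isT : 3 < 15)); rewrite inE. Qed.

Lemma witness_critical : gamma_c_critical (zeta + q + 4) e.
Proof.
exact: (chain_critical core_sym core_gate_clique gate_proper core_lower core_in core_out
  core_three core_three_add layer_le layer_onto layer0).
Qed.

Lemma witness_cut : #|cut_vertices e| = zeta.
Proof.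
have cutP := chain_cut core_sym gate_proper core_in core_out layer_le layer_onto layer0.
have cutN := chain_cut_core core_sym gate_proper core_in core_out layer_le layer_onto layer0.
rewrite -[RHS]card_ord -(@card_imset _ _ (fun i : 'I_zeta => inr (inr (inl i)) : core + chain));
  last by move=> i j [].
apply: eq_card => [[a|t]].
  by rewrite (negPf (cutN a)); apply/esym/negP => /imsetP[].
apply/cutP/imsetP => [[t0 uniq_t]|[i _ [->]]]; last first.
  split=> // [[[]|[j|[j b]]]] //=; first by case=> /val_inj->.
  by move=> eq; have := ltn_ord i; clear - eq; lia.
case: t t0 uniq_t => [[]|[i|[i b]]] //= _ uniq_t; first by exists i.
by have [] := uniq_t (inr (inr (i, ~~ b))) erefl; case: b {uniq_t}.
Qed.

Lemma witness_nontraceable : ~ traceable e.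
Proof.
have chk : all (fun x => all (fun y => (7 <= x) && (7 <= y) ==> ~~ adj x y) vertices) vertices.
  by vm_compute.
(* Outside the seven vertices of [E], each core vertex has its own colour, [7] to [14], and the
   chain has colour [15]: nine colours, while a path falls into at most eight pieces. *)
pose E (x : core + chain) := if x is inl a then a < 7 else false.
pose col (x : core + chain) : nat := if x is inl a then val a else 15.
case=> s [ss us sT].
have col_edge x y : e x y -> ~~ E x -> ~~ E y -> col x = col y.
  case: x y => [a|t] [b|t'] //=; rewrite ?inE -?leqNgt.
  - by move=> ab a7 b7; have := all_core (all_core chk a) b; rewrite a7 b7 (ab : adj a b).
  - by case/andP=> a3 _ a7; have := leq_trans a3 (leq_trans (isT : 3 <= 7) a7); rewrite ltnn.
  by case/andP=> b3 _ _ b7; have := leq_trans b3 (leq_trans (isT : 3 <= 7) b7); rewrite ltnn.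
have le7 : count E s <= 7.
  rewrite -size_filter -(size_map col); apply: leq_trans (_ : size (iota 0 7) <= 7) => //.
  apply: uniq_leq_size.
    rewrite map_inj_in_uniq ?filter_uniq // => [[a|t]] [b|t']; rewrite !mem_filter //=.
    by move=> _ _ /val_inj->.
  by move=> _ /mapP[[a|t] + ->]; rewrite mem_filter => /andP[a7 _] //; rewrite mem_iota.
have ge9 : 9 <= size (undup [seq col y | y <- s & ~~ E y]).
  apply: leq_trans (_ : size (iota 7 9) <= _) => //; apply: uniq_leq_size; first exact: iota_uniq.
  move=> j; rewrite mem_iota mem_undup => /andP[j7]; rewrite leq_eqVlt => /orP[/eqP[->]|j15].
    by apply/mapP; exists (inr (inl tt)); rewrite ?mem_filter ?sT.
  apply/mapP; exists (inl (Ordinal (j15 : j < 15))) => //.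
  by rewrite mem_filter sT andbT /= -leqNgt.
case: s ss {us sT} le7 ge9 => // x s ss le7 ge9.
have lt8 : (count E (x :: s)).+1 <= 8 := le7.
by have := leq_trans (leq_trans ge9 (leq_addr (E x) _)) (leq_trans (path_colours col_edge ss) lt8).
Qed.

End Witness.

Theorem theorem5p3 (k zeta : nat) (k_ge1 : 1 <= k) :
  (exists (T : finType) (e : rel T),
     [/\ simple_graph e, gamma_c_critical k e,
         #|cut_vertices e| = zeta & ~ traceable e])
  <-> (4 <= k /\ 0 <= zeta <= k - 4).
Proof.
split=> [[T [e [sG gk <- nT]]]|[k4 /andP[_ zk]]].
  by have := nontraceable_bounds sG gk nT; split; [|apply/andP; split]; lia.
(* Of the [k - 4] layers above the bottom one, [zeta] get a single vertex and the others two. *)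
have ek : k = zeta + (k - 4 - zeta) + 4 by lia.
exists (core + (unit + ('I_zeta + 'I_(k - 4 - zeta) * bool)))%type.
exists (chain_rel core_rel core_gate (zeta + (k - 4 - zeta)) (@layer zeta (k - 4 - zeta))).
split; [exact: witness_simple|rewrite {1}ek; exact: witness_critical|exact: witness_cut|].
exact: witness_nontraceable.
Qed.
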